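(* Let $k$ be an algebraically closed field of characteristic $0$, let $n,m\ge2$, and let $g(x)=\sum_{i=1}^n r_ix^i\in k[x]$, $f(y)=\sum_{i=1}^m s_iy^i\in k[y]$ with $r_n,s_m\ne0$. Assume that $g(x)$ either has degree at most $5$ or is a power of $x$, and that $f(y)$ either has degree at most $5$ or is a power of $y$. Let $\mathcal{C}$ be the plane curve $f(y)=g(x)$ and $\mathcal{O}(\mathcal{C})=k[x,y]/\langle g-f\rangle$. (i) The coordinate ring $\mathcal{O}(\mathcal{C})$ is a quantum homogeneous space of the Hopf algebra $A(g,f)$. (ii) $A(x,a,g)$ and $A(y,b,f)$ are Hopf subalgebras of $A(g,f)$, and $A(g,f)$ is faithfully flat over these subalgebras. (iii) Assume that $2\le m,n\le5$. Let $\{c_\ell : \ell\in\mathbb{Z}_{\ge0}\}$ be a $k$-basis for $\mathcal{O}(\mathcal{C})$. (a) $A(g,f)$ has PBW basis $$\{c_\ell\, w\, v\, a^ib^j : \ell\in\mathbb{Z}_{\ge0},\ w\in\langle\mathcal{L}_n(a,x)\rangle,\ v\in\langle\mathcal{L}_m(b,y)\rangle,\ i\in\mathbb{Z},\ 0\le j<m\}.$$ (b) $A(g,f)$ is a free left $\mathcal{O}(\mathcal{C})$-module with basis $$\{w\, v\, a^ib^j : w\in\langle\mathcal{L}_n(a,x)\rangle,\ v\in\langle\mathcal{L}_m(b,y)\rangle,\ i\in\mathbb{Z},\ 0\le j<m\}.$$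
   Context: For letters $u,v$ and $i,j\ge0$, $P(j,i)_{(u,v)}$ is the sum of all words in $u,v$ with exactly $j$ letters $u$ and $i$ letters $v$ ($P(0,0)=1$). $A(x,a,g)$ is the quotient of the free product $k[x]*k[a^{\pm1}]$ by the ideal generated by $\sum_{i=j}^n r_iP(j,i-j)_{(a,x)}-r_ja^n$, $1\le j\le n-1$; it is a Hopf algebra with $\Delta(a)=a\otimes a$, $\Delta(x)=1\otimes x+x\otimes a$, $\varepsilon(a)=1$, $\varepsilon(x)=0$, $S(a)=a^{-1}$, $S(x)=-xa^{-1}$. $A(y,b,f)$ is defined in the same way from $f$, with $(y,b,m,s_i)$ in place of $(x,a,n,r_i)$. Then $A(g,f):=\big(A(x,a,g)\otimes_kA(y,b,f)\big)/\langle g-f,\ a^n-b^m\rangle$, a Hopf algebra, where $x,a$ denote $x\otimes1,a\otimes1$ and $y,b$ denote $1\otimes y,1\otimes b$. The algebras $\mathcal{O}(\mathcal{C})$, $A(x,a,g)$, $A(y,b,f)$ map canonically to $A(g,f)$; the statements include that these maps are injective. $\mathcal{L}_n(a,x)=\{a^ix^j : i,j>0,\ i+j<n\}$, $\mathcal{L}_m(b,y)=\{b^iy^j : i,j>0,\ i+j<m\}$, and $\langle\mathcal{L}_n(a,x)\rangle$, $\langle\mathcal{L}_m(b,y)\rangle$ are the subsemigroups (including the empty word $1$) they generate in the free semigroups on $\{a,x\}$ and $\{b,y\}$. A quantum homogeneous space of a Hopf algebra $H$ is (here) a right coideal subalgebra $C$ ($\Delta(C)\subseteq C\otimes H$) such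 that $H$ is a faithfully flat right and left $C$-module. *)

(* Defs.v *)
From HB Require Import structures.
From mathcomp Require Import all_boot all_order all_algebra.
From mathcomp Require Import generic_quotient ring_quotient.
From mathcomp Require Import finmap boolp.
From mathcomp.multinomials Require Import mpoly.
From mathcomp.multinomials Require Import monalg.

Set Implicit Arguments.
Unset Strict Implicit.
Unset Printing Implicit Defensive.

Import GRing.Theory.
Local Open Scope ring_scope.
Local Open Scope quotient_scope.

Section AddGen.
Variables (V : zmodType) (S : V -> Prop).

Inductive add_gen : V -> Prop :=
| add_gen0 : add_gen 0
| add_genB u v : add_gen u -> add_gen v -> add_gen (u - v)
| add_gen_in s : S s -> add_gen s.

Definition add_gen_pred : {pred V} := fun v => `[< add_gen v >].

Lemma add_gen_predP v : reflect (add_gen v) (v \in add_gen_pred).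
Proof. exact: asboolP. Qed.

Fact add_gen_pred_closed : zmod_closed add_gen_pred.
Proof.
split; first by apply/add_gen_predP; constructor.
by move=> u v /add_gen_predP ? /add_gen_predP ?; apply/add_gen_predP; constructor.
Qed.
HB.instance Definition _ := GRing.isZmodClosed.Build V add_gen_pred
  add_gen_pred_closed.

Definition add_gen_closed : zmodClosed V := add_gen_pred.

Definition zquot : Type := Quotient.quot add_gen_closed.
HB.instance Definition _ := GRing.Zmodule.on zquot.

Definition zpi (v : V) : zquot := \pi_(Quotient.quot add_gen_closed) v.
Definition zrep (t : zquot) : V := repr (t : Quotient.quot add_gen_closed).

Lemma zrepK t : zpi (zrep t) = t. Proof. exact: reprK. Qed.

Lemma zpi_eq u v : zpi u = zpi v <-> add_gen (u - v).
Proof.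
have e : (u - v \in add_gen_pred) = (zpi u == zpi v).
  exact: (Quotient.idealrBE add_gen_closed).
by split=> [h|/add_gen_predP]; [apply/add_gen_predP; rewrite e h | rewrite e => /eqP].
Qed.

Fact zpi_is_zmod : zmod_morphism zpi.
Proof. exact: (raddfB \pi_(Quotient.quot add_gen_closed)). Qed.
HB.instance Definition _ := GRing.isZmodMorphism.Build V zquot zpi zpi_is_zmod.

Lemma zpi0 u : zpi u = 0 <-> add_gen u.
Proof. by rewrite -(raddf0 zpi) zpi_eq subr0. Qed.

End AddGen.

Section RingQuotient.
Variables (R : pzRingType) (S : R -> Prop).

Definition ideal_mul (u : R) : Prop :=
  exists l s r, S s /\ u = l * s * r.

Definition rquot : Type := zquot ideal_mul.
HB.instance Definition _ := GRing.Zmodule.on rquot.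

Definition rpi : R -> rquot := @zpi R ideal_mul.
HB.instance Definition _ := GRing.isZmodMorphism.Build R rquot rpi
  (@zpi_is_zmod R ideal_mul).

Lemma ideal_mulL w u : add_gen ideal_mul u -> add_gen ideal_mul (w * u).
Proof.
elim=> [|u1 u2 _ h1 _ h2|_ [l [s [r [Ss ->]]]]].
- by rewrite mulr0; constructor.
- by rewrite mulrBr; constructor.
by apply: add_gen_in; exists (w * l), s, r; rewrite !mulrA.
Qed.

Lemma ideal_mulR w u : add_gen ideal_mul u -> add_gen ideal_mul (u * w).
Proof.
elim=> [|u1 u2 _ h1 _ h2|_ [l [s [r [Ss ->]]]]].
- by rewrite mul0r; constructor.
- by rewrite mulrBl; constructor.
by apply: add_gen_in; exists l, s, (r * w); rewrite !mulrA.
Qed.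

Definition rquot_one : rquot := rpi 1.
Definition rquot_mul (p q : rquot) : rquot := rpi (zrep p * zrep q).

Lemma rpi_mul u v : rpi (u * v) = rquot_mul (rpi u) (rpi v).
Proof.
have h w : add_gen ideal_mul (w - zrep (rpi w)) by apply/zpi_eq; rewrite zrepK.
apply/zpi_eq; set u' := zrep (rpi u); set v' := zrep (rpi v).
have -> : u * v - u' * v' = (u - u') * v - - (u' * (v - v')).
  by rewrite opprK mulrBl mulrBr addrA subrK.
have N x : add_gen ideal_mul x -> add_gen ideal_mul (- x).
  by move=> ?; rewrite -sub0r; constructor=> //; constructor.
by constructor; [apply: ideal_mulR|apply/N/ideal_mulL].
Qed.

Fact rquot_mulA : associative rquot_mul.
Proof.
move=> p q r; rewrite -[p]zrepK -[q]zrepK -[r]zrepK -/rpi.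
by rewrite -!rpi_mul mulrA.
Qed.
Fact rquot_mul1r : left_id rquot_one rquot_mul.
Proof. by move=> p; rewrite -[p]zrepK -/rpi -rpi_mul mul1r. Qed.
Fact rquot_mulr1 : right_id rquot_one rquot_mul.
Proof. by move=> p; rewrite -[p]zrepK -/rpi -rpi_mul mulr1. Qed.
Fact rquot_mulDl : left_distributive rquot_mul +%R.
Proof.
move=> p q r; rewrite -[p]zrepK -[q]zrepK -[r]zrepK -/rpi.
by rewrite -raddfD -!rpi_mul mulrDl raddfD.
Qed.
Fact rquot_mulDr : right_distributive rquot_mul +%R.
Proof.
move=> p q r; rewrite -[p]zrepK -[q]zrepK -[r]zrepK -/rpi.
by rewrite -raddfD -!rpi_mul mulrDr raddfD.
Qed.
HB.instance Definition _ := GRing.Zmodule_isPzRing.Build rquot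
  rquot_mulA rquot_mul1r rquot_mulr1 rquot_mulDl rquot_mulDr.

Fact rpi_is_monoid : monoid_morphism rpi.
Proof. by split=> // u v; rewrite rpi_mul. Qed.
HB.instance Definition _ := GRing.isMonoidMorphism.Build R rquot rpi
  rpi_is_monoid.

End RingQuotient.

(* Left R-modules are [lmodType R] and right R-modules are [lmodType R^c]. *)
Definition restrL (R S : pzRingType) (h : {rmorphism R -> S}) : Type := S.
Definition restrR (R S : pzRingType) (h : {rmorphism R -> S}) : Type := S.

Section Restriction.
Variables (R S : pzRingType) (h : {rmorphism R -> S}).
Local Notation restrL := (restrL h).
Local Notation restrR := (restrR h).

HB.instance Definition _ := GRing.Zmodule.on restrL.
Definition restrL_scale (c : R) (u : restrL) : restrL := h c * (u : S).
Fact restrL_A a b u : restrL_scale a (restrL_scale b u) = restrL_scale (a * b) u.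
Proof. by rewrite /restrL_scale rmorphM mulrA. Qed.
Fact restrL_1 : left_id 1 restrL_scale.
Proof. by move=> u; rewrite /restrL_scale rmorph1 mul1r. Qed.
Fact restrL_Dr : right_distributive restrL_scale +%R.
Proof. by move=> a u v; rewrite /restrL_scale mulrDr. Qed.
Fact restrL_Dl u : {morph restrL_scale^~ u : a b / a + b}.
Proof. by move=> a b; rewrite /restrL_scale rmorphD mulrDl. Qed.
HB.instance Definition _ := GRing.Zmodule_isLmodule.Build R restrL
  restrL_A restrL_1 restrL_Dr restrL_Dl.

HB.instance Definition _ := GRing.Zmodule.on restrR.
Definition restrR_scale (c : R^c) (u : restrR) : restrR := (u : S) * h c.
Fact restrR_A a b u : restrR_scale a (restrR_scale b u) = restrR_scale (a * b) u.
Proof.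
rewrite /restrR_scale -mulrA; congr (_ * _); rewrite -rmorphM; by congr (h _).
Qed.
Fact restrR_1 : left_id 1 restrR_scale.
Proof. by move=> u; rewrite /restrR_scale (rmorph1 h) mulr1. Qed.
Fact restrR_Dr : right_distributive restrR_scale +%R.
Proof. by move=> a u v; rewrite /restrR_scale mulrDl. Qed.
Fact restrR_Dl u : {morph restrR_scale^~ u : a b / a + b}.
Proof. by move=> a b; rewrite /restrR_scale (rmorphD h) mulrDr. Qed.
HB.instance Definition _ := GRing.Zmodule_isLmodule.Build R^c restrR
  restrR_A restrR_1 restrR_Dr restrR_Dl.

End Restriction.

Section Tensor.
Variables (R : pzRingType) (M : lmodType R^c) (N : lmodType R).

Local Notation "[ m , n ]" := (<< (m, n) >> : {malg int[(M * N)%type]}).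

Inductive tensor_rel : {malg int[(M * N)%type]} -> Prop :=
| tensor_relDl m m' n : tensor_rel ([m + m', n] - [m, n] - [m', n])
| tensor_relDr m n n' : tensor_rel ([m, n + n'] - [m, n] - [m, n'])
| tensor_relZ m (c : R) n : tensor_rel ([(c : R^c) *: m, n] - [m, c *: n]).

Definition tensor : Type := zquot tensor_rel.
HB.instance Definition _ := GRing.Zmodule.on tensor.

Definition tens (m : M) (n : N) : tensor := zpi tensor_rel [m, n].

Fact tensDl m m' n : tens (m + m') n = tens m n + tens m' n.
Proof.
rewrite /tens -raddfD; apply/zpi_eq; rewrite opprD addrA.
exact/add_gen_in/tensor_relDl.
Qed.
Fact tensDr m n n' : tens m (n + n') = tens m n + tens m n'.
Proof.
rewrite /tens -raddfD; apply/zpi_eq; rewrite opprD addrA.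
exact/add_gen_in/tensor_relDr.
Qed.
Fact tensZ m (c : R) n : tens ((c : R^c) *: m) n = tens m (c *: n).
Proof. exact/zpi_eq/add_gen_in/tensor_relZ. Qed.

Lemma tens_ind (P : tensor -> Prop) :
    P 0 -> (forall s t, P s -> P t -> P (s - t)) ->
    (forall m n, P (tens m n)) -> forall t, P t.
Proof.
move=> P0 PB Pt t; rewrite -[t]zrepK.
have PN s : P s -> P (- s) by move=> Ps; rewrite -sub0r; apply: PB.
have PD s s' : P s -> P s' -> P (s + s') by move=> ? ?; rewrite -[s']opprK; apply/PB/PN.
have Pn m n (p : nat) : P (zpi tensor_rel << p%:Z *g (m, n)>>).
  elim: p => [|p IH]; first by rewrite monalgU0 raddf0.
  by rewrite -addn1 PoszD monalgUD raddfD; apply: PD => //; apply: Pt.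
rewrite [zrep t]monalgE raddf_sum /=; apply: big_ind => // -[m n] _.
case: (monalg.mcoeff _ _) => p; first exact: Pn.
by rewrite NegzE monalgUN raddfN; apply/PN/Pn.
Qed.

Section Lift.
Variables (V : zmodType) (phi : M -> N -> V).

Definition tlift_pre (s : {malg int[(M * N)%type]}) : V :=
  \sum_(p <- msupp s) phi p.1 p.2 *~ monalg.mcoeff p s.

(* The additive map [tens m n |-> phi m n]; meaningful (see [tliftE]) when
   [phi] is balanced. *)
Definition tlift (t : tensor) : V := tlift_pre (zrep t).

Lemma tlift_pre_additive : zmod_morphism tlift_pre.
Proof.
have E (d : {fset (M * N)%type}) s : (msupp s `<=` d)%fset ->
    tlift_pre s = \sum_(p <- d) phi p.1 p.2 *~ monalg.mcoeff p s.
  move=> le; rewrite /tlift_pre (big_fset_incl _ le) //= => p _ /mcoeff_outdom ->.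
  by rewrite mulr0z.
move=> s t; set d := (msupp s `|` msupp t)%fset.
rewrite (E d) ?msuppB_le // (E d s) ?fsubsetUl // (E d t) ?fsubsetUr //.
by rewrite -sumrB; apply: eq_bigr => p _; rewrite mcoeffB mulrzBr.
Qed.

Definition balanced : Prop :=
  [/\ forall m m' n, phi (m + m') n = phi m n + phi m' n,
      forall m n n', phi m (n + n') = phi m n + phi m n' &
      forall m (c : R) n, phi ((c : R^c) *: m) n = phi m (c *: n)].

Hypothesis bal : balanced.

Lemma tlift_preU m n : tlift_pre [m, n] = phi m n.
Proof.
rewrite /tlift_pre msuppU oner_eq0 big_seq_fset1 /= mcoeffUU.
by rewrite mulr1z.
Qed.

Lemma tlift_zpi s : tlift (zpi _ s) = tlift_pre s.
Proof.
pose HB := GRing.isZmodMorphism.Build _ _ tlift_pre tlift_pre_additive.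
pose F : {additive {malg int[(M * N)%type]} -> V} := HB.pack tlift_pre HB.
have ker u : add_gen tensor_rel u -> tlift_pre u = 0.
  have [Dl Dr Z] := bal.
  elim=> [|u1 u2 _ h1 _ h2|_ []]; first exact: (raddf0 F).
  - by rewrite tlift_pre_additive h1 h2 subrr.
  - move=> m m' n; rewrite !tlift_pre_additive !tlift_preU Dl.
    by rewrite addrAC addrK subrr.
  - move=> m n n'; rewrite !tlift_pre_additive !tlift_preU Dr.
    by rewrite addrAC addrK subrr.
  by move=> m c n; rewrite !tlift_pre_additive !tlift_preU Z subrr.
apply/eqP; rewrite -subr_eq0 -tlift_pre_additive; apply/eqP/ker.
by apply/zpi_eq; rewrite zrepK.
Qed.

Lemma tliftE m n : tlift (tens m n) = phi m n.
Proof. by rewrite tlift_zpi tlift_preU. Qed.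

Lemma tliftB s t : tlift (s - t) = tlift s - tlift t.
Proof.
by rewrite -[s]zrepK -[t]zrepK -raddfB !tlift_zpi tlift_pre_additive.
Qed.

End Lift.
End Tensor.

Arguments tens {R M N}.

Lemma tens_indA (R : pzRingType) (M : lmodType R^c) (N : lmodType R)
    (V : zmodType) (f g : tensor M N -> V) :
  zmod_morphism f -> zmod_morphism g ->
  (forall m n, f (tens m n) = g (tens m n)) -> f =1 g.
Proof.
move=> fB gB fg; apply: tens_ind => [|s t|//].
  by rewrite -(subrr 0) fB gB !subrr.
by rewrite fB gB => -> ->.
Qed.

Definition tmap (R : pzRingType) (M M' : lmodType R^c) (N N' : lmodType R)
    (f : M -> M') (g : N -> N') : tensor M N -> tensor M' N' :=
  tlift (fun m n => tens (f m) (g n)).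

(* A k-algebra is a ring with a ring morphism from k to its centre.  The
   library's [algType k] cannot be used for algebras given by generators and
   relations, as it requires [1 != 0]. *)
Record kalg (k : fieldType) := Kalg {
  kring :> pzRingType;
  kin : {rmorphism k -> kring};
  kcentral : forall c u, kin c * u = u * kin c }.
Arguments kin {k}.

Record kmor (k : fieldType) (A B : kalg k) := Kmor {
  kmor_fun :> {rmorphism A -> B};
  kmor_in : forall c, kmor_fun (kin A c) = kin B c }.

(* p.[u]; [horner_alg] would need a nonzero ring *)
Definition keval (k : fieldType) (A : kalg k) (p : {poly k}) (u : A) : A :=
  \sum_(i < size p) kin A p`_i * u ^+ i.

Section Algebras.
Variable k : fieldType.
Implicit Types A B : kalg k.

Definition kvect A : lmodType k := restrL (kin A).

Definition kself : kalg k :=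
  Kalg (kin := idfun) (fun c u : k => mulrC c u).

Section Quotient.
Variables (A : kalg k) (S : A -> Prop).

Definition kquot_in : {rmorphism k -> rquot S} := rpi S \o kin A.
Fact kquot_central c (u : rquot S) : kquot_in c * u = u * kquot_in c.
Proof. by rewrite -[u]zrepK -/(rpi S) /= -!rmorphM kcentral. Qed.
Definition kquot : kalg k := Kalg kquot_central.

Definition kpi : kmor A kquot :=
  @Kmor k A kquot (rpi S) (fun=> erefl).

End Quotient.

Section TensorAlgebra.
Variables A B : kalg k.

Definition ktensor : Type := tensor (restrR (kin A)) (restrL (kin B)).
HB.instance Definition _ := GRing.Zmodule.on ktensor.

Definition kt (a : A) (b : B) : ktensor :=
  @tens _ (restrR (kin A)) (restrL (kin B)) a b.

Lemma ktZ a c b : kt (a * kin A c) b = kt a (kin B c * b).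
Proof. exact: (@tensZ _ (restrR (kin A)) (restrL (kin B))). Qed.

Lemma ktDl a a' b : kt (a + a') b = kt a b + kt a' b.
Proof. exact: (@tensDl _ (restrR (kin A)) (restrL (kin B))). Qed.

Lemma ktDr a b b' : kt a (b + b') = kt a b + kt a b'.
Proof. exact: (@tensDr _ (restrR (kin A)) (restrL (kin B))). Qed.

Let bal2 (V : zmodType) (phi : A -> B -> V) :
  (forall a a' b, phi (a + a') b = phi a b + phi a' b) ->
  (forall a b b', phi a (b + b') = phi a b + phi a b') ->
  (forall a c b, phi (a * kin A c) b = phi a (kin B c * b)) ->
  @balanced _ (restrR (kin A)) (restrL (kin B)) V phi.
Proof. by move=> Dl Dr Z; split. Qed.

Definition ktensor_mul1 (a : A) (b : B) (t : ktensor) : ktensor :=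
  @tlift _ (restrR (kin A)) (restrL (kin B)) _
    (fun a' b' => kt (a * a') (b * b')) t.

Definition ktensor_mul (s t : ktensor) : ktensor :=
  @tlift _ (restrR (kin A)) (restrL (kin B)) _
    (fun a b => ktensor_mul1 a b t) s.

Let bal_mul1 a b : @balanced _ (restrR (kin A)) (restrL (kin B)) _
  (fun a' b' => kt (a * a') (b * b')).
Proof.
apply: bal2 => [a1 a2 b1|a1 b1 b2|a1 c b1].
- by rewrite mulrDr ktDl.
- by rewrite mulrDr ktDr.
by rewrite mulrA ktZ !mulrA kcentral.
Qed.

Let mul1E a b a' b' : ktensor_mul1 a b (kt a' b') = kt (a * a') (b * b').
Proof. exact: (tliftE (bal_mul1 a b)). Qed.

Let mul1B a b : zmod_morphism (ktensor_mul1 a b).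
Proof. exact: (tliftB (bal_mul1 a b)). Qed.

Let mul1_ext a b a1 b1 a2 b2 :
  (forall a' b', kt (a * a') (b * b') =
     kt (a1 * a') (b1 * b') + kt (a2 * a') (b2 * b')) ->
  forall t, ktensor_mul1 a b t = ktensor_mul1 a1 b1 t + ktensor_mul1 a2 b2 t.
Proof.
move=> h; apply: tens_indA => [|s t|m n]; first exact: mul1B.
  by rewrite !mul1B opprD addrACA.
by rewrite !mul1E.
Qed.

Let bal_mul t : @balanced _ (restrR (kin A)) (restrL (kin B)) _
  (fun a b => ktensor_mul1 a b t).
Proof.
apply: bal2 => [a1 a2 b1|a1 b1 b2|a1 c b1].
- by apply: mul1_ext => a b; rewrite mulrDl ktDl.
- by apply: mul1_ext => a b; rewrite mulrDl ktDr.
move: t; apply: tens_indA => [||a b]; try exact: mul1B.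
by rewrite !mul1E -mulrA kcentral mulrA ktZ mulrA.
Qed.

Lemma ktensor_mulE a b a' b' :
  ktensor_mul (kt a b) (kt a' b') = kt (a * a') (b * b').
Proof. by rewrite /ktensor_mul (tliftE (bal_mul _)) mul1E. Qed.

Let mulBl s s' t :
  ktensor_mul (s - s') t = ktensor_mul s t - ktensor_mul s' t.
Proof. exact: (tliftB (bal_mul t)). Qed.

Let mulBr s t t' :
  ktensor_mul s (t - t') = ktensor_mul s t - ktensor_mul s t'.
Proof.
move: s; apply: tens_indA => [s s'|s s'|a b]; rewrite ?mulBl //.
  by rewrite !opprD addrACA.
by rewrite /ktensor_mul !(tliftE (bal_mul _)) mul1B.
Qed.

Definition ktensor_one : ktensor := kt 1 1.

Fact ktensor_mulA : associative ktensor_mul.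
Proof.
move=> s t u; move: s; apply: tens_indA => [s s'|s s'|a b].
- by rewrite mulBl.
- by rewrite !mulBl.
move: t; apply: tens_indA => [t t'|t t'|a' b'].
- by rewrite mulBl mulBr.
- by rewrite mulBr mulBl.
move: u; apply: tens_indA => [t t'|t t'|c d].
- by rewrite !mulBr.
- by rewrite !mulBr.
by rewrite !ktensor_mulE !mulrA.
Qed.
Fact ktensor_mul1r : left_id ktensor_one ktensor_mul.
Proof.
apply: tens_indA => [s s'|s s'|a b]; [exact: mulBr | by [] |].
by rewrite ktensor_mulE !mul1r.
Qed.
Fact ktensor_mulr1 : right_id ktensor_one ktensor_mul.
Proof.
apply: tens_indA => [s s'|s s'|a b]; [exact: mulBl | by [] |].
by rewrite ktensor_mulE !mulr1.
Qed.
Fact ktensor_mulDl : left_distributive ktensor_mul +%R.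
Proof.
move=> s s' t; have := mulBl 0 0 t; rewrite !subrr => m0.
by rewrite -{1}[s']opprK mulBl -[- s']sub0r mulBl m0 sub0r opprK.
Qed.
Fact ktensor_mulDr : right_distributive ktensor_mul +%R.
Proof.
move=> t s s'; have := mulBr t 0 0; rewrite !subrr => m0.
by rewrite -{1}[s']opprK mulBr -[- s']sub0r mulBr m0 sub0r opprK.
Qed.
HB.instance Definition _ := GRing.Zmodule_isPzRing.Build ktensor
  ktensor_mulA ktensor_mul1r ktensor_mulr1 ktensor_mulDl ktensor_mulDr.

Lemma ktM a b a' b' : kt a b * kt a' b' = kt (a * a') (b * b').
Proof. exact: ktensor_mulE. Qed.

Definition ktl (a : A) : ktensor := kt a 1.
Definition ktr (b : B) : ktensor := kt 1 b.

Fact ktl_zmod : zmod_morphism ktl.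
Proof.
by move=> a a'; apply: (addIr (ktl a')); rewrite subrK /ktl -ktDl subrK.
Qed.
Fact ktl_monoid : monoid_morphism ktl.
Proof. by split=> // a a'; rewrite /ktl ktM mulr1. Qed.
HB.instance Definition _ := GRing.isZmodMorphism.Build A ktensor ktl ktl_zmod.
HB.instance Definition _ := GRing.isMonoidMorphism.Build A ktensor ktl ktl_monoid.

Fact ktr_zmod : zmod_morphism ktr.
Proof.
by move=> a a'; apply: (addIr (ktr a')); rewrite subrK /ktr -ktDr subrK.
Qed.
Fact ktr_monoid : monoid_morphism ktr.
Proof. by split=> // a a'; rewrite /ktr ktM mulr1. Qed.
HB.instance Definition _ := GRing.isZmodMorphism.Build B ktensor ktr ktr_zmod.
HB.instance Definition _ := GRing.isMonoidMorphism.Build B ktensor ktr ktr_monoid.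

Definition ktensor_in : {rmorphism k -> ktensor} := ktl \o kin A.
Fact ktensor_central c (u : ktensor) : ktensor_in c * u = u * ktensor_in c.
Proof.
move: u; apply: tens_indA => [s s'|s s'|a b]; [exact: mulrBr|exact: mulrBl|].
by rewrite -/(kt a b) /= /ktl !ktM kcentral mul1r mulr1.
Qed.
Definition ktens : kalg k := Kalg ktensor_central.

Definition kinl : kmor A ktens := @Kmor k A ktens ktl (fun=> erefl).
Fact kinr_in c : ktr (kin B c) = kin ktens c.
Proof. by rewrite /= /ktl -[kin A c]mul1r ktZ mulr1. Qed.
Definition kinr : kmor B ktens := @Kmor k B ktens ktr kinr_in.

End TensorAlgebra.
End Algebras.

Arguments kt {k A B}.

Definition kcomp (k : fieldType) (A B C : kalg k) (g : kmor B C) (f : kmor A B) :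
    kmor A C :=
  @Kmor k A C (kmor_fun g \o kmor_fun f)
    (fun c => etrans (congr1 g (kmor_in f c)) (kmor_in g c)).

Section TensorMaps.
Variable k : fieldType.
Implicit Types A B C : kalg k.

Definition klift A B (V : zmodType) (phi : A -> B -> V) : ktens A B -> V :=
  @tlift _ (restrR (kin A)) (restrL (kin B)) V phi.

Definition ktmap A A' B B' (f : A -> A') (g : B -> B') :
    ktens A B -> ktens A' B' :=
  klift (fun a b => kt (f a) (g b) : ktens A' B').

Lemma kliftE A B (V : zmodType) (phi : A -> B -> V) :
  (forall a a' b, phi (a + a') b = phi a b + phi a' b) ->
  (forall a b b', phi a (b + b') = phi a b + phi a b') ->
  (forall a c b, phi (a * kin A c) b = phi a (kin B c * b)) ->
  forall a b, klift phi (kt a b) = phi a b.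
Proof.
move=> Dl Dr Z a b; rewrite /klift /kt.
by apply: (@tliftE _ (restrR (kin A)) (restrL (kin B))); split.
Qed.

Lemma ktmapE A A' B B' (f : kmor A A') (g : kmor B B') a b :
  ktmap f g (kt a b) = kt (f a) (g b).
Proof.
rewrite /ktmap kliftE // => [a1 a2 b1|a1 b1 b2|a1 c b1].
- by rewrite rmorphD ktDl.
- by rewrite rmorphD ktDr.
by rewrite !rmorphM !kmor_in ktZ.
Qed.

Lemma kliftB A B (V : zmodType) (phi : A -> B -> V) :
  (forall a a' b, phi (a + a') b = phi a b + phi a' b) ->
  (forall a b b', phi a (b + b') = phi a b + phi a b') ->
  (forall a c b, phi (a * kin A c) b = phi a (kin B c * b)) ->
  zmod_morphism (klift phi).
Proof.
move=> Dl Dr Z s t.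
by apply: (@tliftB _ (restrR (kin A)) (restrL (kin B))); split.
Qed.

Lemma ktens_ext A B (V : zmodType) (f g : ktens A B -> V) :
  zmod_morphism f -> zmod_morphism g ->
  (forall a b, f (kt a b) = g (kt a b)) -> f =1 g.
Proof. exact: (@tens_indA _ (restrR (kin A)) (restrL (kin B))). Qed.

Section Associator.
Variables A B C : kalg k.

Definition kassoc1 (c : C) : ktens A B -> ktens A (ktens B C) :=
  klift (fun a b => kt a (kt b c : ktens B C) : ktens A (ktens B C)).

Definition kassoc : ktens (ktens A B) C -> ktens A (ktens B C) :=
  @klift (ktens A B) C _ (fun s c => kassoc1 c s).

Let Dl (c : C) (a a' : A) (b : B) :
  kt (a + a') (kt b c : ktens B C) = kt a (kt b c : ktens B C) + kt a' (kt b c : ktens B C).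
Proof. exact: ktDl. Qed.
Let Dr (c : C) (a : A) (b b' : B) :
  kt a (kt (b + b') c : ktens B C) = kt a (kt b c : ktens B C) + kt a (kt b' c : ktens B C).
Proof. by rewrite ktDl; apply: ktDr. Qed.
Let Z (c : C) (a : A) d (b : B) :
  kt (a * kin A d) (kt b c : ktens B C) = kt a (kt (kin B d * b) c : ktens B C).
Proof.
rewrite ktZ; congr kt; apply: etrans (ktM (kin B d) 1 b c) _.
by rewrite mul1r.
Qed.

Lemma kassoc1E c a b : kassoc1 c (kt a b) = kt a (kt b c : ktens B C).
Proof. exact: (kliftE (Dl c) (Dr c) (Z c)). Qed.

Lemma kassoc1B c : zmod_morphism (kassoc1 c).
Proof. exact: (kliftB (Dl c) (Dr c) (Z c)). Qed.

Lemma kassocE a b c :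
  kassoc (kt (kt a b : ktens A B) c) = kt a (kt b c : ktens B C).
Proof.
apply: etrans (kassoc1E c a b); apply: (@kliftE (ktens A B) C).
- move=> s t d.
  pose F := GRing.isZmodMorphism.Build _ _ (kassoc1 d) (kassoc1B d).
  exact: (raddfD (HB.pack_for {additive ktens A B -> ktens A (ktens B C)} (kassoc1 d) F)).
- move=> s d d'; move: s; apply: ktens_ext => [|s t|a' b'].
  + exact: kassoc1B.
  + by rewrite !kassoc1B opprD addrACA.
  rewrite !kassoc1E; apply: etrans (ktDr _ _ _); congr kt; exact: ktDr.
- move=> s d e; move: s; apply: ktens_ext => [s t|s t|a' b'].
  + by rewrite mulrBl; apply: kassoc1B.
  + exact: kassoc1B.
  apply: etrans (congr1 _ (ktM a' b' (kin A d) 1)) _.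
  rewrite mulr1 !kassoc1E.
  apply: etrans (Z _ _ _ _) _; congr kt.
  by rewrite kcentral; apply: ktZ.
Qed.

End Associator.

End TensorMaps.

Record hopf (k : fieldType) (H : kalg k) := Hopf {
  comul : kmor H (ktens H H);
  counit : kmor H (kself k);
  antipode : {additive H -> H};
  antipodeZ : forall c u, antipode (kin H c * u) = kin H c * antipode u;
  coassoc : forall h, kassoc (ktmap comul idfun (comul h)) =
                      ktmap idfun comul (comul h);
  counitl : forall h, klift (fun u v => kin H (counit u) * v) (comul h) = h;
  counitr : forall h, klift (fun u v => u * kin H (counit v)) (comul h) = h;
  antipodel : forall h,
    klift (fun u v => antipode u * v) (comul h) = kin H (counit h);
  antipoder : forall h,
    klift (fun u v => u * antipode v) (comul h) = kin H (counit h) }.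

(* An injective algebra morphism is read as the inclusion of a subalgebra. *)
Definition hopf_subalgebra (k : fieldType) (B H : kalg k)
    (DB : hopf B) (DH : hopf H) (iota : kmor B H) : Prop :=
  [/\ injective iota,
      forall b, comul DH (iota b) = ktmap iota iota (comul DB b),
      forall b, counit DH (iota b) = counit DB b &
      forall b, antipode DH (iota b) = iota (antipode DB b)].

Definition exact_at (X Y Z : zmodType) (f : X -> Y) (g : Y -> Z) : Prop :=
  forall y, g y = 0 <-> exists x, f x = y.

Definition faithfully_flat_right (R : pzRingType) (M : lmodType R^c) : Prop :=
  forall (X Y Z : lmodType R) (f : {linear X -> Y}) (g : {linear Y -> Z}),
    exact_at f g <->
    exact_at (tmap (idfun : M -> M) f) (tmap (idfun : M -> M) g).

Definition faithfully_flat_left (R : pzRingType) (M : lmodType R) : Prop :=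
  forall (X Y Z : lmodType R^c) (f : {linear X -> Y}) (g : {linear Y -> Z}),
    exact_at f g <->
    exact_at (tmap f (idfun : M -> M)) (tmap g (idfun : M -> M)).

Definition faithfully_flat_over (R S : pzRingType) (h : {rmorphism R -> S}) :=
  faithfully_flat_right (restrR h) /\ faithfully_flat_left (restrL h).

Definition quantum_homogeneous_space (k : fieldType) (C H : kalg k)
    (D : hopf H) (iota : kmor C H) : Prop :=
  [/\ injective iota,
      forall c, exists t : ktens C H, comul D (iota c) = ktmap iota idfun t &
      faithfully_flat_over iota].

(* [b] is a family indexed by the elements of [I] satisfying [D]. *)
Definition is_basis (R : pzRingType) (V : lmodType R) (I : eqType)
    (D : I -> Prop) (b : I -> V) : Prop :=
  (forall (s : seq I) (c : I -> R), uniq s -> (forall i, i \in s -> D i) ->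
     \sum_(i <- s) c i *: b i = 0 -> forall i, i \in s -> c i = 0) /\
  (forall v, exists (s : seq I) (c : I -> R),
     (forall i, i \in s -> D i) /\ v = \sum_(i <- s) c i *: b i).

(* A word in the letters u, v is a [seq bool]: [true] is u, [false] is v. *)
Definition weval (R : pzRingType) (u v : R) (w : seq bool) : R :=
  \prod_(c <- w) (if c then u else v).

(* P(j,i)_(u,v): all words with j letters u and i letters v *)
Definition Pword (R : pzRingType) (j i : nat) (u v : R) : R :=
  \sum_(w : (j + i).-tuple bool | count_mem true w == j) weval u v w.

(* L_n(u,v) *)
Definition Lword (n : nat) (w : seq bool) : Prop :=
  exists i j, [/\ (0 < i)%N, (0 < j)%N, (i + j < n)%N &
                  w = nseq i true ++ nseq j false].

(* <L_n(u,v)> *)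
Definition Lsemigroup (n : nat) (w : seq bool) : Prop :=
  exists ws : seq (seq bool),
    (forall s, s \in ws -> Lword n s) /\ w = flatten ws.

Section PlaneCurve.
Variable k : fieldType.

Fact kfree_central n (c : k) (u : {malg k[{fmonom 'I_n}]}) :
  c%:MP * u = u * c%:MP.
Proof.
rewrite !malgM_def fgmulUg fgmulgU; apply: eq_bigr => w _.
by rewrite mul1m mulm1 mulrC.
Qed.

Definition kfree (n : nat) : kalg k := Kalg (@kfree_central n).
Definition kletter n (i : 'I_n) : kfree n := << fmu i >>.

(* The free product k[x] * k[a^{+-1}], as k<x,a,a'> / (a a' - 1, a' a - 1) *)
Definition free_x : kfree 3 := kletter (inord 0).
Definition free_a : kfree 3 := kletter (inord 1).
Definition free_ai : kfree 3 := kletter (inord 2).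
Definition kfprod : kalg k :=
  @kquot k (kfree 3)
    (fun u => u = free_a * free_ai - 1 \/ u = free_ai * free_a - 1).
Definition fprod_x : kfprod := kpi _ free_x.
Definition fprod_a : kfprod := kpi _ free_a.
Definition fprod_ai : kfprod := kpi _ free_ai.

(* A(x,a,g), where n is the degree of g *)
Section OneVariable.
Variables (n : nat) (g : {poly k}).

Definition Aone_rel (u : kfprod) : Prop :=
  exists2 j : nat, (1 <= j < n)%N &
    u = \sum_(j <= i < n.+1) kin kfprod g`_i * Pword j (i - j) fprod_a fprod_x
        - kin kfprod g`_j * fprod_a ^+ n.

Definition Aone : kalg k := kquot Aone_rel.
Definition Aone_x : Aone := kpi Aone_rel fprod_x.
Definition Aone_a : Aone := kpi Aone_rel fprod_a.
Definition Aone_ai : Aone := kpi Aone_rel fprod_ai.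

End OneVariable.

(* A(g,f), where n and m are the degrees of g and f *)
Section TwoVariables.
Variables (n : nat) (g : {poly k}) (m : nat) (f : {poly k}).

Let T : kalg k := ktens (Aone n g) (Aone m f).

Definition Atwo_rel (u : T) : Prop :=
  u = keval g (kinl _ _ (Aone_x n g) : T) - keval f (kinr _ _ (Aone_x m f) : T)
  \/ u = (kinl _ _ (Aone_a n g) : T) ^+ n - (kinr _ _ (Aone_a m f) : T) ^+ m.

Definition Atwo : kalg k := kquot Atwo_rel.

Definition Atwo_l : kmor (Aone n g) Atwo :=
  kcomp (kpi Atwo_rel) (kinl (Aone n g) (Aone m f)).
Definition Atwo_r : kmor (Aone m f) Atwo :=
  kcomp (kpi Atwo_rel) (kinr (Aone n g) (Aone m f)).

Definition Atwo_x : Atwo := Atwo_l (Aone_x n g).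
Definition Atwo_a : Atwo := Atwo_l (Aone_a n g).
Definition Atwo_ai : Atwo := Atwo_l (Aone_ai n g).
Definition Atwo_y : Atwo := Atwo_r (Aone_x m f).
Definition Atwo_b : Atwo := Atwo_r (Aone_a m f).
Definition Atwo_bi : Atwo := Atwo_r (Aone_ai m f).

End TwoVariables.

(* O(C) = k[x,y] / <g(x) - f(y)> *)
Definition kpoly2 : kalg k :=
  @Kalg k (mpoly.mpoly 2 k : comNzRingType) (@mpoly.mpolyC 2 k)
    (fun c u => mulrC _ u).
Definition poly2_x : kpoly2 := mpoly.mpolyX k (mpoly.mnm1 (inord 0 : 'I_2)).
Definition poly2_y : kpoly2 := mpoly.mpolyX k (mpoly.mnm1 (inord 1 : 'I_2)).

Definition curve_rel (g f : {poly k}) (u : kpoly2) : Prop :=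
  u = keval g poly2_x - keval f poly2_y.
Definition curve (g f : {poly k}) : kalg k := kquot (curve_rel g f).
Definition curve_x g f : curve g f := kpi (curve_rel g f) poly2_x.
Definition curve_y g f : curve g f := kpi (curve_rel g f) poly2_y.

End PlaneCurve.

(* The Hopf structure prescribed on generators; [ai] is the inverse of [a]. *)
Definition hopf_on (k : fieldType) (H : kalg k) (D : hopf H) (x a ai : H) :=
  [/\ comul D a = kt a a /\ comul D x = kt 1 x + kt x a,
      counit D a = 1 /\ counit D x = 0 &
      antipode D a = ai /\ antipode D x = - (x * ai)].

(* a^i for i : int, given the inverse [ai] of [a] *)
Definition zpow (R : pzRingType) (a ai : R) (i : int) : R :=
  match i with Posz p => a ^+ p | Negz p => ai ^+ p.+1 end.

(* The word [w] is in the letters a, x and [v] is in the letters b, y. *)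
Definition pbw_index := (seq bool * seq bool * int * nat)%type.

Definition pbw_dom (n m : nat) (p : pbw_index) : Prop :=
  let: (w, v, i, j) := p in
  [/\ Lsemigroup n w, Lsemigroup m v & (j < m)%N].

Definition pbw_elt (k : fieldType) (n : nat) (g : {poly k}) (m : nat)
    (f : {poly k}) (p : pbw_index) : Atwo n g m f :=
  let: (w, v, i, j) := p in
  weval (Atwo_a n g m f) (Atwo_x n g m f) w
  * weval (Atwo_b n g m f) (Atwo_y n g m f) v
  * zpow (Atwo_a n g m f) (Atwo_ai n g m f) i
  * Atwo_b n g m f ^+ j.

(* Main.v *)
Require Import Defs.
From HB Require Import structures.
From mathcomp Require Import all_boot all_order all_algebra.
From mathcomp Require Import boolp functions.
From mathcomp Require finmap.
From mathcomp.multinomials Require monalg mpoly ssrcomplements.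
From mathcomp Require Import zify.

Set Implicit Arguments.
Unset Strict Implicit.
Unset Printing Implicit Defensive.

Import GRing.Theory.
Local Open Scope ring_scope.

(** Let t be a central indeterminate and let q(i,l) be the coefficient of t^l
    in (x + t a)^i, the sum of all words with l letters a and i - l letters x.
    The coefficient of t^l in g(x + t a) is then E_l = sum_i r_i q(i,l), and
    the relations of A(x,a,g) say that E_l = r_l a^n for all l > 0, that is,
    g(x + t a) = g(x) + g(t) a^n ([additive_pair]).

    Comparing the coefficients of (x + t a) g(x + t a) = g(x + t a) (x + t a)
    shows that a^n commutes with x and that g(x) commutes with a.  Substituting
    one pair into the other shows that (1 @ x + x @ a, a @ a) again satisfies
    the relations, and a similar substitution treats (- x a^-1, a^-1); the
    relations being symmetric under reversal of words, the latter pair also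
    defines an anti-morphism.  This gives the Hopf structures, and also
    g(x) |-> 1 @ g(x) + g(x) @ a^n, so that the relations g = f and a^n = b^m
    of A(g,f) are compatible with them.

    The bases come from representations instead of rewriting.  Among the words
    of the j-th relation, 0 < j < n, the word a^j x^(n-j) is taken as leading
    word; the normal words are then x^l w a^s a^(n q), where w is a product of
    blocks a^i x^t with i, t > 0 and i + t < n, and s < n; the powers x^l and
    a^(n q) are treated as coefficients.  Given commuting operators xi and gam
    on a space B, with gam invertible, the algebra
    A(x,a,g) acts on the functions that send a state (w, s) to B
    ([state_act]): multiplication by a shifts s and wraps around through gam,
    x lengthens the word, acts by xi at the empty word, and is defined by
    recursion through the relation when a leading word appears.  The recursion
    terminates because every other word of the relation stays below a numerical
    rank ([Rel_tail]).  At s = 0 the relations hold by construction, and the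
    commutation identity above propagates them to all states by descending
    induction on j.  The value of w a^s phi at the empty state is phi (w, s),
    so that normal words are linearly independent; the same rank induction,
    read in the algebra itself, shows that they span ([Aone_spanning]).

    A(g,f) acts on the states of the second factor with values in B as soon as
    B is a module over A(x,a,g) with an operator xi that commutes with it and
    satisfies f(xi) = g(x) ([Atwo_act]).  Taking for B the states of the first
    factor with values in the functions from Z to O(C) gives coordinates of
    A(g,f) over O(C) dual to the PBW words ([pbw_left_coordinates]); taking for
    B the companion module of the equation f(Y) = g(x) over A(x,a,g) gives
    coordinates over A(x,a,g) ([factor_left_coordinates]).

    A family with dual coordinate maps is a basis, its base ring embeds, and
    exactness can be tested on coordinates, hence faithful flatness on the
    left.  The anti-automorphism of A(g,f) that fixes the generators exchanges
    left and right, and exchanging (x, a, g) with (y, b, f) carries the result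
    from one factor to the other. *)

(** * Additive maps and inverses *)

Lemma zmod_sum (V W : zmodType) (p : V -> W) (I : Type) (s : seq I) (F : I -> V) :
  zmod_morphism p -> p (\sum_(i <- s) F i) = \sum_(i <- s) p (F i).
Proof.
move=> pB; pose M := GRing.isZmodMorphism.Build _ _ p pB.
exact: (raddf_sum (HB.pack_for {additive V -> W} p M)).
Qed.

Lemma zmod0 (V W : zmodType) (p : V -> W) : zmod_morphism p -> p 0 = 0.
Proof. by move=> pB; rewrite -(subrr 0) pB subrr. Qed.

Lemma zmodD (V W : zmodType) (p : V -> W) u v : zmod_morphism p -> p (u + v) = p u + p v.
Proof.
move=> pB; pose M := GRing.isZmodMorphism.Build _ _ p pB.
exact: (raddfD (HB.pack_for {additive V -> W} p M)).
Qed.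

Lemma lead_coef_neq0 (k : fieldType) n (g : {poly k}) : size g = n.+1 -> g`_n != 0.
Proof.
move=> deg_g; have -> : g`_n = lead_coef g by rewrite lead_coefE deg_g.
by rewrite lead_coef_eq0 -size_poly_eq0 deg_g.
Qed.

Lemma expr_invl (R : pzRingType) (x y : R) n :
  x * y = 1 -> GRing.comm x y -> x ^+ n * y ^+ n = 1.
Proof. by move=> xy cxy; rewrite -exprMn_comm // xy expr1n. Qed.

Lemma expr_inv (R : pzRingType) (u v : R) i : u * v = 1 -> v * u = 1 ->
  u ^+ i * v ^+ i = 1.
Proof. by move=> uv vu; apply: expr_invl; rewrite // /GRing.comm uv. Qed.

Lemma inverse_expr_eq (R : pzRingType) (u v w z : R) n m :
  u * v = 1 -> v * u = 1 -> w * z = 1 -> z * w = 1 ->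
  u ^+ n = w ^+ m -> v ^+ n = z ^+ m.
Proof.
move=> uv vu wz zw uw.
by rewrite -[LHS]mulr1 -(expr_inv m wz zw) mulrA -uw (expr_inv n vu uv) mul1r.
Qed.

Lemma inverse_unique (R : pzRingType) (u v w : R) : v * u = 1 -> u * w = 1 -> v = w.
Proof. by move=> vu uw; rewrite -[v]mulr1 -uw mulrA vu mul1r. Qed.

(** * Generators and universal properties of quotients and tensor products *)
Section Generation.
Variable k : fieldType.
Implicit Types A B C : kalg k.

(** Subalgebras are predicates, so that an identity between morphisms, or any
    property stable under the operations, is proved on generators only. *)
Definition subalgebra A (P : A -> Prop) : Prop :=
  [/\ forall c, P (kin A c), forall u v, P u -> P v -> P (u - v) &
      forall u v, P u -> P v -> P (u * v)].

Definition generated A (G : A -> Prop) : Prop :=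
  forall P, subalgebra P -> (forall u, G u -> P u) -> forall u, P u.

Lemma kmor_ext A B (G : A -> Prop) (f g : kmor A B) :
  generated G -> (forall u, G u -> f u = g u) -> f =1 g.
Proof.
move=> genG fg; apply: genG fg; split=> [c|u v|u v].
- by rewrite !kmor_in.
- by rewrite !rmorphB => -> ->.
- by rewrite !rmorphM => -> ->.
Qed.

Lemma generated_sub A (G G' : A -> Prop) :
  generated G -> (forall P, subalgebra P -> (forall u, G' u -> P u) ->
     forall u, G u -> P u) -> generated G'.
Proof. by move=> genG GG' P subP G'P; apply: genG => //; apply: GG'. Qed.

Lemma generated_kpi A (S : A -> Prop) (G : A -> Prop) :
  generated G -> generated (fun v : kquot S => exists2 u, G u & v = kpi S u).
Proof.
move=> genG P [Pk PB PM] GP v.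
have -> : v = kpi S (zrep v) by rewrite -[LHS]zrepK.
apply: (genG (fun u => P (kpi S u))) => [|u Gu]; last by apply: GP; exists u.
split=> [c|u w|u w]; first exact: Pk.
  by rewrite rmorphB; apply: PB.
by move=> Pu Pw; rewrite rmorphM; apply: PM.
Qed.

Lemma subalgebra1 A (P : A -> Prop) : subalgebra P -> P 1.
Proof. by case=> Pk _ _; rewrite -(rmorph1 (kin A)). Qed.

Lemma subalgebra0 A (P : A -> Prop) : subalgebra P -> P 0.
Proof. by case=> Pk _ _; rewrite -(rmorph0 (kin A)). Qed.

Lemma subalgebraD A (P : A -> Prop) u v : subalgebra P -> P u -> P v -> P (u + v).
Proof.
move=> sP Pu Pv; have P0 := subalgebra0 sP; have [_ PB _] := sP.
by rewrite -[v]opprK; apply: (PB) => //; rewrite -sub0r; apply: (PB).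
Qed.

Lemma generated_tens A B :
  generated (fun t : ktens A B =>
    (exists a, t = kinl A B a) \/ (exists b, t = kinr A B b)).
Proof.
move=> P sP GP; have [Pk PB PM] := sP.
apply: (@tens_ind _ (restrR (kin A)) (restrL (kin B))); first exact: subalgebra0 sP.
  exact: PB.
move=> a b; have := PM _ _ (GP _ (or_introl (ex_intro _ a erefl)))
  (GP _ (or_intror (ex_intro _ b erefl))).
by rewrite /= /ktl /ktr ktM mulr1 mul1r.
Qed.

Section QuotientLift.
Variables (A B : kalg k) (S : A -> Prop) (f : kmor A B).
Hypothesis fS : forall u, S u -> f u = 0.

Definition kquot_fun (t : kquot S) : B := f (zrep t).

Lemma kquot_funE u : kquot_fun (kpi S u) = f u.
Proof.
have ker v : add_gen (ideal_mul S) v -> f v = 0.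
  elim=> [|u1 u2 _ h1 _ h2|_ [l [s [r [Ss ->]]]]]; first exact: rmorph0.
    by rewrite rmorphB h1 h2 subrr.
  by rewrite !rmorphM (fS Ss) mulr0 mul0r.
apply/eqP; rewrite -subr_eq0 /kquot_fun -rmorphB; apply/eqP/ker.
by apply/zpi_eq; rewrite zrepK.
Qed.

Let pre t : exists u, t = kpi S u.
Proof. by exists (zrep t); rewrite -[LHS]zrepK. Qed.

Fact kquot_fun_zmod : zmod_morphism kquot_fun.
Proof.
move=> s t; have [u ->] := pre s; have [v ->] := pre t.
by rewrite -rmorphB !kquot_funE rmorphB.
Qed.
Fact kquot_fun_monoid : monoid_morphism kquot_fun.
Proof.
split; first by rewrite -(rmorph1 (kpi S)) kquot_funE rmorph1.
move=> s t; have [u ->] := pre s; have [v ->] := pre t.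
by rewrite -rmorphM !kquot_funE rmorphM.
Qed.
HB.instance Definition _ :=
  GRing.isZmodMorphism.Build (kquot S) B kquot_fun kquot_fun_zmod.
HB.instance Definition _ :=
  GRing.isMonoidMorphism.Build (kquot S) B kquot_fun kquot_fun_monoid.

Definition kquot_lift : kmor (kquot S) B.
Proof.
apply: (@Kmor k (kquot S) B kquot_fun) => c.
exact: etrans (kquot_funE _) (kmor_in f c).
Defined.

Lemma kquot_liftE u : kquot_lift (kpi S u) = f u.
Proof. exact: kquot_funE. Qed.

End QuotientLift.

Lemma kpi_rel A (S : A -> Prop) u : S u -> kpi S u = 0.
Proof.
move=> Su; apply/zpi0/add_gen_in; exists 1, u, 1.
by rewrite mul1r mulr1.
Qed.

Section TensorLift.
Variables (A B C : kalg k) (f : kmor A C) (g : kmor B C).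
Hypothesis fg : forall a b, f a * g b = g b * f a.

Definition ktens_fun : ktens A B -> C := klift (fun a b => f a * g b).

Let Dl a a' b : f (a + a') * g b = f a * g b + f a' * g b.
Proof. by rewrite rmorphD mulrDl. Qed.
Let Dr a b b' : f a * g (b + b') = f a * g b + f a * g b'.
Proof. by rewrite rmorphD mulrDr. Qed.
Let Z a c b : f (a * kin A c) * g b = f a * g (kin B c * b).
Proof. by rewrite !rmorphM !kmor_in mulrA. Qed.

Lemma ktens_funE a b : ktens_fun (kt a b) = f a * g b.
Proof. exact: (kliftE Dl Dr Z). Qed.

Fact ktens_fun_zmod : zmod_morphism ktens_fun.
Proof. exact: (kliftB Dl Dr Z). Qed.
HB.instance Definition _ :=
  GRing.isZmodMorphism.Build (ktens A B) C ktens_fun ktens_fun_zmod.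

Fact ktens_fun_monoid : monoid_morphism ktens_fun.
Proof.
split; first by rewrite ktens_funE !rmorph1 mulr1.
move=> s t; move: s; apply: ktens_ext => [u v|u v|a b].
- by rewrite mulrBl raddfB.
- by rewrite raddfB mulrBl.
move: t; apply: ktens_ext => [u v|u v|a' b'].
- by rewrite mulrBr raddfB.
- by rewrite raddfB mulrBr.
rewrite ktM !ktens_funE !rmorphM -!mulrA; congr (_ * _).
by rewrite !mulrA fg.
Qed.
HB.instance Definition _ :=
  GRing.isMonoidMorphism.Build (ktens A B) C ktens_fun ktens_fun_monoid.

Definition ktens_lift : kmor (ktens A B) C.
Proof.
apply: (@Kmor k (ktens A B) C ktens_fun) => c.
by apply: etrans (ktens_funE _ _) _; rewrite kmor_in rmorph1 mulr1.
Defined.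

Lemma ktens_liftE a b : ktens_lift (kt a b) = f a * g b.
Proof. exact: ktens_funE. Qed.

Lemma ktens_lift_l a : ktens_lift (kinl A B a) = f a.
Proof. by apply: etrans (ktens_liftE a 1) _; rewrite rmorph1 mulr1. Qed.
Lemma ktens_lift_r b : ktens_lift (kinr A B b) = g b.
Proof. by apply: etrans (ktens_liftE 1 b) _; rewrite rmorph1 mul1r. Qed.
End TensorLift.

Definition kid A : kmor A A := @Kmor k A A idfun (fun=> erefl).

Lemma ktE A B (a : A) (b : B) : kt a b = kinl A B a * kinr A B b.
Proof. by rewrite /= /ktl /ktr ktM mulr1 mul1r. Qed.

Lemma kinlr_comm A B (a : A) (b : B) :
  kinl A B a * kinr A B b = kinr A B b * kinl A B a.
Proof. by rewrite /= /ktl /ktr !ktM !mulr1 !mul1r. Qed.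

Lemma kcompE A B C (g : kmor B C) (f : kmor A B) u : kcomp g f u = g (f u).
Proof. by []. Qed.

Section TensorMap.
Variables (A A' B B' : kalg k) (f : kmor A A') (g : kmor B B').

Definition ktmap_mor : kmor (ktens A B) (ktens A' B') :=
  ktens_lift (f := kcomp (kinl A' B') f) (g := kcomp (kinr A' B') g)
    (fun a b => kinlr_comm (f a) (g b)).

Lemma ktmap_morE t : ktmap_mor t = ktmap f g t.
Proof.
move: t; apply: ktens_ext => [u v|u v|a b]; first exact: rmorphB.
  apply: kliftB => [a a' b|a b b'|a c b]; rewrite ?rmorphD ?ktDl ?ktDr //.
  by rewrite !rmorphM !kmor_in ktZ.
by rewrite [RHS]ktmapE [LHS]ktens_liftE !kcompE -ktE.
Qed.

Lemma ktmap_mor_kt a b : ktmap_mor (kt a b) = kt (f a) (g b).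
Proof. by rewrite ktmap_morE; apply: ktmapE. Qed.
End TensorMap.

Lemma kmor_comm A B (f : kmor A B) u v :
  u * v = v * u -> f u * f v = f v * f u.
Proof. by move=> uv; rewrite -[LHS]rmorphM uv rmorphM. Qed.

Section Assoc.
Variables A B C : kalg k.

Let ABC := ktens A (ktens B C).
Let iA : kmor A ABC := kinl _ _.
Let iB : kmor B ABC := kcomp (kinr A (ktens B C)) (kinl B C).
Let iC : kmor C ABC := kcomp (kinr A (ktens B C)) (kinr B C).

Let cAB a b : iA a * iB b = iB b * iA a.
Proof. exact: kinlr_comm. Qed.
Let cABC t c : ktens_lift cAB t * iC c = iC c * ktens_lift cAB t.
Proof.
move: t; apply: ktens_ext => [u v|u v|a b].
- by rewrite rmorphB mulrBl.
- by rewrite rmorphB mulrBr.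
have iBC : iB b * iC c = iC c * iB b.
  exact: (kmor_comm (kinr A (ktens B C)) (kinlr_comm b c)).
have iAC : iA a * iC c = iC c * iA a by exact: kinlr_comm.
rewrite ktens_liftE; exact/esym/(commrM (esym iAC) (esym iBC)).
Qed.

Definition kassoc_mor : kmor (ktens (ktens A B) C) ABC := ktens_lift cABC.

Lemma kassocB : zmod_morphism (@kassoc k A B C).
Proof.
apply: kliftB => [a a' b|a b b'|a c b].
- have F := GRing.isZmodMorphism.Build _ _ (kassoc1 b) (@kassoc1B _ A B C b).
  exact: (raddfD (HB.pack_for {additive ktens A B -> ABC} (kassoc1 b) F)).
- move: a; apply: ktens_ext => [|u' v'|a1 b1]; first exact: kassoc1B.
    by rewrite !kassoc1B opprD addrACA.
  by rewrite !kassoc1E; apply: etrans (ktDr _ _ _); congr kt; exact: ktDr.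
- move: a; apply: ktens_ext => [u' v'|u' v'|a1 b1].
  + by rewrite mulrBl kassoc1B.
  + exact: kassoc1B.
  apply: etrans (congr1 _ (ktM a1 b1 (kin A c) 1)) _.
  rewrite mulr1 !kassoc1E ktZ; congr kt.
  by apply: etrans (ktM _ _ _ _) _; rewrite mul1r kcentral ktZ.
Qed.

(** The associator is multiplicative, which makes coassociativity an equality
    of two algebra morphisms. *)
Lemma kassoc_morE t : kassoc_mor t = kassoc t.
Proof.
move: t; apply: ktens_ext => [u v|u v|s c]; [exact: rmorphB|exact: kassocB|].
have subl u v : kt (u - v : ktens A B) c = kt u c - kt v c.
  by apply: (addIr (kt v c)); rewrite subrK -ktDl subrK.
move: s; apply: ktens_ext => [u v|u v|a b].
- by rewrite subl rmorphB.
- by rewrite subl kassocB.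
rewrite [RHS]kassocE; apply: etrans (ktens_liftE _ _ _) _.
rewrite ktens_liftE; apply: etrans (esym (mulrA _ _ _)) _.
by rewrite [RHS]ktE [kt b c]ktE rmorphM.
Qed.

Lemma kassoc_mor_kt a b c : kassoc_mor (kt (kt a b : ktens A B) c) = kt a (kt b c : ktens B C).
Proof. by rewrite kassoc_morE; apply: kassocE. Qed.
End Assoc.
End Generation.

(** * Hopf algebra axioms checked on generators *)
Section Opposite.
Variables (k : fieldType) (A : kalg k).

Definition kop_in (c : k) : A^c := kin A c.
Fact kop_in_zmod : zmod_morphism kop_in.
Proof. exact: (rmorphB (kin A)). Qed.
Fact kop_in_monoid : monoid_morphism kop_in.
Proof.
split=> [|c d]; first exact: (rmorph1 (kin A)).
by rewrite /kop_in mulrC; apply: (rmorphM (kin A)).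
Qed.
HB.instance Definition _ := GRing.isZmodMorphism.Build k A^c kop_in kop_in_zmod.
HB.instance Definition _ := GRing.isMonoidMorphism.Build k A^c kop_in kop_in_monoid.

(** Algebra morphisms into the opposite algebra are the anti-morphisms; the
    antipode and the reversal of words are built in this way. *)
Definition kop : kalg k :=
  @Kalg k A^c kop_in (fun c u => esym (kcentral c (u : A))).
End Opposite.

Section AntiMorphisms.
Variables (k : fieldType) (A B : kalg k) (S : kmor A (kop B)).

Definition anti (u : A) : B := S u.

Lemma antiM u v : anti (u * v) = anti v * anti u.
Proof. exact: (rmorphM S). Qed.
Lemma antiB : zmod_morphism anti.
Proof. exact: (rmorphB S). Qed.
Lemma anti1 : anti 1 = 1.
Proof. exact: (rmorph1 S). Qed.
Lemma anti_in c : anti (kin A c) = kin B c.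
Proof. exact: (kmor_in S). Qed.
HB.instance Definition _ := GRing.isZmodMorphism.Build A B anti antiB.
End AntiMorphisms.

Section HopfBuild.
Variables (k : fieldType) (H : kalg k).
Variables (Delta : kmor H (ktens H H)) (eps : kmor H (kself k)).
Variable (S : kmor H (kop H)).

Let Phi : ktens H H -> H := klift (fun u v => anti S u * v).
Let Psi : ktens H H -> H := klift (fun u v => u * anti S v).

Definition hopf_axioms_at (h : H) : Prop :=
  [/\ kassoc (ktmap Delta idfun (Delta h)) = ktmap idfun Delta (Delta h),
      klift (fun u v => kin H (eps u) * v) (Delta h) = h,
      klift (fun u v => u * kin H (eps v)) (Delta h) = h,
      klift (fun u v => anti S u * v) (Delta h) = kin H (eps h) &
      klift (fun u v => u * anti S v) (Delta h) = kin H (eps h)].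

Let kunit : kmor (kself k) H := @Kmor k (kself k) H (kin H) (fun=> erefl).

Let coL := kcomp (kassoc_mor H H H) (kcomp (ktmap_mor Delta (kid H)) Delta).
Let coR := kcomp (ktmap_mor (kid H) Delta) Delta.
Let coLE u : coL u = kassoc (ktmap Delta idfun (Delta u)).
Proof. by rewrite /coL !kcompE kassoc_morE ktmap_morE. Qed.
Let coRE u : coR u = ktmap idfun Delta (Delta u).
Proof. by rewrite /coR !kcompE ktmap_morE. Qed.

Let coL_def u : coL u = kassoc_mor H H H (ktmap_mor Delta (kid H) (Delta u)).
Proof. by rewrite /coL !kcompE. Qed.
Let coR_def u : coR u = ktmap_mor (kid H) Delta (Delta u).
Proof. by rewrite /coR !kcompE. Qed.

Let unitL : kmor (ktens H H) H := ktens_lift (f := kcomp kunit eps) (g := kid H)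
  (fun a b => kcentral (eps a) b).
Let unitR : kmor (ktens H H) H := ktens_lift (f := kid H) (g := kcomp kunit eps)
  (fun a b => esym (kcentral (eps b) a)).

Let unitLE a b : unitL (kt a b) = kin H (eps a) * b.
Proof. exact: ktens_liftE. Qed.
Let unitRE a b : unitR (kt a b) = a * kin H (eps b).
Proof. exact: ktens_liftE. Qed.

Let PhiDl a a' b : anti S (a + a') * b = anti S a * b + anti S a' * b.
Proof. by rewrite raddfD mulrDl. Qed.
Let PhiDr a b b' : anti S a * (b + b') = anti S a * b + anti S a * b'.
Proof. by rewrite mulrDr. Qed.
Let PhiZ a c b : anti S (a * kin H c) * b = anti S a * (kin H c * b).
Proof. by rewrite antiM anti_in kcentral mulrA. Qed.
Let PhiE a b : Phi (kt a b) = anti S a * b.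
Proof. exact: (kliftE PhiDl PhiDr PhiZ). Qed.
Let PhiB : zmod_morphism Phi.
Proof. exact: (kliftB PhiDl PhiDr PhiZ). Qed.

Let PsiDl a a' b : (a + a') * anti S b = a * anti S b + a' * anti S b.
Proof. by rewrite mulrDl. Qed.
Let PsiDr a b b' : a * anti S (b + b') = a * anti S b + a * anti S b'.
Proof. by rewrite raddfD mulrDr. Qed.
Let PsiZ a c b : (a * kin H c) * anti S b = a * anti S (kin H c * b).
Proof. by rewrite antiM anti_in -[in RHS]kcentral mulrA. Qed.
Let PsiE a b : Psi (kt a b) = a * anti S b.
Proof. exact: (kliftE PsiDl PsiDr PsiZ). Qed.
Let PsiB : zmod_morphism Psi.
Proof. exact: (kliftB PsiDl PsiDr PsiZ). Qed.

Lemma grouplike_hopf_axioms u v : u * v = 1 -> v * u = 1 ->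
  Delta u = kt u u -> eps u = 1 -> anti S u = v -> hopf_axioms_at u.
Proof.
move=> uv vu Du eu Su; rewrite /hopf_axioms_at -coLE -coRE Du -/Phi -/Psi.
split.
- rewrite coL_def coR_def Du (ktmap_mor_kt Delta (kid H) u u).
  rewrite (ktmap_mor_kt (kid H) Delta u u) Du.
  exact: (kassoc_mor_kt u u u).
- by apply: etrans (unitLE u u) _; rewrite eu rmorph1 mul1r.
- by apply: etrans (unitRE u u) _; rewrite eu rmorph1 mulr1.
- by rewrite PhiE Su vu eu rmorph1.
- by rewrite PsiE Su uv eu rmorph1.
Qed.

Lemma skew_primitive_hopf_axioms x a ai : a * ai = 1 ->
  Delta a = kt a a -> eps a = 1 -> anti S a = ai ->
  Delta x = kt 1 x + kt x a -> eps x = 0 -> anti S x = - (x * ai) ->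
  ai * a = 1 -> hopf_axioms_at x.
Proof.
move=> aai Da ea Sa Dx ex Sx aia; rewrite /hopf_axioms_at -coLE -coRE Dx -/Phi -/Psi.
split.
- rewrite coL_def coR_def Dx (rmorphD (ktmap_mor Delta (kid H)))
    (rmorphD (ktmap_mor (kid H) Delta)).
  rewrite (ktmap_mor_kt Delta (kid H) 1 x) (ktmap_mor_kt Delta (kid H) x a).
  rewrite (ktmap_mor_kt (kid H) Delta 1 x) (ktmap_mor_kt (kid H) Delta x a).
  have D1 : Delta 1 = kt 1 1 by apply: etrans (rmorph1 Delta) _.
  rewrite D1 Dx Da.
  rewrite (ktDl (kt 1 x : ktens H H) (kt x a) a) 2!(rmorphD (kassoc_mor H H H)).
  apply: etrans (congr2 +%R (@kassoc_mor_kt k H H H 1 1 x)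
    (congr2 +%R (@kassoc_mor_kt k H H H 1 x a) (@kassoc_mor_kt k H H H x a a))) _.
  apply: etrans (addrA _ _ _) _; apply: (congr2 +%R) => //.
  exact: (esym (ktDr (1 : H) (kt 1 x : ktens H H) (kt x a))).
- apply: etrans (rmorphD unitL _ _) _; rewrite !unitLE.
  by rewrite rmorph1 ex rmorph0 rmorph1 mul1r mul0r addr0.
- apply: etrans (rmorphD unitR _ _) _; rewrite !unitRE.
  by rewrite ea ex rmorph0 rmorph1 mulr1 mulr0 add0r.
- by rewrite (zmodD _ _ PhiB) !PhiE Sx anti1 mul1r mulNr -mulrA aia mulr1 subrr ex rmorph0.
- by rewrite (zmodD _ _ PsiB) !PsiE Sx Sa mul1r addNr ex rmorph0.
Qed.

Variable G : H -> Prop.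
Hypothesis genG : generated G.
Hypothesis axG : forall h, G h -> hopf_axioms_at h.

Let coass h : kassoc (ktmap Delta idfun (Delta h)) = ktmap idfun Delta (Delta h).
Proof.
rewrite -coLE -coRE; apply: (kmor_ext genG) => u /axG [].
by rewrite coLE coRE.
Qed.

Let coul h : klift (fun u v => kin H (eps u) * v) (Delta h) = h.
Proof.
by apply: (@kmor_ext _ _ _ _ (kcomp unitL Delta) (kid H) genG) => u /axG [].
Qed.

Let cour h : klift (fun u v => u * kin H (eps v)) (Delta h) = h.
Proof.
by apply: (@kmor_ext _ _ _ _ (kcomp unitR Delta) (kid H) genG) => u /axG [].
Qed.

Let Phi_mul t a b : Phi (t * kt a b) = anti S a * Phi t * b.
Proof.
move: t; apply: ktens_ext => [u v|u v|a' b'].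
- by rewrite mulrBl PhiB.
- by rewrite PhiB mulrBr mulrBl.
by rewrite ktM !PhiE antiM !mulrA.
Qed.

Let Psi_mul t a b : Psi (kt a b * t) = a * Psi t * anti S b.
Proof.
move: t; apply: ktens_ext => [u v|u v|a' b'].
- by rewrite mulrBr PsiB.
- by rewrite PsiB mulrBr mulrBl.
by rewrite ktM !PsiE antiM !mulrA.
Qed.

Let antl h : Phi (Delta h) = kin H (eps h).
Proof.
move: h; apply: genG => [|h /axG[]//]; split=> [c|u v|u v hu hv].
- rewrite !kmor_in.
  have -> : kin (ktens H H) c = kt (kin H c) 1 by [].
  by rewrite PhiE anti_in mulr1.
- by rewrite !rmorphB PhiB => -> ->.
rewrite !rmorphM -hv; move: (Delta v).
apply: ktens_ext => [s t|s t|a b].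
- by rewrite mulrBr PhiB.
- by rewrite PhiB mulrBr.
by rewrite Phi_mul hu PhiE -kcentral mulrA.
Qed.

Let antr h : Psi (Delta h) = kin H (eps h).
Proof.
move: h; apply: genG => [|h /axG[]//]; split=> [c|u v|u v hu hv].
- rewrite !kmor_in.
  have -> : kin (ktens H H) c = kt (kin H c) 1 by [].
  by rewrite PsiE anti1 mulr1.
- by rewrite !rmorphB PsiB => -> ->.
rewrite !rmorphM -hu; move: (Delta u).
apply: ktens_ext => [s t|s t|a b].
- by rewrite mulrBl PsiB.
- by rewrite PsiB mulrBl.
by rewrite Psi_mul hv PsiE -mulrA kcentral mulrA.
Qed.

Lemma anti_scale c u : anti S (kin H c * u) = kin H c * anti S u.
Proof. by rewrite antiM anti_in kcentral. Qed.

(** The antipode axioms do not equate two morphisms, but the elements where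
    they hold still form a subalgebra, since S is an anti-morphism and k is
    central. *)
Definition hopf_build : hopf H :=
  @Hopf k H Delta eps (anti S) anti_scale coass coul cour antl antr.

End HopfBuild.

(** * Universal property of the free algebra *)
Module FreeAlgebra.
Import finmap monalg.

Section Lift.
Variables (k : fieldType) (n : nat) (B : kalg k) (h : 'I_n -> B).

Definition kfree_fun (p : kfree k n) : B :=
  \sum_(w <- msupp p) kin B (mcoeff w p) * \prod_(i <- fmonom_val w) h i.

Lemma kfree_funE (d : {fset {fmonom 'I_n}}) (p : kfree k n) :
  (msupp p `<=` d)%fset ->
  kfree_fun p = \sum_(w <- d) kin B (mcoeff w p) * \prod_(i <- fmonom_val w) h i.
Proof.
move=> le; rewrite /kfree_fun (big_fset_incl _ le) //= => w _ /mcoeff_outdom ->.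
by rewrite rmorph0 mul0r.
Qed.

Fact kfree_fun_zmod : zmod_morphism kfree_fun.
Proof.
move=> p q; set d := (msupp p `|` msupp q)%fset.
rewrite (@kfree_funE d (p - q)) ?msuppB_le // (@kfree_funE d p) ?fsubsetUl //.
rewrite (@kfree_funE d q) ?fsubsetUr // -sumrB; apply: eq_bigr => w _.
by rewrite mcoeffB rmorphB mulrBl.
Qed.
HB.instance Definition _ :=
  GRing.isZmodMorphism.Build (kfree k n) B kfree_fun kfree_fun_zmod.

Lemma kfree_funU c w :
  kfree_fun << c *g w >> = kin B c * \prod_(i <- fmonom_val w) h i.
Proof.
by rewrite (kfree_funE (msuppU_le)) big_seq_fset1 mcoeffUU.
Qed.

Fact kfree_fun_monoid : monoid_morphism kfree_fun.
Proof.
split; first by rewrite [LHS](kfree_funU 1 (fmone 'I_n)) rmorph1 fm1 big_nil mulr1.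
move=> p q; have -> : p * q = fgmul p q by [].
rewrite /fgmul raddf_sum [in RHS]/kfree_fun mulr_suml.
apply: eq_bigr => u _; rewrite raddf_sum mulr_sumr.
apply: eq_bigr => v _; rewrite [LHS]kfree_funU fmM big_cat rmorphM /=.
by rewrite -!mulrA; congr (_ * _); rewrite !mulrA kcentral.
Qed.
HB.instance Definition _ :=
  GRing.isMonoidMorphism.Build (kfree k n) B kfree_fun kfree_fun_monoid.

Definition kfree_lift : kmor (kfree k n) B.
Proof.
apply: (@Kmor k (kfree k n) B kfree_fun) => c.
by apply: etrans (kfree_funU c (fmone 'I_n)) _; rewrite fm1 big_nil mulr1.
Defined.

Lemma kfree_liftE i : kfree_lift (kletter k i) = h i.
Proof.
by apply: etrans (kfree_funU 1 (fmu i)) _; rewrite rmorph1 mul1r fmU big_seq1.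
Qed.

End Lift.

Lemma generated_kfree (k : fieldType) n :
  generated (fun u : kfree k n => exists i, u = kletter k i).
Proof.
move=> P sP GP p; have [Pk _ PM] := sP.
rewrite [p]monalgE; apply: (big_ind P) => [|u v|w _].
- exact: subalgebra0 sP.
- exact: subalgebraD sP.
have -> : << mcoeff w p *g w >> =
    kin (kfree k n) (mcoeff w p) * \prod_(i <- fmonom_val w) kletter k i.
  have -> : \prod_(i <- fmonom_val w) kletter k i = << w >> :> {malg k[{fmonom 'I_n}]}.
    case: w => w /=; elim: w => [|i w IH].
      by rewrite big_nil; congr << _ >>; apply/val_inj; rewrite /= fm1.
    rewrite big_cons IH; apply: etrans (fgmulUU 1 1 _ _) _.
    by rewrite mulr1; congr << _ >>; apply/val_inj; rewrite /= fmM fmU.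
  have -> : kin (kfree k n) (mcoeff w p) = << mcoeff w p *g fmone 'I_n >> by [].
  by apply/esym; apply: etrans (fgmulUU _ _ _ _) _; rewrite mulr1 mul1m.
apply: (PM) => //; apply: (big_ind P) => [||i _]; first exact: subalgebra1 sP.
  exact: PM.
by apply: (GP (kletter k i)); exists i.
Qed.
End FreeAlgebra.

(** * The relations as an additivity property of g *)
Section BinomialCoefficients.
Variable R : pzRingType.
Implicit Types x a : R.

(** The coefficient of t^j in (x + t a)^i, for a central indeterminate t. *)
Fixpoint qcoef x a (i j : nat) : R :=
  match i with
  | 0 => (j == 0)%:R
  | i'.+1 => x * qcoef x a i' j
             + (if j is j'.+1 then a * qcoef x a i' j' else 0)
  end.

Lemma qcoefS x a i j : qcoef x a i.+1 j.+1 = x * qcoef x a i j.+1 + a * qcoef x a i j.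
Proof. by []. Qed.

Lemma qcoef0 x a i : qcoef x a i 0 = x ^+ i.
Proof. by elim: i => [//|i IH]; rewrite /= IH addr0 exprS. Qed.

Lemma qcoef_gt x a i j : (i < j)%N -> qcoef x a i j = 0.
Proof.
elim: i j => [|i IH] [|j] //= lt_ij.
by rewrite !IH ?mulr0 ?addr0 // ltnW.
Qed.

Lemma qcoef_diag x a i : qcoef x a i i = a ^+ i.
Proof.
elim: i => [//|i IH]; rewrite qcoefS IH qcoef_gt // mulr0 add0r.
by rewrite exprS.
Qed.

(** The recursion of [qcoef] splits off the first factor of (x + t a)^(i+1);
    here the last one is split off.  The interplay of the two is what makes
    a^n and g(x) commute with a and x. *)
Lemma qcoefSr x a i j :
  qcoef x a i.+1 j.+1 = qcoef x a i j.+1 * x + qcoef x a i j * a.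
Proof.
elim: i j => [|i IH] j.
  rewrite qcoefS /=; case: j => [|j] /=; first by rewrite mulr0 mul0r mulr1 mul1r.
  by rewrite !mulr0 !mul0r.
rewrite qcoefS [in LHS]IH; case: j => [|j].
  rewrite (qcoef0 _ _ i.+1) qcoefS (qcoef0 _ _ i) !mulrDr !mulrDl !mulrA -!addrA.
  by congr (_ + _); rewrite addrC -[a * _ * x]mulrA -exprSr -exprS.
rewrite [qcoef x a i.+1 j.+1 in LHS]IH !qcoefS !mulrDr !mulrDl !mulrA.
by rewrite addrACA.
Qed.

Lemma sum_tuple_cons (V : nmodType) N (P : pred (seq bool)) (F : seq bool -> V) :
  \sum_(w : N.+1.-tuple bool | P w) F w =
  \sum_(w : N.-tuple bool | P (true :: w)) F (true :: w)
  + \sum_(w : N.-tuple bool | P (false :: w)) F (false :: w).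
Proof.
pose h (p : bool * N.-tuple bool) : N.+1.-tuple bool := [tuple of p.1 :: p.2].
have hbij : bijective h.
  exists (fun w => (thead w, [tuple of behead w])) => [[b w]|w].
    by congr pair; apply/val_inj.
  by rewrite /h /= [RHS]tuple_eta; apply/val_inj.
rewrite (reindex h) /=; last exact: onW_bij.
rewrite -(pair_big_dep predT (fun b (w : N.-tuple bool) => P (b :: w))
   (fun b (w : N.-tuple bool) => F (b :: w))) /=.
by rewrite big_bool.
Qed.

Lemma qcoef_words x a N j :
  \sum_(w : N.-tuple bool | count_mem true w == j) weval a x w = qcoef x a N j.
Proof.
elim: N j => [|N IH] j.
  case: j => [|j] /=; last by rewrite big_pred0 // => w; rewrite tuple0.
  by rewrite (big_pred1 [tuple]) => [|w]; rewrite ?tuple0 // /weval big_nil.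
rewrite (sum_tuple_cons _ (fun w : seq bool => count_mem true w == j) (weval a x)) /=.
rewrite addrC; congr (_ + _).
  rewrite -IH mulr_sumr; apply: eq_big => [w|w _]; first by rewrite add0n.
  by rewrite /weval big_cons.
case: j => [|j]; first by rewrite big_pred0.
rewrite -IH mulr_sumr; apply: eq_big => [w|w _]; first by rewrite add1n eqSS.
by rewrite /weval big_cons.
Qed.

Lemma Pword_qcoef x a j i : Pword j i a x = qcoef x a (j + i) j.
Proof. exact: qcoef_words. Qed.

End BinomialCoefficients.

Lemma rmorph_qcoef (R S : pzRingType) (f : {rmorphism R -> S}) x a i j :
  f (qcoef x a i j) = qcoef (f x) (f a) i j.
Proof.
elim: i j => [|i IH] j /=; first by rewrite rmorph_nat.
rewrite rmorphD rmorphM IH; case: j => [|j]; first by rewrite rmorph0.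
by rewrite rmorphM IH.
Qed.

Lemma qcoef_converse (R : pzRingType) (x a : R) i j :
  @qcoef R^c x a i j = qcoef x a i j.
Proof.
elim: i j => [//|i IH] [|j]; last by rewrite [RHS]qcoefSr -!IH.
by rewrite !qcoef0; apply: revrX.
Qed.

Section Relations.
Variables (k : fieldType) (n : nat) (g : {poly k}).
Hypotheses (deg_g : size g = n.+1) (g0 : g`_0 = 0).

Section Gcoef.
Variable B : kalg k.
Implicit Types x a : B.

(** The coefficient of t^l in g(x + t a). *)
Definition gcoef x a l : B := \sum_(i < n.+1) kin B g`_i * qcoef x a i l.

(** Together these equations say g(x + t a) = g(x) + g(t) a^n, up to the
    constant term of g. *)
Definition additive_pair x a : Prop :=
  forall l, (0 < l)%N -> gcoef x a l = kin B g`_l * a ^+ n.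

Lemma gcoef0 x a : gcoef x a 0 = keval g x.
Proof. by rewrite /keval deg_g; apply: eq_bigr => i _; rewrite qcoef0. Qed.

Lemma gcoef_ge x a l : (n <= l)%N -> gcoef x a l = kin B g`_l * a ^+ n.
Proof.
rewrite leq_eqVlt => /orP[/eqP <-|lt_nl].
  rewrite /gcoef big_ord_recr /= qcoef_diag big1 ?add0r // => i _.
  by rewrite qcoef_gt ?mulr0.
rewrite nth_default ?deg_g // rmorph0 mul0r; apply: big1 => i _.
by rewrite qcoef_gt ?mulr0 // (leq_trans _ lt_nl) // ltnS ltnW // ltnS -ltnS.
Qed.

(** The coefficient of t^(l+1) in (x + t a) g(x + t a) = g(x + t a) (x + t a). *)
Lemma gcoef_commute x a l :
  x * gcoef x a l.+1 + a * gcoef x a l = gcoef x a l.+1 * x + gcoef x a l * a.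
Proof.
rewrite /gcoef !mulr_sumr !mulr_suml -!big_split; apply: eq_bigr => i _ /=.
rewrite !mulrA -!kcentral -!mulrA -!mulrDr; congr (_ * _).
by rewrite -qcoefS qcoefSr.
Qed.

(** The presentation imposes the equations for 0 < l < n; those for l >= n hold
    in every algebra, because (x + t a)^i has degree at most i in t. *)
Lemma additive_pairP x a :
  (forall j, (0 < j < n)%N ->
     \sum_(j <= i < n.+1) kin B g`_i * Pword j (i - j) a x
     = kin B g`_j * a ^+ n) <-> additive_pair x a.
Proof.
have E j : (0 < j < n)%N -> \sum_(j <= i < n.+1) kin B g`_i * Pword j (i - j) a x
    = gcoef x a j.
  move=> /andP[j_gt0 lt_jn]; pose F i := kin B g`_i * qcoef x a i j.
  rewrite /gcoef -(big_mkord xpredT F) [RHS](@big_cat_nat _ _ _ j) //=; last first.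
    exact: leqW (ltnW lt_jn).
  have -> : \sum_(0 <= i < j) F i = 0.
    by rewrite big_nat big1 // => i lt_ij; rewrite /F qcoef_gt ?mulr0.
  rewrite add0r; apply: eq_big_nat => i /andP[le_ji _].
  by rewrite Pword_qcoef subnKC.
split=> [H l l_gt0|H j /[dup] jn /andP[j_gt0 _]]; last by rewrite E // H.
have [lt_ln|] := ltnP l n; last exact: gcoef_ge.
by rewrite -E ?l_gt0 // H ?l_gt0.
Qed.

Hypothesis n_ge2 : (2 <= n)%N.

Let lead_neq0 : g`_n != 0. Proof. exact: lead_coef_neq0. Qed.

Lemma kinV_mul (c : k) (u : B) : c != 0 -> kin B c^-1 * (kin B c * u) = u.
Proof. by move=> c0; rewrite mulrA -rmorphM mulVf // rmorph1 mul1r. Qed.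

(** In [gcoef_commute] at l = n - 1 both coefficients are multiples of a^n, and
    the terms with a cancel. *)
Lemma additive_pair_an x a : additive_pair x a -> x * a ^+ n = a ^+ n * x.
Proof.
move=> ap; have := gcoef_commute x a n.-1.
have n_gt0 : (0 < n)%N by apply: ltnW.
have n1_gt0 : (0 < n.-1)%N by rewrite -ltnS prednK.
rewrite prednK // !ap //.
have -> : a * (kin B g`_n.-1 * a ^+ n) = kin B g`_n.-1 * a ^+ n * a.
  by rewrite mulrA -kcentral -!mulrA -exprS exprSr.
move/addIr; rewrite mulrA -kcentral -!mulrA.
by move=> /(congr1 (fun u => kin B (g`_n)^-1 * u)); rewrite !kinV_mul.
Qed.

(** In [gcoef_commute] at l = 0 the terms with x cancel, as a^n commutes
    with x. *)
Lemma additive_pair_g x a : additive_pair x a -> a * keval g x = keval g x * a.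
Proof.
move=> ap; have := gcoef_commute x a 0; rewrite ap // gcoef0.
by rewrite mulrA -kcentral -!mulrA additive_pair_an //; move/addrI.
Qed.

End Gcoef.
End Relations.

Section QcoefConvolution.
Variable R : pzRingType.
Implicit Types (x a y : R) (u : nat -> R).

(** A summation by parts: the linear functional t^l |-> u l, with values
    written on the left, is applied to (x + t a) (x + t a)^i. *)
Lemma qcoef_shift u x a i :
  \sum_(l < i.+2) u l * qcoef x a i.+1 l
  = \sum_(l < i.+1) (u l * x + u l.+1 * a) * qcoef x a i l.
Proof.
rewrite big_ord_recl /= addr0; under eq_bigr => l _ do rewrite mulrDr.
rewrite big_split /= addrA.
have -> : u 0%N * (x * qcoef x a i 0) + \sum_(l < i.+1) u l.+1 * (x * qcoef x a i l.+1)
    = \sum_(l < i.+2) u l * (x * qcoef x a i l) by rewrite [RHS]big_ord_recl.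
rewrite big_ord_recr /= qcoef_gt // !mulr0 addr0 -big_split /=.
by apply: eq_bigr => l _; rewrite mulrDl !mulrA.
Qed.

Lemma comm_qcoef y x a i j :
  GRing.comm y x -> GRing.comm y a -> GRing.comm y (qcoef x a i j).
Proof.
move=> yx ya; elim: i j => [|i IH] j /=.
  by case: (j == 0); [exact: commr1|exact: commr0].
apply: commrD; first exact: commrM.
by case: j => [|j]; [exact: commr0|exact: commrM].
Qed.

(** Substituting x1 + t a1 for t in (x2 + t a2)^i gives
    ((x2 + x1 a2) + t (a1 a2))^i when both pairs commute with each other. *)
Lemma qcoef_comul x1 a1 x2 a2 i j :
  GRing.comm x2 x1 -> GRing.comm x2 a1 -> GRing.comm a2 x1 -> GRing.comm a2 a1 ->
  qcoef (x2 + x1 * a2) (a1 * a2) i j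
  = \sum_(l < i.+1) qcoef x1 a1 l j * qcoef x2 a2 i l.
Proof.
move=> c1 c2 c3 c4; elim: i j => [|i IH] j; first by rewrite big_ord1 /= mulr1.
rewrite (qcoef_shift (fun l => qcoef x1 a1 l j)) [LHS]/= IH.
have cx2 l j' := comm_qcoef l j' c1 c2; have ca2 l j' := comm_qcoef l j' c3 c4.
have E l : qcoef x1 a1 l j * x2 + qcoef x1 a1 l.+1 j * a2
    = (x2 + x1 * a2) * qcoef x1 a1 l j
      + (if j is j'.+1 then a1 * qcoef x1 a1 l j' else 0) * a2.
  rewrite /= -cx2 [(_ + _) * a2]mulrDl addrA [(x2 + _) * _]mulrDl.
  by rewrite -[x1 * _ * a2]mulrA -ca2 mulrA.
under [RHS]eq_bigr => l _ do rewrite E mulrDl -mulrA.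
rewrite big_split /= -mulr_sumr; congr (_ + _).
case: j {E} => [|j]; first by rewrite big1 // => l _; rewrite !mul0r.
rewrite IH mulr_sumr; apply: eq_bigr => l _.
by rewrite -[a1 * _ * a2]mulrA -ca2 !mulrA.
Qed.

(** Substituting - x a^-1 + t a^-1 for t, on the left of the coefficients,
    turns x + t a into t. *)
Lemma qcoef_antipode x a ai i j : ai * a = 1 ->
  \sum_(l < i.+1) qcoef (- (x * ai)) ai l j * qcoef x a i l = (i == j)%:R.
Proof.
move=> aia; elim: i j => [|i IH] j; first by rewrite big_ord1 /= mulr1 eq_sym.
rewrite (qcoef_shift (fun l => qcoef (- (x * ai)) ai l j)).
case: j => [|j].
  rewrite big1 // => l _; rewrite !qcoef0 exprSr -[_ * _ * a]mulrA mulNr -mulrA.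
  by rewrite aia mulr1 mulrN subrr mul0r.
rewrite eqSS -IH; apply: eq_bigr => l _; congr (_ * _).
rewrite qcoefSr mulrDl -!mulrA aia mulr1 mulNr -mulrA aia mulr1 mulrN addrA subrr.
by rewrite add0r.
Qed.

End QcoefConvolution.

Section PairOperations.
Variables (k : fieldType) (n : nat) (g : {poly k}) (B : kalg k).
Hypotheses (deg_g : size g = n.+1) (g0 : g`_0 = 0).
Implicit Types x a : B.

(** Apply the linear functional t^l |-> u l to g(x + t a) = g(x) + g(t) a^n.
    Both the comultiplication and the antipode are obtained from this, through
    [qcoef_comul] and [qcoef_antipode]. *)
Lemma gcoef_convolution (u : nat -> B) x a : additive_pair n g x a ->
  \sum_(i < n.+1) kin B g`_i * \sum_(l < i.+1) u l * qcoef x a i l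
  = u 0%N * keval g x + (\sum_(l < n.+1) kin B g`_l * u l) * a ^+ n.
Proof.
move=> ap.
have widen i : (i < n.+1)%N -> \sum_(l < i.+1) u l * qcoef x a i l
    = \sum_(l < n.+1) u l * qcoef x a i l.
  move=> lt_in; rewrite -!(big_mkord xpredT (fun l => u l * qcoef x a i l)).
  have Z : \sum_(i.+1 <= l < n.+1) u l * qcoef x a i l = 0.
    by rewrite big_nat big1 // => l /andP[lt_il _]; rewrite qcoef_gt ?mulr0.
  by rewrite [RHS](@big_cat_nat _ _ _ i.+1) //= Z addr0.
under eq_bigr => i _ do rewrite widen // mulr_sumr.
rewrite exchange_big /= mulr_suml [RHS]addrC.
transitivity (\sum_(l < n.+1) u l * gcoef n g x a l).
  apply: eq_bigr => l _; rewrite mulr_sumr; apply: eq_bigr => i _.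
  by rewrite !mulrA kcentral.
rewrite big_ord_recl [in RHS]big_ord_recl /= g0 rmorph0 !mul0r add0r addrC.
rewrite gcoef0 //; congr (_ + _); apply: eq_bigr => l _.
by rewrite ap // mulrA kcentral.
Qed.

Lemma gcoef_comul x1 a1 x2 a2 j :
  GRing.comm x2 x1 -> GRing.comm x2 a1 -> GRing.comm a2 x1 -> GRing.comm a2 a1 ->
  additive_pair n g x2 a2 ->
  gcoef n g (x2 + x1 * a2) (a1 * a2) j
  = (j == 0)%:R * keval g x2 + gcoef n g x1 a1 j * a2 ^+ n.
Proof.
move=> c1 c2 c3 c4 ap; rewrite -(gcoef_convolution (fun l => qcoef x1 a1 l j) ap).
by apply: eq_bigr => i _; rewrite qcoef_comul.
Qed.

Lemma additive_pair_comul x1 a1 x2 a2 :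
  GRing.comm x2 x1 -> GRing.comm x2 a1 -> GRing.comm a2 x1 -> GRing.comm a2 a1 ->
  additive_pair n g x1 a1 -> additive_pair n g x2 a2 ->
  additive_pair n g (x2 + x1 * a2) (a1 * a2).
Proof.
move=> c1 c2 c3 c4 ap1 ap2 [//|l] _; rewrite gcoef_comul // mul0r add0r ap1 //.
by rewrite -mulrA exprMn_comm //; apply: commr_sym.
Qed.

Lemma keval_comul x1 a1 x2 a2 :
  GRing.comm x2 x1 -> GRing.comm x2 a1 -> GRing.comm a2 x1 -> GRing.comm a2 a1 ->
  additive_pair n g x2 a2 ->
  keval g (x2 + x1 * a2) = keval g x2 + keval g x1 * a2 ^+ n.
Proof.
move=> c1 c2 c3 c4 ap.
by have := gcoef_comul 0 c1 c2 c3 c4 ap; rewrite !gcoef0 // mul1r.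
Qed.

Lemma gcoef_antipode x a ai j : a * ai = 1 -> ai * a = 1 -> (j <= n)%N ->
  additive_pair n g x a ->
  kin B g`_j = (j == 0)%:R * keval g x + gcoef n g (- (x * ai)) ai j * a ^+ n.
Proof.
move=> aai aia le_jn ap.
have := gcoef_convolution (fun l => qcoef (- (x * ai)) ai l j) ap.
rewrite [qcoef _ _ _ _ in X in _ = X -> _]/= => <-.
rewrite (bigD1 (inord j)) //= inordK // qcoef_antipode // eqxx mulr1 big1 ?addr0 //.
move=> i ne_ij; rewrite qcoef_antipode // (_ : (i == j :> nat) = false) ?mulr0 //.
by apply/eqP=> eij; case/eqP: ne_ij; apply/val_inj; rewrite /= inordK.
Qed.

Lemma additive_pair_antipode x a ai : a * ai = 1 -> ai * a = 1 ->
  additive_pair n g x a -> additive_pair n g (- (x * ai)) ai.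
Proof.
move=> aai aia ap l l_gt0.
have [le_ln|lt_nl] := leqP l n; last by apply: gcoef_ge => //; apply: ltnW.
rewrite (gcoef_antipode aai aia le_ln ap) (gtn_eqF l_gt0) mul0r add0r -mulrA.
by rewrite expr_invl ?mulr1 // /GRing.comm aai.
Qed.

Lemma keval_antipode x a ai : a * ai = 1 -> ai * a = 1 ->
  additive_pair n g x a -> keval g (- (x * ai)) = - (keval g x * ai ^+ n).
Proof.
move=> aai aia ap; have := gcoef_antipode aai aia (leq0n n) ap.
rewrite g0 rmorph0 gcoef0 // mul1r => /(congr1 (fun u => u * ai ^+ n)).
rewrite mul0r mulrDl -[_ * a ^+ n * _]mulrA expr_invl ?mulr1 ?/GRing.comm ?aai //.
by move/eqP; rewrite eq_sym addrC addr_eq0 => /eqP.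
Qed.

Lemma keval_mor (A C : kalg k) (f : kmor A C) (p : {poly k}) u :
  f (keval p u) = keval p (f u).
Proof.
rewrite /keval rmorph_sum; apply: eq_bigr => i _.
by rewrite rmorphM rmorphXn kmor_in.
Qed.

Lemma gcoef_mor (C : kalg k) (f : kmor B C) x a l :
  f (gcoef n g x a l) = gcoef n g (f x) (f a) l.
Proof.
rewrite /gcoef rmorph_sum; apply: eq_bigr => i _.
by rewrite rmorphM rmorph_qcoef kmor_in.
Qed.

Lemma additive_pair_mor (C : kalg k) (f : kmor B C) x a :
  additive_pair n g x a -> additive_pair n g (f x) (f a).
Proof.
by move=> ap l l_gt0; rewrite -gcoef_mor ap // rmorphM rmorphXn kmor_in.
Qed.

(** Reversing words permutes those with given numbers of letters, so the
    relations are symmetric under passage to the opposite algebra. *)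
Lemma gcoef_op x a l : gcoef n g (B := kop B) x a l = gcoef n g x a l :> B.
Proof.
apply: eq_bigr => i _; rewrite qcoef_converse.
exact: (esym (kcentral _ _)).
Qed.

Lemma additive_pair_op x a :
  additive_pair n g x a -> additive_pair n g (B := kop B) x a.
Proof.
move=> ap l l_gt0; rewrite gcoef_op ap // kcentral.
by congr (_ * _); rewrite -(revrX a n).
Qed.

Lemma keval_op (p : {poly k}) x : keval p (A := kop B) x = keval p x :> B.
Proof.
apply: eq_bigr => i _; rewrite -[RHS]/(kin B p`_i * x ^+ i) kcentral.
by rewrite -(revrX x i).
Qed.

End PairOperations.

(** * Universal properties of A(x,a,g) and A(g,f), and their Hopf structures *)
Lemma rmorph_Pword (R S : pzRingType) (f : {rmorphism R -> S}) j i u v :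
  f (Pword j i u v) = Pword j i (f u) (f v).
Proof. by rewrite !Pword_qcoef rmorph_qcoef. Qed.

Lemma Aone_rel_mor (k : fieldType) (B C : kalg k) (h : kmor B C) n (g : {poly k})
    (x a : B) j :
  h (\sum_(j <= i < n.+1) kin B g`_i * Pword j (i - j) a x - kin B g`_j * a ^+ n)
  = \sum_(j <= i < n.+1) kin C g`_i * Pword j (i - j) (h a) (h x)
    - kin C g`_j * h a ^+ n.
Proof.
rewrite rmorphB rmorph_sum rmorphM rmorphXn kmor_in; congr (_ - _).
by apply: eq_bigr => i _; rewrite rmorphM rmorph_Pword kmor_in.
Qed.

Section OneVariable.
Variables (k : fieldType) (n : nat) (g : {poly k}).
Hypotheses (deg_g : size g = n.+1) (g0 : g`_0 = 0).
Local Notation A := (Aone n g).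
Local Notation x := (Aone_x n g).
Local Notation a := (Aone_a n g).
Local Notation ai := (Aone_ai n g).

Lemma Aone_aai : a * ai = 1.
Proof.
have h : fprod_a k * fprod_ai k = 1.
  apply/eqP; rewrite -subr_eq0; apply/eqP.
  rewrite /fprod_a /fprod_ai -rmorphM -(rmorph1 (kpi _)) -rmorphB.
  by apply: kpi_rel; left.
by rewrite /Aone_a /Aone_ai -rmorphM h rmorph1.
Qed.

Lemma Aone_aia : ai * a = 1.
Proof.
have h : fprod_ai k * fprod_a k = 1.
  apply/eqP; rewrite -subr_eq0; apply/eqP.
  rewrite /fprod_a /fprod_ai -rmorphM -(rmorph1 (kpi _)) -rmorphB.
  by apply: kpi_rel; right.
by rewrite /Aone_a /Aone_ai -rmorphM h rmorph1.
Qed.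

Lemma Aone_pair : additive_pair n g x a.
Proof.
apply/(additive_pairP deg_g) => j jn; apply/eqP; rewrite -subr_eq0; apply/eqP.
by rewrite -[LHS]Aone_rel_mor; apply: kpi_rel; exists j.
Qed.

Section Lift.
Variables (B : kalg k) (X U V : B).
Hypotheses (UV : U * V = 1) (VU : V * U = 1) (XU : additive_pair n g X U).

Let h (i : 'I_3) : B := nth 0 [:: X; U; V] i.
Let f0 : kmor (kfree k 3) B := FreeAlgebra.kfree_lift h.
Let f0_x : f0 (free_x k) = X.
Proof. by rewrite [LHS]FreeAlgebra.kfree_liftE /h inordK. Qed.
Let f0_a : f0 (free_a k) = U.
Proof. by rewrite [LHS]FreeAlgebra.kfree_liftE /h inordK. Qed.
Let f0_ai : f0 (free_ai k) = V.
Proof. by rewrite [LHS]FreeAlgebra.kfree_liftE /h inordK. Qed.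

Let f0_rel u : u = free_a k * free_ai k - 1 \/ u = free_ai k * free_a k - 1 ->
  f0 u = 0.
Proof.
by case=> ->; rewrite rmorphB rmorphM f0_a f0_ai rmorph1 ?UV ?VU subrr.
Qed.
Let f1 : kmor (kfprod k) B := kquot_lift f0_rel.

Let f1_rel u : @Aone_rel k n g u -> f1 u = 0.
Proof.
case=> j jn ->; have /(additive_pairP deg_g)/(_ j jn) E := XU.
have f1x : f1 (fprod_x k) = X by rewrite [LHS]kquot_liftE; exact: f0_x.
have f1a : f1 (fprod_a k) = U by rewrite [LHS]kquot_liftE; exact: f0_a.
by rewrite Aone_rel_mor f1a f1x E subrr.
Qed.

(** The generator a^-1 is a third letter of the free algebra, whence the three
    images X, U, V. *)
Lemma Aone_lift_sig : {h : kmor A B | [/\ h x = X, h a = U & h ai = V]}.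
Proof.
exists (kquot_lift f1_rel).
by split; rewrite [LHS]kquot_liftE [LHS]kquot_liftE.
Qed.

Definition Aone_lift : kmor A B := sval Aone_lift_sig.

Lemma Aone_liftE : [/\ Aone_lift x = X, Aone_lift a = U & Aone_lift ai = V].
Proof. exact: (svalP Aone_lift_sig). Qed.
Lemma Aone_lift_x : Aone_lift x = X. Proof. by case: Aone_liftE. Qed.
Lemma Aone_lift_a : Aone_lift a = U. Proof. by case: Aone_liftE. Qed.
Lemma Aone_lift_ai : Aone_lift ai = V. Proof. by case: Aone_liftE. Qed.
End Lift.

Definition Aone_gen (u : A) : Prop := [\/ u = x, u = a | u = ai].

Lemma generated_Aone : generated Aone_gen.
Proof.
have := generated_kpi (S := @Aone_rel k n g) (generated_kpi (S := fun u =>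
  u = free_a k * free_ai k - 1 \/ u = free_ai k * free_a k - 1)
  (FreeAlgebra.generated_kfree (k:=k) (n:=3))).
move/generated_sub; apply=> P sP GP u [_ [_ [i ->] ->] ->].
have E (j : nat) : (j < 3)%N -> j = i -> kletter k i = kletter k (inord j).
  by move=> lt3 ji; rewrite ji inord_val.
case: (i : nat) (ltn_ord i) E => [|[|[|//]]] _ E; apply: GP.
- by constructor 1; rewrite (E 0%N).
- by constructor 2; rewrite (E 1%N).
- by constructor 3; rewrite (E 2%N).
Qed.

End OneVariable.

Section TensorSquare.
Variables (k : fieldType) (n : nat) (g : {poly k}) (B : kalg k) (x a ai : B).
Hypotheses (deg_g : size g = n.+1) (g0 : g`_0 = 0).
Hypotheses (aai : a * ai = 1) (aia : ai * a = 1) (ap : additive_pair n g x a).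
Local Notation BB := (ktens B B).

Lemma kt_sum u v : (kt 1 u + kt u v : BB) = kinr B B u + kinl B B u * kinr B B v.
Proof. by rewrite -ktE. Qed.

Lemma additive_pair_tens : additive_pair n g (kt 1 x + kt x a : BB) (kt a a).
Proof.
have ap2 := additive_pair_mor (kinr B B) ap.
have ap1 := additive_pair_mor (kinl B B) ap.
have := additive_pair_comul deg_g g0 (esym (kinlr_comm x x))
  (esym (kinlr_comm a x)) (esym (kinlr_comm x a)) (esym (kinlr_comm a a)) ap1 ap2.
by rewrite -kt_sum -ktE.
Qed.

(** This makes the relation g(x) = f(y) stable under comultiplication once
    a^n = b^m. *)
Lemma keval_tens : keval g (kt 1 x + kt x a : BB)
  = kt 1 (keval g x) + kt (keval g x) (a ^+ n).
Proof.
have ap2 := additive_pair_mor (kinr B B) ap.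
have := keval_comul deg_g g0 (esym (kinlr_comm x x))
  (esym (kinlr_comm a x)) (esym (kinlr_comm x a)) (esym (kinlr_comm a a)) ap2.
by rewrite -kt_sum -!keval_mor -rmorphXn -ktE.
Qed.

Lemma kt_expr u v (N : nat) : (kt u v : BB) ^+ N = kt (u ^+ N) (v ^+ N).
Proof.
elim: N => [//|N IH]; rewrite exprS IH.
by apply: etrans (ktM _ _ _ _) _; rewrite -!exprS.
Qed.

End TensorSquare.

Opaque Aone.

Section Counit.
Variables (k : fieldType) (n : nat) (g : {poly k}).
Hypotheses (deg_g : size g = n.+1) (g0 : g`_0 = 0).

Lemma qcoef01 (R : pzRingType) i l : qcoef (0 : R) 1 i l = (i == l)%:R.
Proof.
elim: i l => [|i IH] [|l] //=; rewrite mul0r add0r //.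
by rewrite mul1r IH eqSS.
Qed.

Lemma additive_pair_counit : additive_pair n g (0 : kself k) 1.
Proof.
move=> l l_gt0; have [le_ln|lt_nl] := leqP l n; last first.
  by apply: gcoef_ge => //; apply: ltnW.
rewrite expr1n mulr1 /gcoef (bigD1 (inord l)) //= inordK // qcoef01 eqxx mulr1.
rewrite big1 ?addr0 // => i ne_il; rewrite qcoef01.
rewrite (_ : (i == l :> nat) = false) ?mulr0 //.
by apply/eqP=> eil; case/eqP: ne_il; apply/val_inj; rewrite /= inordK.
Qed.

Lemma keval0 (B : kalg k) : keval g (0 : B) = 0.
Proof.
rewrite /keval big1 // => i _; rewrite expr0n.
by case: eqP => [->|_]; rewrite ?g0 ?rmorph0 ?mul0r ?mulr0.
Qed.

End Counit.

Section OneVariableHopf.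
Variables (k : fieldType) (n : nat) (g : {poly k}).
Hypotheses (deg_g : size g = n.+1) (g0 : g`_0 = 0).
Local Notation A := (Aone n g).
Local Notation x := (Aone_x n g).
Local Notation a := (Aone_a n g).
Local Notation ai := (Aone_ai n g).

Let kt_inv (B : kalg k) (u v : B) : u * v = 1 -> (kt u u * kt v v : ktens B B) = 1.
Proof. by move=> uv; rewrite ktM uv. Qed.

Let S_pair := additive_pair_op (additive_pair_antipode deg_g g0 (Aone_aai n g)
  (Aone_aia n g) (Aone_pair deg_g)).

Definition Aone_comul : kmor A (ktens A A) :=
  Aone_lift deg_g (kt_inv (Aone_aai n g)) (kt_inv (Aone_aia n g))
    (additive_pair_tens deg_g g0 (Aone_pair deg_g)).

Definition Aone_counit : kmor A (kself k) :=
  Aone_lift deg_g (B := kself k) (mulr1 1) (mulr1 1) (additive_pair_counit deg_g).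

Definition Aone_antipode : kmor A (kop A) :=
  Aone_lift deg_g (B := kop A) (U := ai) (V := a) (Aone_aai n g) (Aone_aia n g)
    S_pair.

Lemma Aone_comulE : [/\ Aone_comul x = kt 1 x + kt x a, Aone_comul a = kt a a
  & Aone_comul ai = kt ai ai].
Proof. exact: Aone_liftE. Qed.

Lemma Aone_counitE :
  [/\ Aone_counit x = 0, Aone_counit a = 1 & Aone_counit ai = 1].
Proof. exact: Aone_liftE. Qed.

Lemma Aone_antipodeE : [/\ anti Aone_antipode x = - (x * ai),
  anti Aone_antipode a = ai & anti Aone_antipode ai = a].
Proof.
exact: (Aone_liftE deg_g (B := kop A) (U := ai) (V := a)
  (Aone_aai n g) (Aone_aia n g) S_pair).
Qed.

Lemma Aone_hopf_axioms u : Aone_gen u ->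
  hopf_axioms_at Aone_comul Aone_counit Aone_antipode u.
Proof.
have [Dx Da Dai] := Aone_comulE; have [ex ea eai] := Aone_counitE.
have [Sx Sa Sai] := Aone_antipodeE; case=> ->.
- exact: skew_primitive_hopf_axioms (Aone_aai n g) Da ea Sa Dx ex Sx (Aone_aia n g).
- exact: grouplike_hopf_axioms (Aone_aai n g) (Aone_aia n g) Da ea Sa.
- exact: grouplike_hopf_axioms (Aone_aia n g) (Aone_aai n g) Dai eai Sai.
Qed.

Definition Aone_hopf : hopf A :=
  hopf_build (@generated_Aone k n g) Aone_hopf_axioms.

Lemma Aone_hopf_on : hopf_on Aone_hopf x a ai.
Proof.
have [Dx Da _] := Aone_comulE; have [ex ea _] := Aone_counitE.
by have [Sx Sa _] := Aone_antipodeE.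
Qed.

End OneVariableHopf.

Lemma kpi_eq (k : fieldType) (A : kalg k) (S : A -> Prop) u v :
  S (u - v) -> kpi S u = kpi S v.
Proof.
by move=> Suv; apply/eqP; rewrite -subr_eq0 -rmorphB; apply/eqP/kpi_rel.
Qed.

Lemma kmor_keval_eq (k : fieldType) (A B : kalg k) (h : kmor A B) p q u v u' v' :
  h u = u' -> h v = v' -> keval p u' = keval q v' -> h (keval p u - keval q v) = 0.
Proof. by move=> hu hv e; rewrite rmorphB !keval_mor hu hv e subrr. Qed.

Lemma kmor_expr_eq (k : fieldType) (A B : kalg k) (h : kmor A B) i j u v u' v' :
  h u = u' -> h v = v' -> u' ^+ i = v' ^+ j -> h (u ^+ i - v ^+ j) = 0.
Proof. by move=> hu hv e; rewrite rmorphB !rmorphXn hu hv e subrr. Qed.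

Lemma comm_inverse (R : pzRingType) (b u v : R) :
  u * v = 1 -> v * u = 1 -> GRing.comm b u -> GRing.comm b v.
Proof.
move=> uv vu bu; rewrite /GRing.comm -[b * v]mul1r -vu -!mulrA.
by rewrite [u * (b * v)]mulrA -bu -!mulrA uv mulr1.
Qed.

Lemma subalgebra_comm (k : fieldType) (A B : kalg k) (h : kmor A B) (b : B) :
  subalgebra (fun u => GRing.comm b (h u)).
Proof.
split=> [c|u v|u v]; rewrite ?kmor_in ?rmorphB ?rmorphM.
- by rewrite /GRing.comm kcentral.
- exact: commrB.
- exact: commrM.
Qed.

Lemma Aone_images_commute (k : fieldType) (B : kalg k) n g m f
    (X U V Y W Z : B) (L : kmor (Aone n g) B) (R : kmor (Aone m f) B) :
  U * V = 1 -> V * U = 1 -> W * Z = 1 -> Z * W = 1 ->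
  [/\ L (Aone_x n g) = X, L (Aone_a n g) = U & L (Aone_ai n g) = V] ->
  [/\ R (Aone_x m f) = Y, R (Aone_a m f) = W & R (Aone_ai m f) = Z] ->
  GRing.comm X Y -> GRing.comm X W -> GRing.comm U Y -> GRing.comm U W ->
  forall p q, L p * R q = R q * L p.
Proof.
move=> UV VU WZ ZW [Lx La Lai] [Rx Ra Rai] cXY cXW cUY cUW p q.
have R_X u : GRing.comm u Y -> GRing.comm u W -> GRing.comm u (R q).
  move=> uY uW; move: q; apply: generated_Aone; first exact: subalgebra_comm.
  move=> v [] ->; [by rewrite Rx|by rewrite Ra|rewrite Rai].
  exact: comm_inverse WZ ZW uW.
have cV w : GRing.comm U w -> GRing.comm V w.
  by move=> Uw; apply/commr_sym/(comm_inverse UV VU)/commr_sym.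
suff: GRing.comm (R q) (L p) by move=> /commr_sym.
move: p; apply: generated_Aone; first exact: subalgebra_comm.
move=> v [] ->; apply/commr_sym.
- exact: (eq_ind_r (fun w => GRing.comm w (R q)) (R_X _ cXY cXW) Lx).
- exact: (eq_ind_r (fun w => GRing.comm w (R q)) (R_X _ cUY cUW) La).
- exact: (eq_ind_r (fun w => GRing.comm w (R q)) (R_X _ (cV _ cUY) (cV _ cUW)) Lai).
Qed.

Section TwoVariables.
Variables (k : fieldType) (n : nat) (g : {poly k}) (m : nat) (f : {poly k}).
Hypotheses (deg_g : size g = n.+1) (g0 : g`_0 = 0).
Hypotheses (deg_f : size f = m.+1) (f0 : f`_0 = 0).
Local Notation A := (Atwo n g m f).
Local Notation x := (Atwo_x n g m f).
Local Notation a := (Atwo_a n g m f).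
Local Notation ai := (Atwo_ai n g m f).
Local Notation y := (Atwo_y n g m f).
Local Notation b := (Atwo_b n g m f).
Local Notation bi := (Atwo_bi n g m f).
Local Notation il := (Atwo_l n g m f).
Local Notation ir := (Atwo_r n g m f).

Lemma Atwo_comm p q : il p * ir q = ir q * il p.
Proof. exact: (kmor_comm (kpi _) (kinlr_comm p q)). Qed.

Lemma Atwo_aai : a * ai = 1.
Proof. by rewrite -rmorphM Aone_aai rmorph1. Qed.
Lemma Atwo_aia : ai * a = 1.
Proof. by rewrite -rmorphM Aone_aia rmorph1. Qed.
Lemma Atwo_bbi : b * bi = 1.
Proof. by rewrite -rmorphM Aone_aai rmorph1. Qed.
Lemma Atwo_bib : bi * b = 1.
Proof. by rewrite -rmorphM Aone_aia rmorph1. Qed.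
Lemma Atwo_pairl : additive_pair n g x a.
Proof. exact/additive_pair_mor/Aone_pair. Qed.
Lemma Atwo_pairr : additive_pair m f y b.
Proof. exact/additive_pair_mor/Aone_pair. Qed.

Let T : kalg k := ktens (Aone n g) (Aone m f).
Let xT : T := kinl _ _ (Aone_x n g).
Let aT : T := kinl _ _ (Aone_a n g).
Let yT : T := kinr _ _ (Aone_x m f).
Let bT : T := kinr _ _ (Aone_a m f).

Lemma Atwo_gf : keval g x = keval f y.
Proof.
have rel : Atwo_rel (keval g xT - keval f yT) by left.
exact: etrans (esym (keval_mor (kpi _) g xT))
  (etrans (kpi_eq rel) (keval_mor (kpi _) f yT)).
Qed.

Lemma Atwo_anbm : a ^+ n = b ^+ m.
Proof.
have rel : Atwo_rel (aT ^+ n - bT ^+ m) by right.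
exact: etrans (esym (rmorphXn (kpi _) n aT))
  (etrans (kpi_eq rel) (rmorphXn (kpi _) m bT)).
Qed.

Section Lift.
Variables (B : kalg k) (X U V Y W Z : B).
Hypotheses (UV : U * V = 1) (VU : V * U = 1) (XU : additive_pair n g X U).
Hypotheses (WZ : W * Z = 1) (ZW : Z * W = 1) (YW : additive_pair m f Y W).
Hypotheses (cXY : GRing.comm X Y) (cXW : GRing.comm X W).
Hypotheses (cUY : GRing.comm U Y) (cUW : GRing.comm U W).
Hypotheses (gf : keval g X = keval f Y) (anbm : U ^+ n = W ^+ m).

Let L : kmor (Aone n g) B := Aone_lift deg_g UV VU XU.
Let R : kmor (Aone m f) B := Aone_lift deg_f WZ ZW YW.
Let LR p q : L p * R q = R q * L p.
Proof.
exact: Aone_images_commute UV VU WZ ZW (Aone_liftE deg_g UV VU XU)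
  (Aone_liftE deg_f WZ ZW YW) cXY cXW cUY cUW p q.
Qed.
Let F : kmor T B := ktens_lift LR.

Let F_rel u : Atwo_rel u -> F u = 0.
Proof.
have Fx : F xT = X by apply: etrans (ktens_lift_l _ _) _; exact: Aone_lift_x.
have Fa : F aT = U by apply: etrans (ktens_lift_l _ _) _; exact: Aone_lift_a.
have Fy : F yT = Y by apply: etrans (ktens_lift_r _ _) _; exact: Aone_lift_x.
have Fb : F bT = W by apply: etrans (ktens_lift_r _ _) _; exact: Aone_lift_a.
by case=> ->; [exact: kmor_keval_eq Fx Fy gf|exact: kmor_expr_eq Fa Fb anbm].
Qed.

Lemma Atwo_lift_sig : {h : kmor A B |
  (forall p, h (il p) = Aone_lift deg_g UV VU XU p) /\
  (forall q, h (ir q) = Aone_lift deg_f WZ ZW YW q)}.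
Proof.
exists (kquot_lift F_rel); split=> p; apply: etrans (kquot_liftE F_rel _) _.
  exact: ktens_lift_l.
exact: ktens_lift_r.
Qed.

Definition Atwo_lift : kmor A B := sval Atwo_lift_sig.

Lemma Atwo_lift_l p : Atwo_lift (il p) = Aone_lift deg_g UV VU XU p.
Proof. exact: (svalP Atwo_lift_sig).1. Qed.
Lemma Atwo_lift_r q : Atwo_lift (ir q) = Aone_lift deg_f WZ ZW YW q.
Proof. exact: (svalP Atwo_lift_sig).2. Qed.
Lemma Atwo_liftE :
  [/\ Atwo_lift x = X, Atwo_lift a = U & Atwo_lift ai = V] /\
  [/\ Atwo_lift y = Y, Atwo_lift b = W & Atwo_lift bi = Z].
Proof.
have [Lx La Lai] := Aone_liftE deg_g UV VU XU.
have [Rx Ra Rai] := Aone_liftE deg_f WZ ZW YW.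
split; split.
- exact: etrans (Atwo_lift_l _) Lx.
- exact: etrans (Atwo_lift_l _) La.
- exact: etrans (Atwo_lift_l _) Lai.
- exact: etrans (Atwo_lift_r _) Rx.
- exact: etrans (Atwo_lift_r _) Ra.
- exact: etrans (Atwo_lift_r _) Rai.
Qed.
End Lift.

Definition Atwo_gen (u : A) : Prop :=
  (exists p, u = il p) \/ (exists q, u = ir q).

Lemma generated_Atwo_lr : generated Atwo_gen.
Proof.
have := generated_kpi (S := @Atwo_rel k n g m f) (@generated_tens k (Aone n g) (Aone m f)).
move/generated_sub; apply=> P sP GP u [v [[p ->]|[q ->]] ->]; apply: GP.
  by left; exists p.
by right; exists q.
Qed.

Definition Atwo_letter (u : A) : Prop :=
  [\/ u = x, u = a | u = ai] \/ [\/ u = y, u = b | u = bi].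

Lemma subalgebra_preim (B C : kalg k) (h : kmor B C) (P : C -> Prop) :
  subalgebra P -> subalgebra (fun u => P (h u)).
Proof.
by case=> Pk PB PM; split=> [c|u v|u v]; rewrite ?kmor_in ?rmorphB ?rmorphM;
  [exact: Pk | exact: PB | exact: PM].
Qed.

Lemma generated_Atwo : generated Atwo_letter.
Proof.
apply: generated_sub generated_Atwo_lr _ => P sP GP u [[p ->]|[q ->]].
  move: p; apply: generated_Aone; first exact: subalgebra_preim.
  by move=> p [] ->; apply: GP; left; [constructor 1|constructor 2|constructor 3].
move: q; apply: generated_Aone; first exact: subalgebra_preim.
by move=> p [] ->; apply: GP; right; [constructor 1|constructor 2|constructor 3].
Qed.

End TwoVariables.

Opaque Atwo Atwo_l Atwo_r.

Section Relations.
Variables (k : fieldType) (n : nat) (g : {poly k}) (m : nat) (f : {poly k}).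
Hypotheses (deg_g : size g = n.+1) (g0 : g`_0 = 0).
Hypotheses (deg_f : size f = m.+1) (f0 : f`_0 = 0).
Implicit Types B : kalg k.

(** The defining relations of A(g,f), as a predicate on six elements of an
    algebra.  The comultiplication, counit, antipode, reversal, exchange of the
    factors and the modules below are all obtained by exhibiting six elements
    that satisfy it. *)
Record Atwo_relations B (x a ai y b bi : B) : Prop := AtwoRelations {
  rel_aai : a * ai = 1;
  rel_aia : ai * a = 1;
  rel_xa : additive_pair n g x a;
  rel_bbi : b * bi = 1;
  rel_bib : bi * b = 1;
  rel_yb : additive_pair m f y b;
  rel_xy : GRing.comm x y;
  rel_xb : GRing.comm x b;
  rel_ay : GRing.comm a y;
  rel_ab : GRing.comm a b;
  rel_gf : keval g x = keval f y;
  rel_anbm : a ^+ n = b ^+ m }.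

Local Notation A := (Atwo n g m f).
Local Notation x := (Atwo_x n g m f).
Local Notation a := (Atwo_a n g m f).
Local Notation ai := (Atwo_ai n g m f).
Local Notation y := (Atwo_y n g m f).
Local Notation b := (Atwo_b n g m f).
Local Notation bi := (Atwo_bi n g m f).

Lemma Atwo_satisfies : Atwo_relations x a ai y b bi.
Proof.
apply: AtwoRelations.
- exact: Atwo_aai.
- exact: Atwo_aia.
- exact: Atwo_pairl.
- exact: Atwo_bbi.
- exact: Atwo_bib.
- exact: Atwo_pairr.
- exact: Atwo_comm.
- exact: Atwo_comm.
- exact: Atwo_comm.
- exact: Atwo_comm.
- exact: Atwo_gf.
- exact: Atwo_anbm.
Qed.

Lemma Atwo_mor B (X U V Y W Z : B) : Atwo_relations X U V Y W Z ->
  {h : kmor A B | [/\ h x = X, h a = U & h ai = V] /\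
                  [/\ h y = Y, h b = W & h bi = Z]}.
Proof.
case=> ? ? ? ? ? ? ? ? ? ? ? ?.
by eexists; apply: Atwo_liftE.
Qed.

Lemma comm_kt B (u v u' v' : B) : GRing.comm u u' -> GRing.comm v v' ->
  GRing.comm (kt u v : ktens B B) (kt u' v').
Proof.
by move=> uu vv; rewrite /GRing.comm; apply: etrans (ktM _ _ _ _) _; rewrite uu vv; apply/esym/ktM.
Qed.

Section Derived.
Variables (B : kalg k) (X U V Y W Z : B).
Hypothesis rel : Atwo_relations X U V Y W Z.

Lemma relations_tens : @Atwo_relations (ktens B B)
  (kt 1 X + kt X U) (kt U U) (kt V V) (kt 1 Y + kt Y W) (kt W W) (kt Z Z).
Proof.
case: rel => UV VU XU WZ ZW YW cXY cXW cUY cUW gf ab.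
have kt_inv (u v : B) : u * v = 1 -> (kt u u : ktens B B) * kt v v = 1.
  by move=> uv; apply: etrans (ktM _ _ _ _) _; rewrite uv.
have c1 (u : B) : GRing.comm 1 u by exact/commr_sym/commr1.
have c1' (u : B) : GRing.comm u 1 by exact/commr1.
apply: AtwoRelations.
- exact: kt_inv.
- exact: kt_inv.
- exact: additive_pair_tens.
- exact: kt_inv.
- exact: kt_inv.
- exact: additive_pair_tens.
- apply/commrD; apply/commr_sym/commrD; apply: comm_kt => //; exact: commr_sym.
- apply/commr_sym/commrD; apply: comm_kt => //; exact: commr_sym.
- by apply/commrD; apply: comm_kt.
- exact: comm_kt.
- apply: etrans (keval_tens deg_g g0 XU) (etrans _ (esym (keval_tens deg_f f0 YW))).
  by rewrite gf ab.
- apply: etrans (kt_expr _ _ _) (etrans _ (esym (kt_expr _ _ _))).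
  by rewrite ab.
Qed.

Lemma comm_op (u v : B) : GRing.comm u v -> @GRing.comm (kop B) u v.
Proof. by move=> uv; exact: (esym uv). Qed.

Lemma relations_op : @Atwo_relations (kop B) X U V Y W Z.
Proof.
case: rel => UV VU XU WZ ZW YW cXY cXW cUY cUW gf ab.
apply: AtwoRelations.
- exact: VU.
- exact: UV.
- exact: additive_pair_op.
- exact: ZW.
- exact: WZ.
- exact: additive_pair_op.
- exact: (comm_op cXY).
- exact: (comm_op cXW).
- exact: (comm_op cUY).
- exact: (comm_op cUW).
- exact: (@etrans B _ _ _ (keval_op g X) (etrans gf (esym (keval_op f Y)))).
- exact: (@etrans B _ _ _ (revrX U n) (etrans ab (esym (revrX W m)))).
Qed.

Lemma relations_antipode :
  Atwo_relations (- (X * V)) V U (- (Y * Z)) Z W.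
Proof.
case: rel => UV VU XU WZ ZW YW cXY cXW cUY cUW gf ab.
have cV w : GRing.comm U w -> GRing.comm V w.
  by move=> Uw; apply/commr_sym/(comm_inverse UV VU)/commr_sym.
have cZ w : GRing.comm w W -> GRing.comm w Z by apply: comm_inverse.
have cM (u v w : B) : GRing.comm u w -> GRing.comm v w -> GRing.comm (u * v) w.
  by move=> uw vw; apply/commr_sym/commrM; apply: commr_sym.
have cN (u w : B) : GRing.comm u w -> GRing.comm (- u) w.
  by move=> uw; apply/commr_sym/commrN/commr_sym.
have VZ : V ^+ n = Z ^+ m := inverse_expr_eq UV VU WZ ZW ab.
apply: AtwoRelations.
- exact: VU.
- exact: UV.
- exact: (additive_pair_antipode deg_g g0 UV VU XU).
- exact: ZW.
- exact: WZ.
- exact: (additive_pair_antipode deg_f f0 WZ ZW YW).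
- by apply/cN/commrN/cM; [apply: commrM => //; apply: cZ|
    apply: commrM; apply: cV => //; apply: cZ].
- by apply/cN/cM; [apply: cZ|apply/cV/cZ].
- by apply/commrN/commrM; [apply: cV|apply/cV/cZ].
- exact/cV/cZ.
- by rewrite (keval_antipode deg_g g0 UV VU XU) (keval_antipode deg_f f0 WZ ZW YW) gf VZ.
- exact: VZ.
Qed.

End Derived.

Lemma relations_counit : @Atwo_relations (kself k) 0 1 1 0 1 1.
Proof.
apply: AtwoRelations.
- exact: mulr1.
- exact: mulr1.
- exact: additive_pair_counit.
- exact: mulr1.
- exact: mulr1.
- exact: additive_pair_counit.
- exact: (mulrC (0 : k)).
- exact: (mulrC (0 : k)).
- exact: (mulrC (1 : k)).
- exact: (mulrC (1 : k)).
- by rewrite (keval0 g0) (keval0 f0).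
- by rewrite !expr1n.
Qed.

Definition Atwo_comul : kmor A (ktens A A) :=
  sval (Atwo_mor (relations_tens Atwo_satisfies)).
Definition Atwo_counit : kmor A (kself k) := sval (Atwo_mor relations_counit).
Definition Atwo_antipode : kmor A (kop A) :=
  sval (Atwo_mor (relations_op (relations_antipode Atwo_satisfies))).

Lemma Atwo_comulE :
  [/\ Atwo_comul x = kt 1 x + kt x a, Atwo_comul a = kt a a
    & Atwo_comul ai = kt ai ai] /\
  [/\ Atwo_comul y = kt 1 y + kt y b, Atwo_comul b = kt b b
    & Atwo_comul bi = kt bi bi].
Proof. exact: (svalP (Atwo_mor (relations_tens Atwo_satisfies))). Qed.
Lemma Atwo_counitE :
  [/\ Atwo_counit x = 0, Atwo_counit a = 1 & Atwo_counit ai = 1] /\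
  [/\ Atwo_counit y = 0, Atwo_counit b = 1 & Atwo_counit bi = 1].
Proof. exact: (svalP (Atwo_mor relations_counit)). Qed.
Lemma Atwo_antipodeE :
  [/\ anti Atwo_antipode x = - (x * ai), anti Atwo_antipode a = ai
    & anti Atwo_antipode ai = a] /\
  [/\ anti Atwo_antipode y = - (y * bi), anti Atwo_antipode b = bi
    & anti Atwo_antipode bi = b].
Proof.
exact: (svalP (Atwo_mor (relations_op (relations_antipode Atwo_satisfies)))).
Qed.

Lemma Atwo_hopf_axioms u : Atwo_letter u ->
  hopf_axioms_at Atwo_comul Atwo_counit Atwo_antipode u.
Proof.
have [[Dx Da Dai] [Dy Db Dbi]] := Atwo_comulE.
have [[ex ea eai] [ey eb ebi]] := Atwo_counitE.
have [[Sx Sa Sai] [Sy Sb Sbi]] := Atwo_antipodeE.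
have [aai aia _ bbi bib _ _ _ _ _ _ _] := Atwo_satisfies.
case=> -[] ->.
- exact: skew_primitive_hopf_axioms aai Da ea Sa Dx ex Sx aia.
- exact: grouplike_hopf_axioms aai aia Da ea Sa.
- exact: grouplike_hopf_axioms aia aai Dai eai Sai.
- exact: skew_primitive_hopf_axioms bbi Db eb Sb Dy ey Sy bib.
- exact: grouplike_hopf_axioms bbi bib Db eb Sb.
- exact: grouplike_hopf_axioms bib bbi Dbi ebi Sbi.
Qed.

Definition Atwo_hopf : hopf A :=
  hopf_build (@generated_Atwo k n g m f) Atwo_hopf_axioms.

Lemma Atwo_hopf_onl : hopf_on Atwo_hopf x a ai.
Proof.
have [[Dx Da _] _] := Atwo_comulE; have [[ex ea _] _] := Atwo_counitE.
by have [[Sx Sa _] _] := Atwo_antipodeE.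
Qed.

Lemma Atwo_hopf_onr : hopf_on Atwo_hopf y b bi.
Proof.
have [_ [Dx Da _]] := Atwo_comulE; have [_ [ex ea _]] := Atwo_counitE.
by have [_ [Sx Sa _]] := Atwo_antipodeE.
Qed.

End Relations.

(** * The coordinate ring of the curve *)
Module TwoVariablePolynomials.
Import mpoly.

Section Lift.
Variables (k : fieldType) (B : kalg k) (X Y : B).
Hypothesis cXY : GRing.comm X Y.

Let mono (m : 'X_{1..2}) : B := X ^+ m (inord 0) * Y ^+ m (inord 1).

Definition poly2_fun (p : mpoly.mpoly 2 k) : B :=
  \sum_(m <- mpoly.msupp p) kin B (mpoly.mcoeff m p) * mono m.

Let poly2_funE (p : mpoly.mpoly 2 k) i : (mpoly.msize p <= i)%N ->
  poly2_fun p = \sum_(m : 'X_{1..2 < i}) kin B (mpoly.mcoeff m p) * mono m.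
Proof.
move=> le_pi; set I : subFinType _ := 'X_{1..2 < i}.
rewrite /poly2_fun (ssrcomplements.big_mksub I) ?msupp_uniq //=; first last.
  by move=> x /msize_mdeg_lt /leq_trans; apply.
rewrite big_rmcond //= => j /memN_msupp_eq0 ->.
by rewrite rmorph0 mul0r.
Qed.

Fact poly2_fun_zmod : zmod_morphism poly2_fun.
Proof.
move=> p q; pose i := maxn (mpoly.msize (p - q))
  (maxn (mpoly.msize p) (mpoly.msize q)).
rewrite !(@poly2_funE _ i) ?leq_maxl ?leq_maxr //; first last.
- by rewrite /i !leq_max leqnn !orbT.
- by rewrite /i !leq_max leqnn !orbT.
rewrite -sumrB; apply: eq_bigr => m _.
by rewrite mcoeffB rmorphB mulrBl.
Qed.
HB.instance Definition _ :=
  GRing.isZmodMorphism.Build (mpoly.mpoly 2 k) B poly2_fun poly2_fun_zmod.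

Let funD p q : poly2_fun (p + q) = poly2_fun p + poly2_fun q.
Proof. exact: raddfD. Qed.
Let fun0 : poly2_fun 0 = 0.
Proof. exact: raddf0. Qed.

Let poly2_funX c m : poly2_fun (c *: mpolyX k m : mpoly.mpoly 2 k) = kin B c * mono m.
Proof.
have [->|c0] := eqVneq c 0; first by rewrite scale0r rmorph0 mul0r fun0.
rewrite /poly2_fun -mul_mpolyC mul_mpolyC msuppMCX // big_seq1.
by rewrite mcoeffZ mcoeffX eqxx mulr1.
Qed.

Let monoM m m' : mono (m + m') = mono m * mono m'.
Proof.
rewrite /mono !mnmDE !exprD -!mulrA; congr (_ * _); rewrite !mulrA; congr (_ * _).
exact: (commrX _ (commr_sym (commrX _ (commr_sym cXY)))).
Qed.

Fact poly2_fun_monoid : monoid_morphism poly2_fun.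
Proof.
split.
  have -> : 1 = 1 *: mpolyX k 0%MM :> mpoly.mpoly 2 k.
    by rewrite scale1r mpolyX0.
  by rewrite poly2_funX rmorph1 mul1r /mono !mnm0E !expr0 mulr1.
move=> p q; elim/mpolyind: p => [|c m p' _ _ IHp].
  by rewrite mul0r !fun0 mul0r.
rewrite mulrDl !funD IHp mulrDl; congr (_ + _).
elim/mpolyind: q {IHp} => [|d m' q' _ _ IHq].
  by rewrite mulr0 !fun0 mulr0.
rewrite mulrDr !funD IHq mulrDr; congr (_ + _).
rewrite !poly2_funX -scalerAl -scalerAr scalerA -mpolyXD poly2_funX monoM rmorphM.
have swap (u v : B) : kin B c * kin B d * (u * v) = kin B c * u * (kin B d * v).
  by rewrite -!mulrA; congr (_ * _); rewrite !mulrA kcentral.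
exact: swap.
Qed.
HB.instance Definition _ :=
  GRing.isMonoidMorphism.Build (mpoly.mpoly 2 k) B poly2_fun poly2_fun_monoid.

Fact poly2_fun_in c : poly2_fun (kin (kpoly2 k) c) = kin B c.
Proof.
have -> : kin (kpoly2 k) c = c *: mpolyX k 0%MM :> mpoly.mpoly 2 k.
  by rewrite mpolyX0 -mul_mpolyC mulr1.
by rewrite poly2_funX /mono !mnm0E !expr0 !mulr1.
Qed.

Definition poly2_lift : kmor (kpoly2 k) B :=
  @Kmor k (kpoly2 k) B (poly2_fun : {rmorphism mpoly.mpoly 2 k -> B}) poly2_fun_in.

Lemma poly2_lift_x : poly2_lift (poly2_x k) = X.
Proof.
rewrite /= -[poly2_x k]/(mpolyX k U_(inord 0) : mpoly.mpoly 2 k) -[mpolyX _ _]scale1r.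
rewrite poly2_funX rmorph1 mul1r /mono !mnm1E eqxx.
by rewrite -val_eqE /= !inordK // expr0 mulr1.
Qed.

Lemma poly2_lift_y : poly2_lift (poly2_y k) = Y.
Proof.
rewrite /= -[poly2_y k]/(mpolyX k U_(inord 1) : mpoly.mpoly 2 k) -[mpolyX _ _]scale1r.
rewrite poly2_funX rmorph1 mul1r /mono !mnm1E eqxx.
by rewrite -val_eqE /= !inordK // expr0 mul1r.
Qed.
End Lift.

Lemma generated_poly2 (k : fieldType) :
  generated (fun u : kpoly2 k => u = poly2_x k \/ u = poly2_y k).
Proof.
move=> P sP GP p; have [Pk _ PM] := sP.
have Px : P (poly2_x k) by apply: GP; left.
have Py : P (poly2_y k) by apply: GP; right.
have PX u d : P u -> P (u ^+ d).
  by move=> Pu; elim: d => [|d IH]; [exact: subalgebra1 sP|rewrite exprS; apply: PM].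
elim/mpolyind: (p : mpoly.mpoly 2 k) => [|c m q _ _ IH]; first exact: subalgebra0 sP.
apply: (subalgebraD sP) => //; rewrite -mul_mpolyC; apply: (PM (kin (kpoly2 k) c)) => //.
rewrite mpolyXE_id big_ord_recl big_ord1; apply: PM.
  rewrite (_ : ord0 = inord 0); first exact: (PX (poly2_x k)).
  by apply/val_inj; rewrite /= inordK.
rewrite (_ : lift ord0 ord0 = inord 1); first exact: (PX (poly2_y k)).
by apply/val_inj; rewrite /= inordK.
Qed.

End TwoVariablePolynomials.

Section Curve.
Variables (k : fieldType) (g f : {poly k}).

Lemma generated_curve :
  generated (fun u : curve g f => u = curve_x g f \/ u = curve_y g f).
Proof.
apply: generated_sub (generated_kpi (S := curve_rel g f)
  (@TwoVariablePolynomials.generated_poly2 k)) _.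
move=> P sP GP u [v [->|->] ->]; apply: GP; first by left.
by right.
Qed.

Lemma curveC (u v : curve g f) : u * v = v * u.
Proof.
have sub (w : curve g f) : subalgebra (fun t => GRing.comm w t).
  exact: (subalgebra_comm (kid _) w).
have xy : GRing.comm (curve_x g f) (curve_y g f).
  by apply: (kmor_comm (kpi _)); apply: mulrC.
move: v; apply: generated_curve => [|v Gv]; first exact: sub.
apply/commr_sym; move: u; apply: generated_curve => [|u Gu]; first exact: sub.
case: Gv Gu => -> [] -> //; exact: commr_sym.
Qed.

Lemma curve_eq : keval g (curve_x g f) = keval f (curve_y g f).
Proof.
have rel : curve_rel g f (keval g (poly2_x k) - keval f (poly2_y k)) by [].
exact: etrans (esym (keval_mor (kpi _) g (poly2_x k)))
  (etrans (kpi_eq rel) (keval_mor (kpi _) f (poly2_y k))).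
Qed.

Lemma curve_mor (B : kalg k) (X Y : B) : GRing.comm X Y -> keval g X = keval f Y ->
  {h : kmor (curve g f) B | h (curve_x g f) = X /\ h (curve_y g f) = Y}.
Proof.
move=> cXY gf; pose h := TwoVariablePolynomials.poly2_lift cXY.
have h_rel u : curve_rel g f u -> h u = 0.
  by move=> ->; exact: (kmor_keval_eq (TwoVariablePolynomials.poly2_lift_x cXY)
    (TwoVariablePolynomials.poly2_lift_y cXY) gf).
exists (kquot_lift h_rel); split.
  exact: etrans (kquot_liftE h_rel _) (TwoVariablePolynomials.poly2_lift_x cXY).
exact: etrans (kquot_liftE h_rel _) (TwoVariablePolynomials.poly2_lift_y cXY).
Qed.

End Curve.

(** * Normal words and the rank induction *)
Lemma nseqSr (T : Type) t (c : T) : nseq t.+1 c = nseq t c ++ [:: c].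
Proof. by elim: t => //= t ->. Qed.

Section Blocks.
Variable n : nat.
Hypothesis n_ge2 : (2 <= n)%N.
Local Open Scope nat_scope.

(** The block (i, t) stands for the word a^i x^t. *)
Definition block : Type := {p : nat * nat | [&& 0 < p.1, 0 < p.2 & p.1 + p.2 < n]}.
Implicit Types (W : seq block) (s : nat).

(** The head of the list is the last block of the word: multiplication by a
    letter on the right only changes the head. *)
Fixpoint state_word W : seq bool :=
  if W is b :: W' then
    state_word W' ++ nseq (val b).1 true ++ nseq (val b).2 false
  else [::].

(** With the rank rank(w) n + s for the normal word w a^s, multiplication by a
    adds 1 to the rank and multiplication by x multiplies it by n, as long as
    the product remains a normal word. *)
Fixpoint state_rank W : nat :=
  if W is b :: W' then
    (state_rank W' * n + (val b).1) * n ^ (val b).2.-1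
  else 1.

(** What becomes of the normal word w a^s after multiplication by x on the
    right: a longer normal word, the word x with no letter a before it, or a
    normal word followed by the leading word a^j x^(n-j). *)
Variant step_result : Type :=
  StepCons of seq block | StepBase | StepLead of nat & seq block.

Definition step W s : step_result :=
  if insub (s, 1) is Some b then StepCons (b :: W)
  else if s == 0 then
    if W is b :: W' then
      if insub ((val b).1, (val b).2.+1) is Some b' then StepCons (b' :: W')
      else StepLead (val b).1 W'
    else StepBase
  else StepLead n.-1 W.

Definition lead_word j : seq bool := nseq j true ++ nseq (n - j) false.

Variant step_spec W s : step_result -> Prop :=
| StepConsSpec W2 : state_rank W2 = state_rank W * n + s ->
    state_word W2 = state_word W ++ nseq s true ++ [:: false] ->
    step_spec W s (StepCons W2)
| StepBaseSpec : W = [::] -> s = 0 -> step_spec W s StepBase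
| StepLeadSpec j W' : 0 < j < n ->
    state_rank W * n + s = (state_rank W' * n + j) * n ^ (n.-1 - j) ->
    state_word W ++ nseq s true ++ [:: false] = state_word W' ++ lead_word j ->
    step_spec W s (StepLead j W').

Lemma stepP W s : s < n -> step_spec W s (step W s).
Proof.
move=> lt_sn; rewrite /step; case: insubP => [b _ vb|].
  by apply: StepConsSpec; rewrite /= vb ?expn0 ?muln1.
rewrite /= addn1 -/(s.+1 < n) => nb.
have [s0|s_gt0] := posnP s; last first.
  have sn : s = n.-1 by lia.
  rewrite sn; apply: StepLeadSpec; rewrite ?subnn ?expn0 ?muln1 //; first lia.
  by rewrite /lead_word (_ : n - n.-1 = 1) //; lia.
rewrite s0; case: W => [|[[i t] itP] W]; first exact: StepBaseSpec.
have /and3P[i0 t0 it] := itP; simpl in i0, t0, it.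
case: insubP => [b' _ vb'|nb'].
  apply: StepConsSpec; rewrite /= vb' /=.
    by rewrite addn0 -mulnA -expnSr prednK.
  by rewrite -!catA -[_ :: _]/(nseq t.+1 false) nseqSr.
have it1 : i + t = n.-1 by move: nb'; rewrite /= i0 /=; lia.
apply: StepLeadSpec => /=; first lia.
  by rewrite /= addn0 -mulnA -expnSr prednK // (_ : n.-1 - i = t) //; lia.
rewrite /= /lead_word (_ : n - i = t.+1); last by lia.
by rewrite -!catA nseqSr.
Qed.

Lemma state_rank_gt0 W : 0 < state_rank W.
Proof.
elim: W => [//|b W IH] /=; rewrite muln_gt0 expn_gt0 addn_gt0 muln_gt0 IH.
by rewrite (ltnW n_ge2).
Qed.

End Blocks.

Lemma leading_trues (w : seq bool) :
  exists p, w = nseq p true \/ exists w', w = nseq p true ++ false :: w'.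
Proof.
elim: w => [|[] w [p IH]]; first by exists 0%N; left.
  by exists p.+1; case: IH => [->|[w' ->]]; [left|right; exists w'].
by exists 0%N; right; exists w.
Qed.

Section RankInduction.
Variables (k : fieldType) (n : nat) (g : {poly k}).
Hypothesis n_ge2 : (2 <= n)%N.

Fact ordn_proof (i : nat) : (i %% n < n)%N.
Proof. by rewrite ltn_pmod // ltnW. Qed.
Definition ordn i : 'I_n := Ordinal (ordn_proof i).

Lemma ordn_id (s : 'I_n) : ordn s = s.
Proof. by apply/val_inj; rewrite /= modn_small. Qed.

Lemma ordnD i j : ordn (ordn i + j) = ordn (i + j).
Proof. by apply/val_inj; rewrite /= modnDml. Qed.

Section Tail.
Variables (L : lmodType k) (x a : L -> L).

Definition word_act (w : seq bool) (u : L) : L :=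
  foldr (fun c v => if c then a v else x v) u w.

(** The j-th relation without its leading term, applied to u: the words other
    than a^j x^(n-j), minus the right-hand side r_j a^n. *)
Definition tail_act (j : nat) (u : L) : L :=
  \sum_(i < n.+1) g`_i *:
    \sum_(w : i.-tuple bool | (count_mem true w == j) && (tval w != lead_word n j))
      word_act w u
  - g`_j *: iter n a u.

Lemma word_act_cat v w u : word_act (v ++ w) u = word_act v (word_act w u).
Proof. exact: foldr_cat. Qed.

Lemma word_act_true i u : word_act (nseq i true) u = iter i a u.
Proof. by elim: i => //= i ->. Qed.
End Tail.

Section Chain.
Variables (L : lmodType k) (a : L -> L).
Variable Rel : seq (block n) -> 'I_n -> L -> Prop.
Hypothesis Rel0 : forall W s, Rel W s 0.
Hypothesis RelL : forall W s c u v, Rel W s u -> Rel W s v -> Rel W s (c *: u + v).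
Hypothesis RelA : forall W (s : 'I_n) u, Rel W (ordn s.+1) u -> Rel W s (a u).

(** [Rel W s u] is a property of u that concerns the state w a^s only, such as
    a value at that state; [agree r u] asserts it below the rank r. *)
Definition agree r u := forall W s, (state_rank W < r)%N -> Rel W s u.

Lemma Rel_iter W i p u : Rel W (ordn (i + p)) u -> Rel W (ordn i) (iter p a u).
Proof.
elim: p i => [|p IH] i; first by rewrite addn0.
rewrite iterS => h; apply: RelA; rewrite -[X in ordn X]addn1 ordnD addn1.
by apply: IH; rewrite addSnnS.
Qed.

Section OneOperator.
Variables (x : L -> L) (r0 : nat).
Hypothesis Rel_x : forall r u, (r <= r0)%N -> agree r u ->
  forall W (s : 'I_n), (state_rank W * n + s < r)%N -> Rel W s (x u).

(** A letter a costs nothing, as it stays among the states of one word, and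
    each letter x divides the range of ranks by n. *)
Lemma agree_word w r u : (r * n ^ count_mem false w <= r0)%N ->
  agree (r * n ^ count_mem false w) u -> agree r (word_act x a w u).
Proof.
elim: w r => [|[] w IH] r /=; first by rewrite expn0 muln1.
  rewrite add0n => le_r ag W s lt_W; apply: RelA.
  exact: IH le_r ag W _ lt_W.
rewrite add1n expnS mulnA => le_r ag W s lt_W.
apply: (@Rel_x (r * n)%N).
- apply: leq_trans (le_r); apply: leq_pmulr; rewrite expn_gt0; lia.
- exact: IH.
- have := ltn_ord s; nia.
Qed.

(** Termination: a word of the j-th relation other than the leading one either
    has fewer than j letters a before its first x, or has j of them but fewer
    letters x, so that it needs u only below the rank of w a^j x^(n-1-j). *)
Lemma Rel_tail W j u : (0 < j < n)%N ->
  ((state_rank W * n + j) * n ^ (n.-1 - j) <= r0)%N -> agree r0 u ->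
  Rel W (ordn 0) (tail_act x a j u).
Proof.
move=> /andP[j_gt0 lt_jn] le_r0 ag.
have RelD W' s v w : Rel W' s v -> Rel W' s w -> Rel W' s (v + w).
  by move=> Rv; rewrite -[v]scale1r; apply: RelL.
have RelZ W' s c v : Rel W' s v -> Rel W' s (c *: v).
  by move=> Rv; rewrite -[c *: v]addr0; apply: RelL.
have rank_gt0 := state_rank_gt0 n_ge2 W.
have pow_gt0 e : (0 < n ^ e)%N by rewrite expn_gt0; lia.
have lt_W : (state_rank W < r0)%N.
  apply: leq_trans (le_r0); apply: (@leq_trans (state_rank W * n + j)); first nia.
  exact/leq_pmulr/pow_gt0.
rewrite /tail_act -scaleNr; apply: (RelD); last first.
  by apply/RelZ/Rel_iter/ag.
elim/big_ind: _ => [//|v w|i _]; first exact: (RelD).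
apply: (RelZ); elim/big_ind: _ => [//|v w|w /andP[/eqP cw w_lead]]; first exact: (RelD).
have le_in : (i <= n)%N by rewrite -ltnS.
have := size_tuple w; move: (tval w) cw w_lead => {}w cw w_lead sz_w.
have [p [ew|[w' ew]]] := leading_trues w.
  by rewrite ew word_act_true; apply/Rel_iter/ag.
have cw' : (p + count_mem true w' = j)%N.
  by rewrite -cw ew count_cat count_nseq /= mul1n.
have fw' : (p + (size w').+1 = i)%N by rewrite -sz_w ew size_cat size_nseq.
have tw' : (count_mem false w' + count_mem true w' = size w')%N.
  rewrite -(count_predC (pred1 true) w') addnC; congr (_ + _)%N.
  by apply: eq_count => -[].
(* Only a^j x^(n-j) has j letters a first and n - j letters x after them. *)
have small : (state_rank W * n + p < state_rank W * n + j
              \/ count_mem false w' < n.-1 - j)%N.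
  have [lt_pj|ge_pj] := ltnP p j; first by left; rewrite ltn_add2l.
  right; have t0 : count_mem true w' = 0%N by lia.
  rewrite ltnNge; apply: contra w_lead => ge_f; apply/eqP.
  have pj : p = j by lia.
  have szw' : size w' = (n - j).-1 by lia.
  rewrite ew /lead_word pj; congr (_ ++ _).
  have -> : (n - j)%N = (size w').+1 by lia.
  rewrite /=; congr (_ :: _); move: t0; elim: (w') => [//|[] v IHv] //=.
  by rewrite add0n => /IHv <-.
rewrite ew word_act_cat word_act_true; apply: Rel_iter; rewrite add0n /=.
have op : ordn p = p :> nat by rewrite /= modn_small //; lia.
have le_r : ((state_rank W * n + p).+1 * n ^ count_mem false w' <= r0)%N.
  apply: leq_trans (le_r0); case: small => [lt_p|lt_f].
    by apply: leq_mul => //; apply: leq_pexp2l; lia.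
  have -> : (n.-1 - j = (n.-1 - j).-1.+1)%N by lia.
  rewrite expnS mulnA; apply: leq_mul; first nia.
  by apply: leq_pexp2l; lia.
apply: (@Rel_x (state_rank W * n + p).+1); last by rewrite op.
  by apply: leq_trans (le_r); apply: leq_pmulr; apply: pow_gt0.
apply: agree_word => // W' s lt_W'; apply: ag.
exact: leq_trans lt_W' le_r.
Qed.

End OneOperator.

Variable xN : nat -> L -> L.
Hypothesis Rel_step : forall N W (s : 'I_n) u,
  match step W s with
  | StepCons W2 => Rel W2 (ordn 0) u
  | StepBase => Rel [::] (ordn 0) u
  | StepLead j W' => Rel W' (ordn 0) (tail_act (xN N) a j u)
  end -> Rel W s (xN N.+1 u).

(** The fuel N bounds the rank.  The statement covers functions of states
    ([Rel] compares two values there) as well as elements of the algebra ([Rel]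
    asserts that a product lies in a given subspace). *)
Lemma rank_induction N r u : (r <= N)%N -> agree r u ->
  forall W (s : 'I_n), (state_rank W * n + s < r)%N -> Rel W s (xN N u).
Proof.
elim: N r u => [|N IH] r u le_r ag W s lt_W; first by lia.
apply: Rel_step; case: (stepP n_ge2 W (ltn_ord s)) => [W2 rW2 _|W0 s0|j W' jn rW' _].
- by apply: ag; rewrite rW2.
- by apply: ag => /=; move: lt_W; rewrite W0 /=; lia.
apply: (@Rel_tail (xN N) (state_rank W * n + s)) => //.
- move=> r' v le_r' agv W1 s1 lt1; apply: IH agv W1 s1 lt1; lia.
- by rewrite rW'.
- by move=> W1 s1 lt1; apply: ag; lia.
Qed.

End Chain.
End RankInduction.

(** * The algebra of endomorphisms of a vector space *)
Section Endomorphisms.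
Variables (k : fieldType) (M : lmodType k).

Record endo : Type := Endo { endo_fun :> M -> M; endo_linear : linear endo_fun }.

Lemma endoP (p q : endo) : p =1 q -> p = q.
Proof.
case: p q => [p pl] [q ql] /= /funext pq; case: q / pq ql => ql.
by congr Endo; apply: Prop_irrelevance.
Qed.

HB.instance Definition _ := gen_eqMixin endo.
HB.instance Definition _ := gen_choiceMixin endo.

Lemma endoD (p : endo) u v : p (u + v) = p u + p v.
Proof. by have := endo_linear p 1 u v; rewrite !scale1r. Qed.
Lemma endo0 (p : endo) : p 0 = 0.
Proof. by apply: (addIr (p 0)); rewrite -endoD !add0r. Qed.
Lemma endoZ (p : endo) c u : p (c *: u) = c *: p u.
Proof. by rewrite -[c *: u]addr0 endo_linear endo0 addr0. Qed.

Fact endo_zero_linear : linear (fun _ : M => 0 : M).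
Proof. by move=> c u v; rewrite scaler0 addr0. Qed.
Fact endo_one_linear : linear (fun u : M => u).
Proof. by []. Qed.
Fact endo_add_linear (p q : endo) : linear (fun u => p u + q u).
Proof. by move=> c u v; rewrite !endo_linear scalerDr addrACA. Qed.
Fact endo_opp_linear (p : endo) : linear (fun u => - p u).
Proof. by move=> c u v; rewrite endo_linear opprD scalerN. Qed.
Fact endo_mul_linear (p q : endo) : linear (fun u => p (q u)).
Proof. by move=> c u v; rewrite !endo_linear. Qed.
Fact endo_scale_linear c : linear (fun u : M => c *: u).
Proof. by move=> d u v; rewrite scalerDr !scalerA mulrC. Qed.

Definition endo_zero := Endo endo_zero_linear.
Definition endo_one := Endo endo_one_linear.
Definition endo_add p q := Endo (endo_add_linear p q).
Definition endo_opp p := Endo (endo_opp_linear p).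
Definition endo_mul p q := Endo (endo_mul_linear p q).

Fact endo_addA : associative endo_add.
Proof. by move=> p q r; apply: endoP => u; apply: addrA. Qed.
Fact endo_addC : commutative endo_add.
Proof. by move=> p q; apply: endoP => u; apply: addrC. Qed.
Fact endo_add0 : left_id endo_zero endo_add.
Proof. by move=> p; apply: endoP => u; apply: add0r. Qed.
Fact endo_addN : left_inverse endo_zero endo_opp endo_add.
Proof. by move=> p; apply: endoP => u; apply: addNr. Qed.
HB.instance Definition _ :=
  GRing.isZmodule.Build endo endo_addA endo_addC endo_add0 endo_addN.

Fact endo_mulA : associative endo_mul.
Proof. by move=> p q r; apply: endoP. Qed.
Fact endo_mul1 : left_id endo_one endo_mul.
Proof. by move=> p; apply: endoP. Qed.
Fact endo_mulr1 : right_id endo_one endo_mul.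
Proof. by move=> p; apply: endoP. Qed.
Fact endo_mulDl : left_distributive endo_mul endo_add.
Proof. by move=> p q r; apply: endoP. Qed.
Fact endo_mulDr : right_distributive endo_mul endo_add.
Proof. by move=> p q r; apply: endoP => u; apply: endoD. Qed.
HB.instance Definition _ := GRing.Zmodule_isPzRing.Build endo
  endo_mulA endo_mul1 endo_mulr1 endo_mulDl endo_mulDr.

Definition endo_in (c : k) : endo := Endo (endo_scale_linear c).
Fact endo_in_zmod : zmod_morphism endo_in.
Proof. by move=> c d; apply: endoP => u; apply: scalerBl. Qed.
Fact endo_in_monoid : monoid_morphism endo_in.
Proof.
split; first by apply: endoP => u; apply: scale1r.
by move=> c d; apply: endoP => u /=; rewrite scalerA.
Qed.
HB.instance Definition _ := GRing.isZmodMorphism.Build k endo endo_in endo_in_zmod.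
HB.instance Definition _ := GRing.isMonoidMorphism.Build k endo endo_in endo_in_monoid.

Fact endo_central c (p : endo) : endo_in c * p = p * endo_in c.
Proof. by apply: endoP => u; apply/esym/endoZ. Qed.
Definition kend : kalg k := Kalg endo_central.

Lemma kendM (p q : kend) u : (p * q : kend) u = p (q u). Proof. by []. Qed.
Lemma kend_in c u : kin kend c u = c *: u. Proof. by []. Qed.
Lemma kendX (p : kend) i u : (p ^+ i : kend) u = iter i p u.
Proof. by elim: i => [//|i IH]; rewrite exprS kendM IH. Qed.
Lemma kend_sum (I : Type) (r : seq I) (P : pred I) (F : I -> kend) u :
  (\sum_(i <- r | P i) F i : kend) u = \sum_(i <- r | P i) F i u.
Proof. exact: (big_morph (fun p : kend => p u)). Qed.
Lemma kendP (p q : kend) : (forall u, p u = q u) -> p = q.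
Proof. exact: endoP. Qed.
Lemma kend_comm (p q : kend) u : GRing.comm p q -> p (q u) = q (p u).
Proof. by move=> pq; rewrite -!kendM pq. Qed.

End Endomorphisms.

Lemma weval_kend (k : fieldType) (M : lmodType k) (x a : kend M) w u :
  (weval a x w : kend M) u = word_act x a w u.
Proof.
elim: w => [|c w IH]; first by rewrite /weval big_nil.
by rewrite /weval big_cons -/(weval a x w) kendM IH; case: c.
Qed.

Section TailMorphism.
Variables (k : fieldType) (n : nat) (g : {poly k}) (L L' : lmodType k).
Variables (x a : L -> L) (x' a' : L' -> L') (h : L -> L').
Hypothesis h_lin : linear h.
Hypotheses (hx : forall u, h (x u) = x' (h u)) (ha : forall u, h (a u) = a' (h u)).

Lemma word_act_morph w u : h (word_act x a w u) = word_act x' a' w (h u).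
Proof. by elim: w => [//|[] w IH] /=; rewrite ?ha ?hx IH. Qed.

Lemma tail_act_morph j u : h (tail_act n g x a j u) = tail_act n g x' a' j (h u).
Proof.
have h0 : h 0 = 0.
  have := h_lin 1 0 0; rewrite !scale1r addr0 => e.
  by apply: (addIr (h 0)); rewrite add0r -e.
have hD v w : h (v + w) = h v + h w by rewrite -[v]scale1r h_lin !scale1r.
have hZ c v : h (c *: v) = c *: h v by rewrite -[c *: v]addr0 h_lin h0 addr0.
have hI i v : h (iter i a v) = iter i a' (h v).
  by elim: i => //= i IH; rewrite ha IH.
rewrite /tail_act -!scaleNr hD hZ hI (big_morph h hD h0); congr (_ + _).
apply: eq_bigr => i _; rewrite hZ (big_morph h hD h0); congr (_ *: _).
by apply: eq_bigr => w _; rewrite word_act_morph.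
Qed.
End TailMorphism.

Lemma word_act_linear (k : fieldType) (L : lmodType k) (x a : L -> L) w :
  linear x -> linear a -> linear (word_act x a w).
Proof.
move=> xl al; elim: w => [//|[] w IH] c u v /=; first by rewrite IH al.
by rewrite IH xl.
Qed.

Lemma tail_act_linear (k : fieldType) n (g : {poly k}) (L : lmodType k)
    (x a : L -> L) j : linear x -> linear a -> linear (tail_act n g x a j).
Proof.
move=> xl al c u v; rewrite /tail_act.
have iterl i : linear (iter i a).
  by elim: i => [//|i IH] d s t /=; rewrite IH al.
rewrite iterl scalerDr scalerBr opprD !scalerA mulrC -!scalerA addrACA; congr (_ + _).
rewrite scaler_sumr -big_split; apply: eq_bigr => i _ /=.
rewrite scalerA mulrC -scalerA -scalerDr; congr (_ *: _).
rewrite scaler_sumr -big_split.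
by apply: eq_bigr => w _; rewrite word_act_linear.
Qed.

(** * Operators on functions of states *)
Section StateFunctions.
Variables (k : fieldType) (n : nat) (g : {poly k}).
Hypothesis n_ge2 : (2 <= n)%N.
Local Notation o := (ordn n_ge2).

(** A function phi is read as a linear form on normal words: its value at
    (w, s) is its value on w a^s, and u acts by (u phi)(v) = phi(v u). *)
Definition state_fun (B : lmodType k) : lmodType k := seq (block n) -> 'I_n -> B.

Section Operators.
Variables (B : lmodType k) (xi gam : B -> B).

(** For s = n - 1 the word w a^s a is w a^n, and gam stands for the central
    element a^n. *)
Definition shift_op (phi : state_fun B) : state_fun B := fun W s =>
  if (s.+1 < n)%N then phi W (o s.+1) else gam (phi W (o 0)).

(** The operator of x.  It calls itself on tails of relations, where the rank
    decreases; the fuel replaces a well-founded recursion. *)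
Fixpoint letter_fuel (N : nat) (phi : state_fun B) : state_fun B :=
  if N is N'.+1 then fun W s =>
    match step W s with
    | StepCons W2 => phi W2 (o 0)
    | StepBase => xi (phi [::] (o 0))
    | StepLead j W' =>
        - (g`_n)^-1 *: tail_act n g (letter_fuel N') shift_op j phi W' (o 0)
    end
  else 0.

Lemma letter_fuelS N phi W (s : 'I_n) : letter_fuel N.+1 phi W s =
  match step W s with
  | StepCons W2 => phi W2 (o 0)
  | StepBase => xi (phi [::] (o 0))
  | StepLead j W' =>
      - (g`_n)^-1 *: tail_act n g (letter_fuel N) shift_op j phi W' (o 0)
  end.
Proof. by []. Qed.

(** By [Rel_tail], the rank of the state plus one is enough fuel. *)
Definition letter_op (phi : state_fun B) : state_fun B :=
  fun W s => letter_fuel (state_rank W * n + s).+1 phi W s.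
End Operators.

Section Naturality.
Variables (B B' : lmodType k) (xi gam : B -> B) (xi' gam' : B' -> B').
Variable theta : B -> B'.
Hypothesis theta_lin : linear theta.
Hypotheses (theta_xi : forall u, theta (xi u) = xi' (theta u))
  (theta_gam : forall u, theta (gam u) = gam' (theta u)).

Local Notation L := ((state_fun B * state_fun B')%type : lmodType k).
Let Rel (W : seq (block n)) (s : 'I_n) (p : L) : Prop := theta (p.1 W s) = p.2 W s.
Let a (p : L) : L := (shift_op gam p.1, shift_op gam' p.2).

Let theta0 : theta 0 = 0.
Proof.
have := theta_lin 1 0 0; rewrite !scale1r addr0 => e.
by apply: (addIr (theta 0)); rewrite add0r -e.
Qed.
Let thetaZ c u : theta (c *: u) = c *: theta u.
Proof. by rewrite -[c *: u]addr0 theta_lin theta0 addr0. Qed.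

Let Rel0 W s : Rel W s 0. Proof. exact: theta0. Qed.
Let RelL W s c u v : Rel W s u -> Rel W s v -> Rel W s (c *: u + v).
Proof.
by rewrite /Rel => Ru Rv; apply: etrans (theta_lin _ _ _) _; rewrite Ru Rv.
Qed.
Let RelA W (s : 'I_n) u : Rel W (o s.+1) u -> Rel W s (a u).
Proof.
rewrite /Rel /= /shift_op; case: ltnP => // le_n.
have -> : o s.+1 = o 0.
  have sn : s.+1 = n by apply/eqP; rewrite eqn_leq ltn_ord.
  by apply/val_inj; rewrite /= sn modnn mod0n.
by rewrite theta_gam => ->.
Qed.

(** Values at small rank depend neither on the fuel nor on the argument at higher
    rank, and they are compatible with a change theta of coefficients; d and d'
    are amounts of extra fuel. *)
Lemma letter_fuel_natural d d' N r phi phi' : (r <= N)%N ->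
  (forall W s, (state_rank W < r)%N -> theta (phi W s) = phi' W s) ->
  forall W (s : 'I_n), (state_rank W * n + s < r)%N ->
  theta (letter_fuel xi gam (N + d) phi W s) = letter_fuel xi' gam' (N + d') phi' W s.
Proof.
pose xN N (p : L) : L := (letter_fuel xi gam (N + d) p.1, letter_fuel xi' gam' (N + d') p.2).
have Rel_step N1 W (s : 'I_n) (u : L) :
    match step W s with
    | StepCons W2 => Rel W2 (o 0) u
    | StepBase => Rel [::] (o 0) u
    | StepLead j W' => Rel W' (o 0) (tail_act n g (xN N1) a j u)
    end -> Rel W s (xN N1.+1 u).
  move=> h; change (theta (letter_fuel xi gam (N1 + d).+1 u.1 W s)
    = letter_fuel xi' gam' (N1 + d').+1 u.2 W s).
  rewrite !letter_fuelS.
  case: (step W s) h => [W2 //||j W' h].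
    by rewrite theta_xi => ->.
  have e1 := @tail_act_morph k n g L (state_fun B) (xN N1) a
    (letter_fuel xi gam (N1 + d)) (shift_op gam) (fun p : L => p.1)
    (fun _ _ _ => erefl) (fun _ => erefl) (fun _ => erefl) j u.
  have e2 := @tail_act_morph k n g L (state_fun B') (xN N1) a
    (letter_fuel xi' gam' (N1 + d')) (shift_op gam') (fun p : L => p.2)
    (fun _ _ _ => erefl) (fun _ => erefl) (fun _ => erefl) j u.
  rewrite thetaZ; congr (_ *: _).
  apply: etrans (congr1 (fun F : state_fun B => theta (F W' (o 0))) (esym e1)) _.
  by apply: etrans (congr1 (fun F : state_fun B' => F W' (o 0)) e2).
move=> le_rN ag W s lt_W.
exact: (@rank_induction k n g n_ge2 L a Rel Rel0 RelL RelA xN Rel_step N r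
  (phi, phi')).
Qed.
End Naturality.

Section LetterOperator.
Variables (B : lmodType k) (xi gam : B -> B).
Local Notation X := (letter_op xi gam).
Local Notation A := (shift_op gam).

Let id_lin : linear (fun u : B => u). Proof. by []. Qed.

(** The recursion equation without fuel, from the independence of the fuel
    along the words of the relation. *)
Lemma letter_opE phi W (s : 'I_n) : X phi W s =
  match step W s with
  | StepCons W2 => phi W2 (o 0)
  | StepBase => xi (phi [::] (o 0))
  | StepLead j W' => - (g`_n)^-1 *: tail_act n g X A j phi W' (o 0)
  end.
Proof.
rewrite {1}/letter_op /=; case: (stepP n_ge2 W (ltn_ord s)) => // j W' jn rW' _.
congr (_ *: _); set r0 := (state_rank W * n + s)%N.
pose L : lmodType k := (state_fun B * state_fun B)%type.
pose Rel (W : seq (block n)) (s : 'I_n) (p : L) : Prop := p.1 W s = p.2 W s.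
pose a (p : L) : L := (A p.1, A p.2).
pose x (p : L) : L := (letter_fuel xi gam r0 p.1, X p.2).
have Rel0 V t : Rel V t 0 by [].
have RelL V t c u v : Rel V t u -> Rel V t v -> Rel V t (c *: u + v).
  by rewrite /Rel => Ru Rv; apply: (congr2 (fun p q => c *: p + q)).
have RelA V (t : 'I_n) u : Rel V (o t.+1) u -> Rel V t (a u).
  rewrite /Rel /= /shift_op; case: ltnP => // le_n.
  have -> : o t.+1 = o 0.
    have sn : t.+1 = n by apply/eqP; rewrite eqn_leq ltn_ord.
    by apply/val_inj; rewrite /= sn modnn mod0n.
  by move=> ->.
have := @Rel_tail k n g n_ge2 L a Rel Rel0 RelL RelA x r0 _ W' j (phi, phi) jn.
rewrite -rW' leqnn /Rel => Rel_end.
have e1 := @tail_act_morph k n g L (state_fun B) x a (letter_fuel xi gam r0) A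
  (fun p : L => p.1) (fun _ _ _ => erefl) (fun _ => erefl) (fun _ => erefl) j (phi, phi).
have e2 := @tail_act_morph k n g L (state_fun B) x a X A
  (fun p : L => p.2) (fun _ _ _ => erefl) (fun _ => erefl) (fun _ => erefl) j (phi, phi).
apply: etrans (congr1 (fun F : state_fun B => F W' (o 0)) (esym e1))
    (etrans _ (congr1 (fun F : state_fun B => F W' (o 0)) e2)).
apply: Rel_end => // r u le_r ag V t lt_V; rewrite /x /= /letter_op.
set r1 := (state_rank V * n + t)%N in lt_V *.
have := @letter_fuel_natural B B xi gam xi gam id id_lin (fun _ => erefl)
  (fun _ => erefl) (r0 - r1.+1) 0 r1.+1 r1.+1 u.1 u.2 (leqnn _) _ V t (leqnn _).
rewrite subnKC ?addn0; last exact: leq_trans lt_V le_r.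
by apply=> V1 t1 lt1; apply: ag; apply: leq_trans lt1 lt_V.
Qed.

Lemma letter_op_natural (B' : lmodType k) (xi' gam' : B' -> B') (theta : B -> B') :
  linear theta -> (forall u, theta (xi u) = xi' (theta u)) ->
  (forall u, theta (gam u) = gam' (theta u)) ->
  forall phi W (s : 'I_n), theta (X phi W s) =
     letter_op xi' gam' (fun W s => theta (phi W s)) W s.
Proof.
move=> th_lin th_xi th_gam phi W s; rewrite /letter_op.
have := @letter_fuel_natural _ _ _ _ _ _ _ th_lin th_xi th_gam 0 0
  (state_rank W * n + s).+1 (state_rank W * n + s).+1 phi _ (leqnn _) (fun _ _ _ => erefl)
  W s (leqnn _).
by rewrite addn0.
Qed.

Hypotheses (xi_lin : linear xi) (gam_lin : linear gam).

Lemma shift_op_linear : linear A.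
Proof.
move=> c u v; apply/funext => W; apply/funext => s.
transitivity (c *: A u W s + A v W s) => //; rewrite /shift_op.
by case: ifP => // _; apply: gam_lin.
Qed.

Lemma letter_op_linear : linear X.
Proof.
have fuel_lin N : linear (letter_fuel xi gam N).
  elim: N => [|N IH] c u v /=; first by rewrite scaler0 addr0.
  apply/funext => W; apply/funext => s.
  transitivity (c *: letter_fuel xi gam N.+1 u W s + letter_fuel xi gam N.+1 v W s) => //=.
  case: (step W s) => [W2 //||j W']; first exact: xi_lin.
  rewrite (tail_act_linear n g j IH shift_op_linear).
  transitivity (- (g`_n)^-1 *: (c *: tail_act n g (letter_fuel xi gam N) A j u W' (o 0)
    + tail_act n g (letter_fuel xi gam N) A j v W' (o 0))) => //.
  by rewrite scalerDr !scalerA mulrC.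
move=> c u v; apply/funext => W; apply/funext => s; rewrite /letter_op fuel_lin.
by [].
Qed.

End LetterOperator.
End StateFunctions.

(** * The representation of A(x,a,g) on functions of states *)
Section GcoefWords.
Variables (k : fieldType) (n : nat) (g : {poly k}) (M : lmodType k) (x a : kend M).

(** E_j is the leading word plus the remaining words, the subtracted term
    r_j a^n of [tail_act] being added back. *)
Lemma gcoef_words j u : (0 < j <= n)%N ->
  (gcoef n g x a j : kend M) u
  = g`_n *: word_act x a (lead_word n j) u
    + (tail_act n g x a j u + g`_j *: iter n a u).
Proof.
move=> jn; rewrite /gcoef kend_sum /tail_act subrK.
have sz : size (lead_word n j) == n by rewrite size_cat !size_nseq subnKC //; lia.
have E i : \sum_(w : i.-tuple bool | count_mem true w == j) word_act x a w u
    = (if i == n then word_act x a (lead_word n j) u else 0)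
      + \sum_(w : i.-tuple bool | (count_mem true w == j) && (tval w != lead_word n j))
          word_act x a w u.
  rewrite (bigID (fun w : i.-tuple bool => tval w == lead_word n j)) /=; congr (_ + _).
  case: eqP => [->|ne_in]; last first.
    rewrite big1 // => w /andP[_ /eqP ew]; case: ne_in.
    by rewrite -(size_tuple w) ew (eqP sz).
  rewrite (big_pred1 (Tuple sz)) // => w; rewrite /= -val_eqE /=.
  have [->|_] := eqVneq (tval w) (lead_word n j); last by rewrite andbF.
  by rewrite count_cat !count_nseq /= mul1n mul0n addn0 eqxx.
transitivity (\sum_(i < n.+1) g`_i *:
    \sum_(w : i.-tuple bool | count_mem true w == j) word_act x a w u).
  apply: eq_bigr => i _; rewrite kendM kend_in -qcoef_words kend_sum.
  by congr (_ *: _); apply: eq_bigr => w _; apply: weval_kend.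
under eq_bigr => i _ do rewrite E scalerDr.
rewrite big_split /= big_ord_recr /= eqxx big1 ?add0r // => i _.
by rewrite ltn_eqF // scaler0.
Qed.

End GcoefWords.

Section StateModule.
Variables (k : fieldType) (n : nat) (g : {poly k}).
Hypothesis n_ge2 : (2 <= n)%N.
Local Notation o := (ordn n_ge2).

Let o_val i : (i < n)%N -> o i = i :> nat.
Proof. by move=> lt_in; rewrite /= modn_small. Qed.

Lemma step_new W s h : @step n W s = StepCons (Sub (s, 1%N) h :: W).
Proof. by rewrite /step insubT. Qed.

Lemma step_extend W i t h h' :
  @step n (Sub (i, t) h :: W) 0 = StepCons (Sub (i, t.+1) h' :: W).
Proof. by rewrite /step insubF //= insubT. Qed.

Lemma step_base : @step n [::] 0 = StepBase n.
Proof. by rewrite /step insubF. Qed.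

Lemma step_lead_new W : @step n W n.-1 = StepLead n.-1 W.
Proof.
rewrite /step insubF /=; last by lia.
by rewrite (_ : (n.-1 == 0%N) = false) //; lia.
Qed.

Lemma step_lead_extend W j t h : (j + t)%N = n.-1 ->
  @step n (Sub (j, t) h :: W) 0 = StepLead j W.
Proof.
by move=> jt; rewrite /step insubF //= insubF //=; lia.
Qed.

Section Module.
Variables (B : lmodType k) (xi gam gami : kend B).
Hypotheses (gg : gam * gami = 1) (gg' : gami * gam = 1) (xg : GRing.comm xi gam).
Local Notation L := (state_fun n B).
Local Notation X := (letter_op g n_ge2 xi gam).
Local Notation A := (shift_op n_ge2 gam).

Let gamK u : gam (gami u) = u. Proof. by rewrite -kendM gg. Qed.
Let gamiK u : gami (gam u) = u. Proof. by rewrite -kendM gg'. Qed.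

Definition unshift_op (phi : L) : L := fun W s =>
  if (0 < s)%N then phi W (o s.-1) else gami (phi W (o n.-1)).

Lemma unshift_op_linear : linear unshift_op.
Proof.
move=> c u v; apply/funext => W; apply/funext => s.
transitivity (c *: unshift_op u W s + unshift_op v W s) => //; rewrite /unshift_op.
by case: ifP => // _; apply: (endo_linear gami).
Qed.

Definition state_x : kend L :=
  Endo (letter_op_linear g n_ge2 (endo_linear xi) (endo_linear gam)).
Definition state_a : kend L := Endo (shift_op_linear n_ge2 (endo_linear gam)).
Definition state_ai : kend L := Endo unshift_op_linear.

Lemma state_a_ai : state_a * state_ai = 1.
Proof.
apply: kendP => phi; apply/funext => W; apply/funext => s.
change (A (unshift_op phi) W s = phi W s); rewrite /shift_op /unshift_op.
case: ifP => [lt_sn|ge_sn].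
  by rewrite o_val //= ordn_id.
have sn : s = n.-1 :> nat by have := ltn_ord s; lia.
rewrite o_val; last by lia.
by rewrite /= gamK -sn ordn_id.
Qed.

Lemma state_ai_a : state_ai * state_a = 1.
Proof.
apply: kendP => phi; apply/funext => W; apply/funext => s.
change (unshift_op (A phi) W s = phi W s); rewrite /shift_op /unshift_op.
case: ifP => [s_gt0|/negbT s0].
  have := ltn_ord s => lt_sn; rewrite o_val; last by lia.
  by rewrite prednK // lt_sn ordn_id.
have {}s0 : s = 0%N :> nat by lia.
rewrite o_val; last by lia.
rewrite prednK; last by lia.
by rewrite ltnn gamiK -s0 ordn_id.
Qed.

Lemma iter_shift p phi W (s : 'I_n) :
  iter p A phi W s = iter ((s + p) %/ n) gam (phi W (o (s + p))).
Proof.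
elim: p s => [|p IH] s.
  by rewrite addn0 divn_small // ordn_id.
rewrite iterS {1}/shift_op; case: ifP => [lt_sn|ge_sn].
  by rewrite IH ordnD o_val // addSnnS.
have sn : (s + p.+1 = n + p)%N by have := ltn_ord s; lia.
rewrite IH sn o_val ?add0n; last by lia.
rewrite divnDl // divnn (ltnW n_ge2) add1n iterS; congr (gam (iter _ _ (phi W _))).
by apply/val_inj; rewrite /= modnDl.
Qed.

Lemma iter_shift0 p phi W : (p < n)%N -> iter p A phi W (o 0) = phi W (o p).
Proof. by move=> lt_pn; rewrite iter_shift o_val ?add0n ?divn_small //; lia. Qed.

Lemma state_a_expn phi : (state_a ^+ n : kend L) phi = fun W s => gam (phi W s).
Proof.
rewrite kendX; apply/funext => W; apply/funext => s.
rewrite [LHS]iter_shift divnDr // divnn (ltnW n_ge2) divn_small // add0n /=.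
congr (gam (phi W _)); apply/val_inj.
by rewrite /= modnDr modn_small.
Qed.

Local Notation act := (word_act X A).

Lemma act_block t i W h phi :
  act (nseq i true ++ nseq t.+1 false) phi W (o 0)
  = phi (Sub (i, t.+1) h :: W) (o 0).
Proof.
elim: t h phi => [|t IH] h phi.
  have /and3P[/= i0 _ it] := h.
  rewrite word_act_cat word_act_true iter_shift0; last by lia.
  rewrite /= letter_opE o_val; last by lia.
  by rewrite (@step_new W i h).
have h' : [&& 0 < (i, t.+1).1, 0 < (i, t.+1).2 & (i, t.+1).1 + (i, t.+1).2 < n]%N.
  by have /and3P[/= i0 _ it] := h; rewrite /= i0 /=; lia.
rewrite nseqSr catA word_act_cat (IH h') /= letter_opE o_val; last by lia.
by rewrite (@step_extend W i t.+1 h' h).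
Qed.

Lemma act_state W phi : act (state_word W) phi [::] (o 0) = phi W (o 0).
Proof.
elim: W phi => [//|[[i t] h] W IH] phi.
rewrite [state_word _]/(state_word W ++ nseq i true ++ nseq t false).
rewrite word_act_cat IH; have /and3P[_ /= t0 _] := h.
by case: t t0 h => // t _ h; rewrite (@act_block t i W h).
Qed.

Lemma act_lead j W phi : (0 < j < n)%N ->
  act (lead_word n j) phi W (o 0) = - (g`_n)^-1 *: tail_act n g X A j phi W (o 0).
Proof.
move=> jn; rewrite /lead_word; case e: (n - j)%N => [|[|t]]; first by lia.
  have -> : j = n.-1 by lia.
  rewrite word_act_cat word_act_true iter_shift0; last by lia.
  rewrite /= letter_opE o_val; last by lia.
  by rewrite step_lead_new.
have h : [&& 0 < (j, t.+1).1, 0 < (j, t.+1).2 & (j, t.+1).1 + (j, t.+1).2 < n]%N.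
  by rewrite /=; lia.
rewrite nseqSr catA word_act_cat (@act_block t j W h) /= letter_opE o_val; last by lia.
by rewrite (@step_lead_extend W j t.+1 h) //; lia.
Qed.

Hypothesis deg_g : size g = n.+1.

Let lead_neq0 : g`_n != 0. Proof. exact: lead_coef_neq0. Qed.

(** At the state (w, 0) the j-th relation is the definition of x on the leading
    word a^j x^(n-j). *)
Lemma gcoef_at0 j phi W : (0 < j < n)%N ->
  (gcoef n g state_x state_a j : kend L) phi W (o 0)
  = g`_j *: (state_a ^+ n : kend L) phi W (o 0).
Proof.
move=> jn; rewrite gcoef_words; last by lia.
transitivity (g`_n *: act (lead_word n j) phi W (o 0)
  + (tail_act n g X A j phi W (o 0) + g`_j *: iter n A phi W (o 0))) => //.
rewrite act_lead // scalerA mulrN mulfV // scaleN1r addKr.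
by rewrite kendX.
Qed.

(** Since a^n acts by gam at every state, this is naturality in the coefficients. *)
Lemma state_x_an : GRing.comm state_x (state_a ^+ n).
Proof.
apply: kendP => phi; rewrite !kendM !state_a_expn; apply/funext => W; apply/funext => s.
apply/esym/(@letter_op_natural k n g n_ge2 B xi gam B xi gam gam).
- exact: endo_linear.
- by move=> u; rewrite (kend_comm _ xg).
- by [].
Qed.

(** Descending induction on j: once E_(j+1) = r_(j+1) a^n commutes with x, the
    identity x E_(j+1) + a E_j = E_(j+1) x + E_j a makes E_j commute with a, and
    a carries the j-th relation from the states (w, 0) to all (w, s). *)
Lemma state_additive_pair : additive_pair n g state_x state_a.
Proof.
have AEn : GRing.comm state_a (state_a ^+ n) by apply: commrX.
have H d j : (0 < j)%N -> (n <= d + j)%N ->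
    gcoef n g state_x state_a j = kin (kend L) g`_j * state_a ^+ n.
  elim: d j => [|d IH] j j_gt0 le_n; first exact: gcoef_ge.
  have [le_nj|lt_jn] := leqP n j; first exact: gcoef_ge.
  have Ej1 : gcoef n g state_x state_a j.+1 = kin (kend L) g`_j.+1 * state_a ^+ n.
    by apply: IH => //; rewrite addnS.
  have cX : GRing.comm state_x (gcoef n g state_x state_a j.+1).
    by rewrite Ej1; apply: commrM state_x_an; rewrite /GRing.comm kcentral.
  have cA : GRing.comm state_a (gcoef n g state_x state_a j).
    by have := gcoef_commute n g state_x state_a j; rewrite cX; move/addrI.
  apply: kendP => phi; apply/funext => W; apply/funext => s.
  rewrite kendM kend_in.
  change (gcoef n g state_x state_a j phi W s = g`_j *: (state_a ^+ n : kend L) phi W s).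
  have at0 (p : kend L) : GRing.comm state_a p -> p phi W s = p ((state_a ^+ s : kend L) phi) W (o 0).
    move=> cp; have cps : GRing.comm p (state_a ^+ s) by apply/commrX/commr_sym.
    by rewrite (kend_comm _ cps) kendX -[RHS]/(iter s A (p phi) W (o 0)) iter_shift0 ?ordn_id.
  by rewrite (at0 _ cA) (at0 _ AEn) gcoef_at0 ?j_gt0.
by move=> l l_gt0; apply: (H n l) => //; rewrite leq_addr.
Qed.

Definition state_act : kmor (Aone n g) (kend L) :=
  Aone_lift deg_g state_a_ai state_ai_a state_additive_pair.

Lemma state_actE : [/\ state_act (Aone_x n g) = state_x, state_act (Aone_a n g) = state_a
  & state_act (Aone_ai n g) = state_ai].
Proof. exact: Aone_liftE. Qed.

Lemma state_act_weval w p phi :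
  state_act (weval (Aone_a n g) (Aone_x n g) w * p) phi = act w (state_act p phi).
Proof.
have [ex ea _] := state_actE.
have rmorph_weval : state_act (weval (Aone_a n g) (Aone_x n g) w) = weval state_a state_x w.
  by rewrite /weval rmorph_prod; apply: eq_bigr => c _; case: c.
by rewrite rmorphM rmorph_weval kendM weval_kend.
Qed.

(** Duality between normal words and states.  It makes normal words linearly
    independent over the coefficients. *)
Lemma state_act_state W (s : nat) phi : (s < n)%N ->
  state_act (weval (Aone_a n g) (Aone_x n g) (state_word W) * Aone_a n g ^+ s) phi
    [::] (o 0) = phi W (o s).
Proof.
move=> lt_sn; have [_ ea _] := state_actE.
rewrite state_act_weval act_state rmorphXn ea kendX.
by rewrite -[LHS]/(iter s A phi W (o 0)) iter_shift0.
Qed.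

Lemma state_x_at0 phi : (state_x phi) [::] (o 0) = xi (phi [::] (o 0)).
Proof.
change (X phi [::] (o 0) = xi (phi [::] (o 0))).
by rewrite letter_opE o_val ?step_base // ltnW.
Qed.

Lemma state_x_expr_at0 i phi :
  (state_x ^+ i : kend L) phi [::] (o 0) = (xi ^+ i : kend B) (phi [::] (o 0)).
Proof.
elim: i phi => [//|i IH] phi.
by rewrite exprSr kendM IH state_x_at0 exprSr.
Qed.

Lemma keval_kend (V : lmodType k) (h : {poly k}) (p : kend V) u :
  (keval h p : kend V) u = \sum_(i < size h) h`_i *: (p ^+ i : kend V) u.
Proof.
by rewrite /keval kend_sum; apply: eq_bigr => i _; rewrite kendM kend_in.
Qed.

(** At the empty state x acts by xi, and g(x) is central, so that it acts by
    g(xi) at every state that normal words reach. *)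
Lemma keval_state_x phi W s : (keval g state_x : kend L) phi W s = (keval g xi : kend B) (phi W s).
Proof.
have ap := state_additive_pair.
have cA : GRing.comm (keval g state_x) state_a by apply/esym; apply: (additive_pair_g deg_g).
have cX : GRing.comm (keval g state_x) state_x.
  apply: commr_sym; apply: commr_sum => i _; apply: commrM.
    by rewrite /GRing.comm kcentral.
  exact: commrX.
have at0 psi : (keval g state_x : kend L) psi [::] (o 0) = (keval g xi : kend B) (psi [::] (o 0)).
  rewrite !keval_kend.
  transitivity (\sum_(i < size g) g`_i *: (state_x ^+ i : kend L) psi [::] (o 0)).
    by elim/big_rec2: _ => // i y1 y2 _ <-.
  by apply: eq_bigr => i _; rewrite state_x_expr_at0.
have cact w psi : (keval g state_x : kend L) (act w psi) = act w ((keval g state_x : kend L) psi).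
  elim: w => [//|[] w IH] /=; rewrite -IH.
    exact: (kend_comm _ cA).
  exact: (kend_comm _ cX).
have reach psi : psi W s = act (state_word W ++ nseq s true) psi [::] (o 0).
  by rewrite word_act_cat act_state word_act_true iter_shift0 ?ordn_id.
by rewrite reach -cact at0 -reach.
Qed.

End Module.
End StateModule.

(** * Normal words span *)
Section LeftRegular.
Variables (k : fieldType) (B : kalg k).

Lemma kvect_scaleE (c : k) (u : kvect B) : c *: u = kin B c * u :> B.
Proof. by []. Qed.

Fact lmul_linear (b : B) : linear (fun u : kvect B => b * (u : B) : kvect B).
Proof.
move=> c u v; change (b * (kin B c * u + v) = kin B c * (b * u) + b * v :> B).
by rewrite mulrDr !mulrA kcentral.
Qed.
Definition lmul_fun (b : B) : kend (kvect B) := Endo (lmul_linear b).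
Fact lmul_zmod : zmod_morphism lmul_fun.
Proof. by move=> b c; apply: kendP => u; apply: (@mulrBl B). Qed.
Fact lmul_monoid : monoid_morphism lmul_fun.
Proof.
split; first by apply: kendP => u; apply: (@mul1r B).
by move=> b c; apply: kendP => u; apply/esym/(@mulrA B).
Qed.
HB.instance Definition _ := GRing.isZmodMorphism.Build B (kend (kvect B)) lmul_fun lmul_zmod.
HB.instance Definition _ := GRing.isMonoidMorphism.Build B (kend (kvect B)) lmul_fun lmul_monoid.

Definition lmul : kmor B (kend (kvect B)).
Proof.
by apply: (@Kmor k B (kend (kvect B)) lmul_fun) => c; apply: kendP.
Defined.

Lemma lmulE b u : lmul b u = b * u. Proof. by []. Qed.

Lemma word_act_lmul x a w u : word_act (lmul x) (lmul a) w u = weval a x w * u.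
Proof.
elim: w => [|c w IH]; first by rewrite /weval big_nil mul1r.
by rewrite /weval big_cons -/(weval a x w) -mulrA -IH; case: c.
Qed.
End LeftRegular.

Lemma weval_cat (R : pzRingType) (u v : R) w w' :
  weval u v (w ++ w') = weval u v w * weval u v w'.
Proof. by rewrite /weval big_cat. Qed.

Lemma weval_true (R : pzRingType) (u v : R) i : weval u v (nseq i true) = u ^+ i.
Proof.
elim: i => [|i IH]; first by rewrite /weval big_nil.
by rewrite exprS -IH /weval /= big_cons.
Qed.

Section Spanning.
Variables (k : fieldType) (n : nat) (g : {poly k}).
Hypotheses (n_ge2 : (2 <= n)%N) (deg_g : size g = n.+1).
Variables (B : kalg k) (x a ai : B) (P : B -> Prop).
Hypotheses (aai : a * ai = 1) (aia : ai * a = 1) (ap : additive_pair n g x a).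
Hypothesis genB : generated (fun u => [\/ u = x, u = a | u = ai]).
Hypothesis P0 : P 0.
Hypothesis PL : forall c u v, P u -> P v -> P (kin B c * u + v).
Hypothesis Px : forall u, P u -> P (x * u).
Hypothesis Pc : forall u, P u -> P (a ^+ n * u).
Hypothesis Pci : forall u, P u -> P (ai ^+ n * u).
Hypothesis Pw : forall (W : seq (block n)) s, (s < n)%N ->
  P (weval a x (state_word W) * a ^+ s).
Local Notation o := (ordn n_ge2).
Local Notation V := (kvect B).
Local Notation ev := (weval a x).

Let Rel (W : seq (block n)) (s : 'I_n) (u : V) : Prop :=
  P (ev (state_word W) * a ^+ s * u).

Let Rel0 W s : Rel W s 0. Proof. by rewrite /Rel mulr0. Qed.
Let RelL W s c u v : Rel W s u -> Rel W s v -> Rel W s (c *: u + v).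
Proof.
rewrite /Rel; move: (ev _ * _) => q Ru Rv.
change (P (q * (kin B c * u + v))).
have -> : q * (kin B c * u + v) = kin B c * (q * u) + q * v.
  by rewrite mulrDr !mulrA kcentral.
exact: PL.
Qed.

Let c_central w : GRing.comm (ev w) (a ^+ n).
Proof.
rewrite /weval; elim/big_ind: _ => [|u v|c _]; first exact/commr_sym/commr1.
  by move=> cu cv; apply/commr_sym/commrM; apply: commr_sym.
by case: c; [apply: commrX|apply: (additive_pair_an deg_g)].
Qed.

Let o_val i : (i < n)%N -> o i = i :> nat.
Proof. by move=> lt_in; rewrite /= modn_small. Qed.

Let RelA W (s : 'I_n) u : Rel W (o s.+1) u -> Rel W s (lmul B a u).
Proof.
rewrite /Rel lmulE; have [lt_sn|ge_sn] := ltnP s.+1 n.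
  by rewrite o_val // exprSr !mulrA.
have sn : s.+1 = n by apply/eqP; rewrite eqn_leq ltn_ord.
have -> : o s.+1 = 0%N :> nat by rewrite /= sn modnn.
rewrite expr0 mulr1 mulrA -[ev _ * a ^+ s * a]mulrA -exprSr sn c_central.
by rewrite -mulrA; apply: Pc.
Qed.

Let RelAi W (s : 'I_n) u : Rel W (o (s + n.-1)) u -> Rel W s (lmul B ai u).
Proof.
have caai : GRing.comm a ai by rewrite /GRing.comm aai.
rewrite /Rel lmulE; have [s0|s_gt0] := posnP s.
  rewrite s0 add0n o_val ?expr0 ?mulr1; last by lia.
  have -> : ev (state_word W) * (ai * u)
      = ai ^+ n * (ev (state_word W) * a ^+ n.-1 * u).
    have cai : GRing.comm (ev (state_word W)) (ai ^+ n).
      by apply: (comm_inverse (u := a ^+ n)); rewrite ?expr_invl //.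
    rewrite !mulrA -cai -!mulrA; congr (_ * _); rewrite !mulrA; congr (_ * u).
    have -> : n = n.-1.+1 by lia.
    by rewrite exprS /= -mulrA expr_invl ?mulr1 //; apply: commr_sym.
  exact: Pci.
have -> : o (s + n.-1) = s.-1 :> nat.
  rewrite /= (_ : s + n.-1 = s.-1 + n)%N; last by lia.
  by rewrite modnDr modn_small //; have := ltn_ord s; lia.
by rewrite -[in _ * a ^+ s](prednK s_gt0) exprSr !mulrA -[_ * a * ai]mulrA aai mulr1.
Qed.

Let lead_neq0 : g`_n != 0. Proof. exact: lead_coef_neq0. Qed.

Let lead_tail j (u : V) : (0 < j < n)%N ->
  word_act (lmul B x) (lmul B a) (lead_word n j) u
  = - (g`_n)^-1 *: tail_act n g (lmul B x) (lmul B a) j u.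
Proof.
move=> jn; have := @gcoef_words k n g V (lmul B x) (lmul B a) j u.
rewrite -gcoef_mor ap; last by lia.
rewrite rmorphM rmorphXn kmor_in kendM kend_in kendX.
have -> : (0 < j <= n)%N by lia.
move/(_ isT); set t := tail_act _ _ _ _ _ _; set l := word_act _ _ _ _.
rewrite addrA -[X in X = _]add0r => /addIr/esym/eqP; rewrite addr_eq0 => /eqP e.
by rewrite scaleNr -scalerN -e scalerA mulVf // scale1r.
Qed.

Let Rel_step N W (s : 'I_n) u :
  match step W s with
  | StepCons W2 => Rel W2 (o 0) u
  | StepBase => Rel [::] (o 0) u
  | StepLead j W' => Rel W' (o 0) (tail_act n g (lmul B x) (lmul B a) j u)
  end -> Rel W s ((fun _ => lmul B x : V -> V) N.+1 u).
Proof.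
have o0 : o 0 = 0%N :> nat by apply: o_val; lia.
have wx W1 t v : ev (state_word W1) * a ^+ t * (x * v)
    = ev (state_word W1 ++ nseq t true ++ [:: false]) * v.
  by rewrite !weval_cat weval_true !mulrA {3}/weval big_seq1.
rewrite /Rel lmulE; case: (stepP n_ge2 W (ltn_ord s)) => [W2 _ eW|-> s0|j W' jn _ eW].
- by rewrite wx -eW o0 expr0 mulr1.
- by rewrite s0 o0 !expr0 !mulr1 /weval big_nil !mul1r; apply: Px.
rewrite wx eW o0 expr0 mulr1 weval_cat -mulrA -[ev (lead_word n j) * u]word_act_lmul lead_tail //.
set t := tail_act _ _ _ _ _ _ => Pt; rewrite kvect_scaleE mulrA -kcentral -mulrA.
by rewrite -[_ * _]addr0; apply: PL.
Qed.

(** The elements u such that P (w a^s u) for all states form a subspace that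
    contains 1, and it is stable under left multiplication by the generators:
    for x this is the rank induction for the property P (w a^s u) of u. *)
Lemma Aone_spanning u : P u.
Proof.
pose T (v : B) := forall W s, Rel W s v.
have T1 : T 1 by move=> W s; rewrite /Rel mulr1; apply: Pw.
have Tx v : T v -> T (x * v).
  move=> Tv W s; pose r := (state_rank W * n + s).+1.
  exact: (@rank_induction k n g n_ge2 V (lmul B a) Rel Rel0 RelL RelA
    (fun _ => lmul B x : V -> V) Rel_step r r v (leqnn _) (fun W' s' _ => Tv W' s')).
have Ta v : T v -> T (a * v) by move=> Tv W s; apply: RelA.
have Tai v : T v -> T (ai * v) by move=> Tv W s; apply: RelAi.
have Tu : forall v, T v -> T (u * v).
  move: u; apply: genB => [|w [] -> //].
  split=> [c|v w Tv Tw z Tz W s|v w Tv Tw z Tz]; last by rewrite -mulrA; apply/Tv/Tw.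
    move=> v Tv W s; have := RelL c (Tv W s) (Rel0 W s).
    by rewrite addr0.
  have := RelL (-1) (Tw z Tz W s) (Tv z Tz W s).
  by rewrite scaleN1r addrC mulrBl.
have := Tu 1 T1 [::] (o 0).
by rewrite /Rel o_val /weval ?big_nil ?expr0 ?mulr1 ?mul1r //; lia.
Qed.

End Spanning.

(** * The representation of A(g,f) *)
Section Pointwise.
Variables (k : fieldType) (T : Type) (B : lmodType k).
Local Notation TB := (T -> B : lmodType k).

Fact pointwise_linear (p : kend B) : linear (fun phi : TB => (fun t => p (phi t)) : TB).
Proof. by move=> c u v; apply/funext => t; apply: (endo_linear p). Qed.
Definition pointwise_fun (p : kend B) : kend TB := Endo (pointwise_linear p).
Fact pointwise_zmod : zmod_morphism pointwise_fun.
Proof. by move=> p q; apply: kendP. Qed.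
Fact pointwise_monoid : monoid_morphism pointwise_fun.
Proof. by split=> [|p q]; apply: kendP. Qed.
HB.instance Definition _ :=
  GRing.isZmodMorphism.Build (kend B) (kend TB) pointwise_fun pointwise_zmod.
HB.instance Definition _ :=
  GRing.isMonoidMorphism.Build (kend B) (kend TB) pointwise_fun pointwise_monoid.

Definition pointwise : kmor (kend B) (kend TB).
Proof. by apply: (@Kmor k (kend B) (kend TB) pointwise_fun) => c; apply: kendP. Defined.

End Pointwise.

Definition pointwise2 (k : fieldType) m (B : lmodType k) :
    kmor (kend B) (kend (state_fun m B)) :=
  kcomp (pointwise _ _) (pointwise 'I_m B).

Lemma pointwise2E (k : fieldType) m (B : lmodType k) (p : kend B)
  (phi : state_fun m B) W s : pointwise2 m B p phi W s = p (phi W s).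
Proof. by []. Qed.

Section PointwiseNaturality.
Variables (k : fieldType) (m : nat) (f : {poly k}) (B : lmodType k).
Variables (m_ge2 : (2 <= m)%N) (p xi gam : kend B).

Lemma pointwise2_state_x : GRing.comm p xi -> GRing.comm p gam ->
  GRing.comm (pointwise2 m B p) (state_x f m_ge2 xi gam).
Proof.
move=> pxi pgam; apply: kendP => phi; apply/funext => V; apply/funext => s.
apply: (@letter_op_natural k m f m_ge2 B xi gam B xi gam p).
- exact: endo_linear.
- by move=> u; apply: kend_comm.
- by move=> u; apply: kend_comm.
Qed.

Lemma pointwise2_state_a : GRing.comm p gam ->
  GRing.comm (pointwise2 m B p) (state_a m_ge2 gam).
Proof.
move=> pgam; apply: kendP => phi; apply/funext => V; apply/funext => s.
change (p (shift_op m_ge2 gam phi V s)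
  = shift_op m_ge2 gam (pointwise2 m B p phi) V s).
by rewrite /shift_op; case: ifP => // _; apply: kend_comm.
Qed.
End PointwiseNaturality.

Lemma Aone_comm_image (k : fieldType) n (g : {poly k}) (C : kalg k)
    (h : kmor (Aone n g) C) (c : C) :
  GRing.comm c (h (Aone_x n g)) -> GRing.comm c (h (Aone_a n g)) ->
  forall p, GRing.comm c (h p).
Proof.
move=> cx ca; apply: generated_Aone; first exact: subalgebra_comm.
have uv : h (Aone_a n g) * h (Aone_ai n g) = 1.
  by rewrite -rmorphM Aone_aai rmorph1.
have vu : h (Aone_ai n g) * h (Aone_a n g) = 1.
  by rewrite -rmorphM Aone_aia rmorph1.
by move=> u [] ->; [exact: cx|exact: ca|exact: comm_inverse uv vu ca].
Qed.

Lemma kmor_inv (k : fieldType) (A C : kalg k) (h : kmor A C) u v :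
  u * v = 1 -> h u * h v = 1.
Proof. by move=> uv; rewrite -rmorphM uv rmorph1. Qed.

Section TwoVariableAction.
Variables (k : fieldType) (n : nat) (g : {poly k}) (m : nat) (f : {poly k}).
Hypotheses (deg_g : size g = n.+1) (g0 : g`_0 = 0) (n_ge2 : (2 <= n)%N).
Hypotheses (deg_f : size f = m.+1) (f0 : f`_0 = 0) (m_ge2 : (2 <= m)%N).
Variables (B : lmodType k) (act : kmor (Aone n g) (kend B)) (xi : kend B).
Hypothesis xi_act : forall p, GRing.comm xi (act p).
Hypothesis f_xi : keval f xi = act (keval g (Aone_x n g)).

Local Notation A := (Atwo n g m f).
Local Notation il := (Atwo_l n g m f).
Local Notation ir := (Atwo_r n g m f).
Local Notation L := (state_fun m B).
Local Notation pt := (pointwise2 m B).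

Let gam : kend B := act (Aone_a n g ^+ n).
Let gami : kend B := act (Aone_ai n g ^+ n).

Let gg : gam * gami = 1.
Proof. exact: (kmor_inv act (expr_inv n (Aone_aai n g) (Aone_aia n g))). Qed.
Let gg' : gami * gam = 1.
Proof. exact: (kmor_inv act (expr_inv n (Aone_aia n g) (Aone_aai n g))). Qed.

Let Y : kend L := state_x f m_ge2 xi gam.
Let W : kend L := state_a m_ge2 gam.
Let Z : kend L := state_ai m_ge2 gami.

Let gam_comm p : GRing.comm (act p) gam.
Proof.
apply/commr_sym/Aone_comm_image; rewrite /gam.
  apply: (kmor_comm act); apply/esym/(additive_pair_an deg_g n_ge2).
  exact: Aone_pair.
by apply: (kmor_comm act); apply/esym/commrX.
Qed.

Lemma two_variable_relations : @Atwo_relations k n g m f (kend L)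
  (pt (act (Aone_x n g))) (pt (act (Aone_a n g))) (pt (act (Aone_ai n g))) Y W Z.
Proof.
have xgam : GRing.comm xi gam by apply: xi_act.
apply: AtwoRelations.
- exact: (kmor_inv pt (kmor_inv act (Aone_aai n g))).
- exact: (kmor_inv pt (kmor_inv act (Aone_aia n g))).
- exact/additive_pair_mor/additive_pair_mor/Aone_pair.
- exact: (state_a_ai m_ge2 gg).
- exact: (state_ai_a m_ge2 gg').
- exact: (state_additive_pair m_ge2 xgam deg_f).
- by apply: pointwise2_state_x; [apply/commr_sym/xi_act|apply: gam_comm].
- by apply: pointwise2_state_a; apply: gam_comm.
- by apply: pointwise2_state_x; [apply/commr_sym/xi_act|apply: gam_comm].
- by apply: pointwise2_state_a; apply: gam_comm.
- apply: etrans (esym (keval_mor pt g (act (Aone_x n g)))) _.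
  apply: etrans (congr1 pt (etrans (esym (keval_mor act g _)) (esym f_xi))) _.
  apply: kendP => phi; apply/funext => V; apply/funext => s.
  by rewrite pointwise2E (keval_state_x m_ge2 xgam deg_f).
- apply: etrans (esym (rmorphXn pt n (act (Aone_a n g)))) _.
  apply: etrans (congr1 pt (esym (rmorphXn act n _))) _.
  by apply: kendP => phi; apply: etrans (esym (state_a_expn m_ge2 gam phi)).
Qed.

(** A(x,a,g) acts on the coefficients, where gam is the action of a^n, which is
    b^m, and f(y) = f(xi) = g(x). *)
Definition Atwo_act : kmor A (kend L) :=
  sval (Atwo_mor deg_g deg_f two_variable_relations).

Lemma Atwo_act_l p phi V s : Atwo_act (il p) phi V s = act p (phi V s).
Proof.
have [[ex ea eai] _] := svalP (Atwo_mor deg_g deg_f two_variable_relations).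
rewrite -/Atwo_act in ex ea eai.
have E : kcomp Atwo_act il =1 kcomp pt act.
  apply: (kmor_ext (@generated_Aone k n g)) => u [] ->.
  - exact: ex.
  - exact: ea.
  - exact: eai.
by have := E p; rewrite !kcompE => ->.
Qed.

Lemma Atwo_act_r q phi : Atwo_act (ir q) phi
  = state_act m_ge2 gg gg' (xi_act (Aone_a n g ^+ n)) deg_f q phi.
Proof.
have [_ [ey eb ebi]] := svalP (Atwo_mor deg_g deg_f two_variable_relations).
rewrite -/Atwo_act in ey eb ebi.
pose st := state_act m_ge2 gg gg' (xi_act (Aone_a n g ^+ n)) deg_f.
have [sy sb sbi] := state_actE m_ge2 gg gg' (xi_act (Aone_a n g ^+ n)) deg_f.
have E : kcomp Atwo_act ir =1 st.
  apply: (kmor_ext (@generated_Aone k m f)) => u [] ->.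
  - exact: etrans ey (esym sy).
  - exact: etrans eb (esym sb).
  - exact: etrans ebi (esym sbi).
by have := E q; rewrite kcompE => ->.
Qed.

Lemma Atwo_act_y u phi :
  Atwo_act (Atwo_y n g m f * u) phi [::] (ordn m_ge2 0)
  = xi (Atwo_act u phi [::] (ordn m_ge2 0)).
Proof.
have [_ [ey _ _]] := svalP (Atwo_mor deg_g deg_f two_variable_relations).
rewrite -/Atwo_act in ey.
by rewrite rmorphM ey kendM state_x_at0.
Qed.

Lemma Atwo_act_word V (j : nat) phi : (j < m)%N ->
  Atwo_act (weval (Atwo_b n g m f) (Atwo_y n g m f) (state_word V)
            * Atwo_b n g m f ^+ j) phi [::] (ordn m_ge2 0)
  = phi V (ordn m_ge2 j).
Proof.
move=> lt_jm.
have -> : weval (Atwo_b n g m f) (Atwo_y n g m f) (state_word V) * Atwo_b n g m f ^+ j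
  = ir (weval (Aone_a m f) (Aone_x m f) (state_word V) * Aone_a m f ^+ j).
  rewrite rmorphM rmorphXn; congr (_ * _).
  by rewrite /weval rmorph_prod; apply: eq_bigr => c _; case: c.
by rewrite Atwo_act_r state_act_state.
Qed.

End TwoVariableAction.

(** * Families with dual coordinate maps *)
Section ExactCoordinates.
Variables (X Y Z TX TY TZ : zmodType) (f : X -> Y) (g : Y -> Z).
Variables (F : {additive TX -> TY}) (G : TY -> TZ) (I : eqType) (i0 : I).
Variables (tauX : I -> TX -> X) (tauY : I -> TY -> Y) (tauZ : I -> TZ -> Z).
Variables (iotaX : I -> X -> TX) (iotaY : I -> Y -> TY) (iotaZ : I -> Z -> TZ).
Hypotheses (tauF : forall i t, tauY i (F t) = f (tauX i t))
  (tauG : forall i t, tauZ i (G t) = g (tauY i t))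
  (iotaF : forall i x, F (iotaX i x) = iotaY i (f x))
  (iotaG : forall i y, G (iotaY i y) = iotaZ i (g y)).
Hypotheses (tauZ0 : forall i, tauZ i 0 = 0) (iotaZ0 : forall i, iotaZ i 0 = 0).
Hypotheses (tauK : forall y, tauY i0 (iotaY i0 y) = y)
  (tauKZ : forall z, tauZ i0 (iotaZ i0 z) = z).
Hypotheses (expY : forall t, exists s : seq I, t = \sum_(i <- s) iotaY i (tauY i t))
  (expZ : forall t, exists s : seq I, t = \sum_(i <- s) iotaZ i (tauZ i t)).

(** The complex F, G is a direct sum of copies of f, g: tau_i is the i-th
    projection, iota_i the i-th inclusion, and i0 an index that occurs. *)
Lemma exact_coordinates : exact_at f g <-> exact_at F G.
Proof.
split=> [ex t|ex y]; split.
- move=> Gt0; have fx i : exists x, f x = tauY i t.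
    by apply/ex; rewrite -tauG Gt0 tauZ0.
  have [x_ fx_] := choice fx; have [s ->] := expY t.
  exists (\sum_(i <- s) iotaX i (x_ i)); rewrite raddf_sum.
  by apply: eq_bigr => i _; rewrite iotaF fx_.
- move=> [t' <-]; have [s ->] := expZ (G (F t')).
  rewrite big1 // => i _; rewrite tauG tauF.
  by have -> : g (f (tauX i t')) = 0 by apply/ex; exists (tauX i t').
- move=> gy0; have /ex[t' Ft'] : G (iotaY i0 y) = 0 by rewrite iotaG gy0 iotaZ0.
  by exists (tauX i0 t'); rewrite -tauF Ft' tauK.
- move=> [x <-]; have G0 : G (F (iotaX i0 x)) = 0 by apply/ex; exists (iotaX i0 x).
  by rewrite -[LHS]tauKZ -iotaG -iotaF G0 tauZ0.
Qed.
End ExactCoordinates.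

Section Coordinates.
Variables (R S : pzRingType) (h : {rmorphism R -> S}) (I : eqType).
Variables (D : I -> Prop) (b : I -> S) (co : I -> S -> R).

(** The maps co i are left R-linear forms on S, dual to the family b on D; a
    spanning family with such forms is a basis of S over R. *)
Record left_coordinates : Prop := LeftCoordinates {
  coB : forall i, zmod_morphism (co i);
  coM : forall i r u, co i (h r * u) = r * co i u;
  co_dual : forall i j, D i -> D j -> co i (b j) = (i == j)%:R;
  co_span : forall u, exists s (c : I -> R),
    (forall i, i \in s -> D i) /\ u = \sum_(i <- s) h (c i) * b i }.

Record right_coordinates : Prop := RightCoordinates {
  rcoB : forall i, zmod_morphism (co i);
  rcoM : forall i r u, co i (u * h r) = co i u * r;
  rco_dual : forall i j, D i -> D j -> co i (b j) = (i == j)%:R;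
  rco_span : forall u, exists s (c : I -> R),
    (forall i, i \in s -> D i) /\ u = \sum_(i <- s) b i * h (c i) }.

Lemma sum_pick (V : zmodType) (s : seq I) (i : I) (F : I -> V) :
  uniq s -> i \in s -> (forall j, j != i -> F j = 0) -> \sum_(j <- s) F j = F i.
Proof.
by move=> us si F0; rewrite (bigD1_seq i) //= big1 ?addr0.
Qed.

Section Left.
Hypothesis lc : left_coordinates.

Lemma co_combination (s : seq I) (c : I -> R) j : D j -> (forall i, i \in s -> D i) ->
  co j (\sum_(i <- s) h (c i) * b i) = \sum_(i <- s) c i * (j == i)%:R.
Proof.
move=> Dj Ds; rewrite (zmod_sum _ _ (coB lc j)) big_seq [RHS]big_seq.
by apply: eq_bigr => i si; rewrite (coM lc) (co_dual lc) //; apply: Ds.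
Qed.

Lemma left_is_basis : is_basis (V := restrL h) D b.
Proof.
split=> [s c us Ds e i si|u]; last by exact: (co_span lc u).
have := congr1 (co i) e; rewrite [X in X = _ -> _](co_combination _ (Ds i si) Ds).
rewrite (zmod0 (coB lc i)) (sum_pick us si) ?eqxx ?mulr1 // => j ji.
by rewrite eq_sym (negbTE ji) mulr0.
Qed.

(** The expansion is stated over every index list containing s, so that finitely
    many elements can be expanded over a common one. *)
Lemma left_expansion u : exists s : seq I, (forall i, i \in s -> D i) /\
  forall s' : seq I, uniq s' -> {subset s <= s'} -> (forall i, i \in s' -> D i) ->
    u = \sum_(i <- s') h (co i u) * b i.
Proof.
have [s [c [Ds eu]]] := co_span lc u; exists s; split=> // s' us' ss' Ds'.
transitivity (\sum_(j <- s') \sum_(i <- s) h (c i) * (j == i)%:R * b j).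
  rewrite exchange_big {1}eu [LHS]big_seq [RHS]big_seq; apply: eq_bigr => i si.
  rewrite (sum_pick us' (ss' _ si)) ?eqxx ?mulr1 // => j ji.
  by rewrite (negbTE ji) mulr0 mul0r.
rewrite [LHS]big_seq [RHS]big_seq; apply: eq_bigr => j sj.
rewrite eu co_combination ?rmorph_sum ?mulr_suml //; last exact: Ds'.
by apply: eq_bigr => i _; rewrite rmorphM rmorph_nat.
Qed.

Variable i0 : I.
Hypothesis Di0 : D i0.

Lemma coordinates_injective : injective h.
Proof.
move=> r r' e; have E q : co i0 (h q * b i0) = q.
  by rewrite (coM lc) (co_dual lc) // eqxx mulr1.
by rewrite -(E r) e E.
Qed.

Section TensorSide.
Variable Y : lmodType R^c.
Local Notation T := (tensor Y (restrL h)).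

Let coY i (y : Y) (u : restrL h) : Y := (co i u : R^c) *: y.
Let coY_bal i : balanced (coY i).
Proof.
split=> [y y' u|y u u'|y c u]; rewrite /coY.
- exact: scalerDr.
- by rewrite (zmodD _ _ (coB lc i)); apply: scalerDl.
rewrite [co i (c *: u)](coM lc); rewrite scalerA; congr (_ *: _).
Qed.
Definition left_tau i : T -> Y := tlift (coY i).
Definition left_iota i (y : Y) : T := tens y (b i : restrL h).

Lemma left_tauE i y u : left_tau i (tens y u) = (co i u : R^c) *: y.
Proof. exact: (tliftE (coY_bal i)). Qed.
Lemma left_tauB i : zmod_morphism (left_tau i).
Proof. exact: (tliftB (coY_bal i)). Qed.

Lemma left_iotaB i : zmod_morphism (left_iota i).
Proof.
move=> y y'; apply: (addIr (left_iota i y')).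
by rewrite subrK /left_iota -tensDl subrK.
Qed.

Lemma left_tensor_expansion t : exists s : seq I, (forall i, i \in s -> D i) /\
  forall s' : seq I, uniq s' -> {subset s <= s'} -> (forall i, i \in s' -> D i) ->
    t = \sum_(i <- s') left_iota i (left_tau i t).
Proof.
move: t; apply: tens_ind => [|t t' [s [Ds es]] [s' [Ds' es']]|y u].
- exists [::]; split=> // s' _ _ _; rewrite big1 // => i _.
  by rewrite (zmod0 (left_tauB i)) (zmod0 (left_iotaB i)).
- exists (s ++ s'); split=> [i|s2 us2 ss2 Ds2].
    by rewrite mem_cat => /orP[/Ds|/Ds'].
  rewrite {1}(es s2) // => [|i si]; last by apply: ss2; rewrite mem_cat si.
  rewrite {1}(es' s2) // => [|i si]; last by apply: ss2; rewrite mem_cat si orbT.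
  rewrite -sumrB; apply: eq_bigr => i _.
  by rewrite (left_tauB i) (left_iotaB i).
have [s [Ds es]] := left_expansion u; exists s; split=> // s' us' ss' Ds'.
rewrite {1}(es s') //.
have tensB : zmod_morphism (tens y : restrL h -> T).
  by move=> v v'; apply: (addIr (tens y v')); rewrite subrK -tensDr subrK.
rewrite [LHS](zmod_sum _ _ tensB); apply: eq_bigr => i _.
by rewrite /left_iota left_tauE tensZ.
Qed.

Lemma left_tensor_sum t : exists s, t = \sum_(i <- s) left_iota i (left_tau i t).
Proof.
have [s [Ds es]] := left_tensor_expansion t; exists (undup s).
apply: es => [|i|i]; first exact: undup_uniq.
  by rewrite mem_undup.
by rewrite mem_undup; apply: Ds.
Qed.

Lemma left_tauK y : left_tau i0 (left_iota i0 y) = y.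
Proof. by rewrite left_tauE (co_dual lc) // eqxx scale1r. Qed.
End TensorSide.

Lemma left_faithfully_flat : faithfully_flat_left (restrL h).
Proof.
move=> X Y Z f g.
have tmapE (U V : lmodType R^c) (p : {linear U -> V}) u m :
    tmap p (idfun : restrL h -> restrL h) (tens u m) = tens (p u) m.
  apply: tliftE; split=> [v v' w|v w w'|v c w].
  - by rewrite raddfD tensDl.
  - exact: tensDr.
  - by rewrite linearZ tensZ.
have tmapB (U V : lmodType R^c) (p : {linear U -> V}) :
    zmod_morphism (tmap p (idfun : restrL h -> restrL h)).
  apply: tliftB; split=> [v v' w|v w w'|v c w].
  - by rewrite raddfD tensDl.
  - exact: tensDr.
  - by rewrite linearZ tensZ.
have tau_nat (U V : lmodType R^c) (p : {linear U -> V}) i t :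
    left_tau i (tmap p (idfun : restrL h -> restrL h) t) = p (left_tau i t).
  move: t; apply: tens_indA => [s t|s t|u m].
  - by rewrite tmapB left_tauB.
  - by rewrite left_tauB raddfB.
  by rewrite tmapE !left_tauE linearZ.
pose M := GRing.isZmodMorphism.Build _ _ _ (tmapB _ _ f).
pose F := HB.pack_for {additive tensor X (restrL h) -> tensor Y (restrL h)}
  (tmap f (idfun : restrL h -> restrL h)) M.
apply: (@exact_coordinates X Y Z _ _ _ f g F (tmap g idfun) I i0
  (@left_tau X) (@left_tau Y) (@left_tau Z)
  (@left_iota X) (@left_iota Y) (@left_iota Z)).
- by move=> i t; apply: tau_nat.
- by move=> i t; apply: tau_nat.
- by move=> i x; apply: tmapE.
- by move=> i y; apply: tmapE.
- by move=> i; apply: (zmod0 (left_tauB i)).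
- by move=> i; apply: (zmod0 (left_iotaB i)).
- exact: left_tauK.
- exact: left_tauK.
- exact: left_tensor_sum.
- exact: left_tensor_sum.
Qed.
End Left.
Section Right.
Hypothesis rc : right_coordinates.

Lemma rco_combination (s : seq I) (c : I -> R) j : D j -> (forall i, i \in s -> D i) ->
  co j (\sum_(i <- s) b i * h (c i)) = \sum_(i <- s) (j == i)%:R * c i.
Proof.
move=> Dj Ds; rewrite (zmod_sum _ _ (rcoB rc j)) big_seq [RHS]big_seq.
by apply: eq_bigr => i si; rewrite (rcoM rc) (rco_dual rc) //; apply: Ds.
Qed.

Lemma right_expansion u : exists s : seq I, (forall i, i \in s -> D i) /\
  forall s' : seq I, uniq s' -> {subset s <= s'} -> (forall i, i \in s' -> D i) ->
    u = \sum_(i <- s') b i * h (co i u).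
Proof.
have [s [c [Ds eu]]] := rco_span rc u; exists s; split=> // s' us' ss' Ds'.
transitivity (\sum_(j <- s') \sum_(i <- s) b j * (h (c i) * (j == i)%:R)).
  rewrite exchange_big {1}eu [LHS]big_seq [RHS]big_seq; apply: eq_bigr => i si.
  rewrite (sum_pick us' (ss' _ si)) ?eqxx ?mulr1 // => j ji.
  by rewrite (negbTE ji) !mulr0.
rewrite [LHS]big_seq [RHS]big_seq; apply: eq_bigr => j sj.
rewrite eu rco_combination ?rmorph_sum ?mulr_sumr //; last exact: Ds'.
by apply: eq_bigr => i _; rewrite rmorphM rmorph_nat; case: (j == i);
  rewrite ?mulr1 ?mul1r // mulr0 mul0r.
Qed.

Variable i0 : I.
Hypothesis Di0 : D i0.

Section RightTensorSide.
Variable Y : lmodType R.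
Local Notation T := (tensor (restrR h) Y).

Let coY i (u : restrR h) (y : Y) : Y := co i u *: y.
Let coY_bal i : balanced (coY i).
Proof.
split=> [u u' y|u y y'|u c y]; rewrite /coY.
- by rewrite (zmodD _ _ (rcoB rc i)); apply: scalerDl.
- exact: scalerDr.
by rewrite [co i _](rcoM rc) scalerA.
Qed.
Definition right_tau i : T -> Y := tlift (coY i).
Definition right_iota i (y : Y) : T := tens (b i : restrR h) y.

Lemma right_tauE i y u : right_tau i (tens u y) = co i u *: y.
Proof. exact: (tliftE (coY_bal i)). Qed.
Lemma right_tauB i : zmod_morphism (right_tau i).
Proof. exact: (tliftB (coY_bal i)). Qed.

Lemma right_iotaB i : zmod_morphism (right_iota i).
Proof.
move=> y y'; apply: (addIr (right_iota i y')).
by rewrite subrK /right_iota -tensDr subrK.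
Qed.

Lemma right_tensor_expansion t : exists s : seq I, (forall i, i \in s -> D i) /\
  forall s' : seq I, uniq s' -> {subset s <= s'} -> (forall i, i \in s' -> D i) ->
    t = \sum_(i <- s') right_iota i (right_tau i t).
Proof.
move: t; apply: tens_ind => [|t t' [s [Ds es]] [s' [Ds' es']]|u y].
- exists [::]; split=> // s' _ _ _; rewrite big1 // => i _.
  by rewrite (zmod0 (right_tauB i)) (zmod0 (right_iotaB i)).
- exists (s ++ s'); split=> [i|s2 us2 ss2 Ds2].
    by rewrite mem_cat => /orP[/Ds|/Ds'].
  rewrite {1}(es s2) // => [|i si]; last by apply: ss2; rewrite mem_cat si.
  rewrite {1}(es' s2) // => [|i si]; last by apply: ss2; rewrite mem_cat si orbT.
  rewrite -sumrB; apply: eq_bigr => i _.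
  by rewrite (right_tauB i) (right_iotaB i).
have [s [Ds es]] := right_expansion u; exists s; split=> // s' us' ss' Ds'.
rewrite [in LHS](es s') //.
have tensB : zmod_morphism (fun v : restrR h => tens v y : T).
  by move=> v v'; apply: (addIr (tens v' y)); rewrite subrK -tensDl subrK.
apply: etrans (zmod_sum s' (fun i => b i * h (co i u)) tensB) _; apply: eq_bigr => i _.
by rewrite /right_iota right_tauE -tensZ.
Qed.

Lemma right_tensor_sum t : exists s, t = \sum_(i <- s) right_iota i (right_tau i t).
Proof.
have [s [Ds es]] := right_tensor_expansion t; exists (undup s).
apply: es => [|i|i]; first exact: undup_uniq.
  by rewrite mem_undup.
by rewrite mem_undup; apply: Ds.
Qed.

Lemma right_tauK y : right_tau i0 (right_iota i0 y) = y.
Proof. by rewrite right_tauE (rco_dual rc) // eqxx scale1r. Qed.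
End RightTensorSide.

Lemma right_faithfully_flat : faithfully_flat_right (restrR h).
Proof.
move=> X Y Z f g.
have tmapE (U V : lmodType R) (p : {linear U -> V}) u m :
    tmap (idfun : restrR h -> restrR h) p (tens m u) = tens m (p u).
  apply: tliftE; split=> [v v' w|v w w'|v c w].
  - exact: tensDl.
  - by rewrite raddfD tensDr.
  - by rewrite tensZ linearZ.
have tmapB (U V : lmodType R) (p : {linear U -> V}) :
    zmod_morphism (tmap (idfun : restrR h -> restrR h) p).
  apply: tliftB; split=> [v v' w|v w w'|v c w].
  - exact: tensDl.
  - by rewrite raddfD tensDr.
  - by rewrite tensZ linearZ.
have tau_nat (U V : lmodType R) (p : {linear U -> V}) i t :
    right_tau i (tmap (idfun : restrR h -> restrR h) p t) = p (right_tau i t).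
  move: t; apply: tens_indA => [s t|s t|m u].
  - by rewrite tmapB right_tauB.
  - by rewrite right_tauB raddfB.
  by rewrite tmapE !right_tauE linearZ.
pose M := GRing.isZmodMorphism.Build _ _ _ (tmapB _ _ f).
pose F := HB.pack_for {additive tensor (restrR h) X -> tensor (restrR h) Y}
  (tmap (idfun : restrR h -> restrR h) f) M.
apply: (@exact_coordinates X Y Z _ _ _ f g F (tmap idfun g) I i0
  (@right_tau X) (@right_tau Y) (@right_tau Z)
  (@right_iota X) (@right_iota Y) (@right_iota Z)).
- by move=> i t; apply: tau_nat.
- by move=> i t; apply: tau_nat.
- by move=> i x; apply: tmapE.
- by move=> i y; apply: tmapE.
- by move=> i; apply: (zmod0 (right_tauB i)).
- by move=> i; apply: (zmod0 (right_iotaB i)).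
- exact: right_tauK.
- exact: right_tauK.
- exact: right_tensor_sum.
- exact: right_tensor_sum.
Qed.
End Right.
End Coordinates.

(** An anti-automorphism tS of S that extends one of R carries left coordinates
    to right ones. *)
Lemma right_of_left (R S : pzRingType) (h : {rmorphism R -> S}) (I : eqType)
    (D : I -> Prop) (b : I -> S) (co : I -> S -> R) (tR : R -> R) (tS : S -> S) :
  zmod_morphism tR -> (forall u v, tR (u * v) = tR v * tR u) -> tR 1 = 1 ->
  cancel tR tR ->
  zmod_morphism tS -> (forall u v, tS (u * v) = tS v * tS u) -> cancel tS tS ->
  (forall r, tS (h r) = h (tR r)) ->
  left_coordinates h D b co ->
  right_coordinates h D (tS \o b) (fun i u => tR (co i (tS u))).
Proof.
move=> tRB tRM tR1 tRK tSB tSM tSK th lc; split.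
- by move=> i u v; rewrite tSB (coB lc) tRB.
- by move=> i r u; rewrite tSM th (coM lc) tRM tRK.
- move=> i j Di Dj; rewrite /= tSK (co_dual lc) //.
  by case: (i == j); rewrite ?tR1 // (zmod0 tRB).
move=> u; have [s [c [Ds eu]]] := co_span lc (tS u).
exists s, (fun i => tR (c i)); split=> //.
rewrite -[u]tSK eu (zmod_sum _ _ tSB); apply: eq_bigr => i _.
by rewrite tSM th.
Qed.

Section Span.
Variables (R S : pzRingType) (h : {rmorphism R -> S}) (I : eqType).
Variables (D : I -> Prop) (b : I -> S).

Definition in_span (u : S) : Prop := exists l : seq (R * I),
  (forall p, p \in [seq q.2 | q <- l] -> D p) /\ u = \sum_(p <- l) h p.1 * b p.2.

Lemma in_span0 : in_span 0.
Proof. by exists [::]; split=> //; rewrite big_nil. Qed.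

Lemma in_spanD u v : in_span u -> in_span v -> in_span (u + v).
Proof.
move=> [l [Dl ->]] [l' [Dl' ->]]; exists (l ++ l'); split; last by rewrite big_cat.
by move=> p; rewrite map_cat mem_cat => /orP[/Dl|/Dl'].
Qed.

Lemma in_span_gen r i : D i -> in_span (h r * b i).
Proof.
move=> Di; exists [:: (r, i)]; split; last by rewrite big_seq1.
by move=> p; rewrite inE => /eqP ->.
Qed.

Lemma in_span_additive (t : S -> S) : zmod_morphism t ->
  (forall r i, D i -> in_span (t (h r * b i))) -> forall u, in_span u -> in_span (t u).
Proof.
move=> tB tgen u [l [Dl ->]]; elim: l Dl => [|[r i] l IH] Dl.
  by rewrite big_nil (zmod0 tB); apply: in_span0.
rewrite big_cons (zmodD _ _ tB); apply: in_spanD.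
  by apply: tgen; apply: Dl; rewrite /= inE eqxx.
by apply: IH => p lp; apply: Dl; rewrite /= inE lp orbT.
Qed.

Lemma in_spanM r u : in_span u -> in_span (h r * u).
Proof.
apply: (in_span_additive (t := fun u => h r * u)); first exact: mulrBr.
by move=> r' i Di; rewrite mulrA -rmorphM; apply: in_span_gen.
Qed.

Lemma in_spanB u v : in_span u -> in_span v -> in_span (u - v).
Proof.
move=> su sv; apply: in_spanD => //.
by rewrite -mulN1r -(rmorph1 h) -rmorphN; apply: in_spanM.
Qed.

(** Repeated indices are merged, to obtain coefficients indexed by I. *)
Lemma in_span_combination u : in_span u -> exists s (c : I -> R),
  (forall i, i \in s -> D i) /\ u = \sum_(i <- s) h (c i) * b i.
Proof.
move=> [l [Dl ->]]; exists (undup [seq q.2 | q <- l]).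
exists (fun i => \sum_(p <- l | p.2 == i) p.1); split.
  by move=> i; rewrite mem_undup; apply: Dl.
under [RHS]eq_bigr => i _ do rewrite rmorph_sum mulr_suml big_mkcond /=.
rewrite exchange_big big_seq [RHS]big_seq; apply: eq_bigr => p lp.
rewrite (sum_pick (i := p.2)) ?undup_uniq ?eqxx //.
  by rewrite mem_undup; apply: map_f.
by move=> j jp; rewrite eq_sym (negbTE jp).
Qed.
End Span.

Section ProductInduction.
Variables (k : fieldType) (A1 A2 C : kalg k) (L : kmor A1 C) (R : kmor A2 C).
Hypothesis LR : forall p q, L p * R q = R q * L p.
Hypothesis genLR : generated (fun u => (exists p, u = L p) \/ (exists q, u = R q)).

Lemma product_ind (P : C -> Prop) : P 0 -> (forall u v, P u -> P v -> P (u + v)) ->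
  (forall p q, P (L p * R q)) -> forall u, P u.
Proof.
move=> P0 PD Pgen.
pose S (u : C) := exists l : seq (A1 * A2), u = \sum_(p <- l) L p.1 * R p.2.
have S1 : S 1.
  by exists [:: (1, 1)]; rewrite big_seq1 !rmorph1 mulr1.
have SD u v : S u -> S v -> S (u + v).
  by move=> [l ->] [l' ->]; exists (l ++ l'); rewrite big_cat.
have Sl p w : S w -> S (L p * w).
  move=> [l ->]; exists [seq (p * q.1, q.2) | q <- l].
  by rewrite big_map mulr_sumr; apply: eq_bigr => q _; rewrite mulrA -rmorphM.
have Sr q w : S w -> S (R q * w).
  move=> [l ->]; exists [seq (p.1, q * p.2) | p <- l].
  rewrite big_map mulr_sumr; apply: eq_bigr => p _ /=.
  by rewrite rmorphM !mulrA LR.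
have SM (u : C) : forall w, S w -> S (u * w).
  move: u; apply: genLR => [|u [[p ->]|[q ->]] w]; last 2 first.
  - exact: Sl.
  - exact: Sr.
  split=> [c|u v Su Sv w Sw|u v Su Sv w Sw].
  - by move=> w Sw; rewrite -(kmor_in L); apply: Sl.
  - rewrite mulrBl; apply: (SD) (Su _ Sw) _.
    rewrite -mulN1r -(rmorph1 L) -rmorphN.
    by apply: (Sl); apply: Sv.
  - by rewrite -mulrA; apply/Su/Sv.
move=> u; have [l ->] : S u by rewrite -[u]mulr1; apply: SM.
by apply: (big_ind P) => // p _; apply: Pgen.
Qed.
End ProductInduction.

(** * PBW words and integral powers of a *)
Lemma Lsemigroup_state n w :
  Lsemigroup n w <-> exists W : seq (block n), w = state_word W.
Proof.
split=> [[ws [Lws ->]]|[W ->]].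
  elim/last_ind: ws Lws => [|ws s IH] Lws; first by exists [::].
  have [|W eW] := IH; first by move=> t wst; apply: Lws; rewrite mem_rcons inE wst orbT.
  have [|i [j [i0 j0 ij es]]] := Lws s; first by rewrite mem_rcons inE eqxx.
  have h : [&& 0 < (i, j).1, 0 < (i, j).2 & (i, j).1 + (i, j).2 < n]%N by rewrite /= i0 j0.
  exists (Sub (i, j) h :: W); rewrite -cats1 flatten_cat eW /= cats0 es.
  by [].
elim: W => [|[[i j] h] W [ws [Lws eW]]]; first by exists [::].
exists (rcons ws (nseq i true ++ nseq j false)); split.
  move=> s; rewrite mem_rcons inE => /orP[/eqP ->|]; last exact: Lws.
  by have /and3P[? ? ?] := h; exists i, j.
by rewrite -cats1 flatten_cat -eW /= cats0.
Qed.

Section IntegerPowers.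
Variables (R : pzRingType) (a ai : R).
Hypotheses (aai : a * ai = 1) (aia : ai * a = 1).

Lemma zpowS i : zpow a ai (i + 1) = zpow a ai i * a.
Proof.
case: i => [p|p].
  by rewrite (_ : Posz p + 1 = Posz p.+1) /= ?exprSr //; lia.
case: p => [|p]; first by rewrite /= expr1 aia.
rewrite (_ : Negz p.+1 + 1 = Negz p) /=; last by lia.
by rewrite [ai ^+ p.+2]exprSr -mulrA aia mulr1.
Qed.

Lemma zpowP i : zpow a ai (i - 1) = zpow a ai i * ai.
Proof. by rewrite -[in RHS](subrK 1 i) zpowS -mulrA aai mulr1. Qed.

Lemma zpowDn i (p : nat) : zpow a ai (i + p%:Z) = zpow a ai i * a ^+ p.
Proof.
elim: p => [|p IH]; first by rewrite addr0 mulr1.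
by rewrite -addn1 PoszD addrA zpowS IH -mulrA addn1 -exprSr.
Qed.

Lemma zpowBn i (p : nat) : zpow a ai (i - p%:Z) = zpow a ai i * ai ^+ p.
Proof.
elim: p => [|p IH]; first by rewrite subr0 mulr1.
by rewrite -addn1 PoszD opprD addrA zpowP IH -mulrA addn1 -exprSr.
Qed.

End IntegerPowers.

Lemma kmor_zpow (k : fieldType) (A B : kalg k) (h : kmor A B) a ai i :
  h (zpow a ai i) = zpow (h a) (h ai) i.
Proof. by case: i => p; rewrite /= rmorphXn. Qed.

(** * PBW words span over the coordinate ring *)
Lemma kmor_weval (k : fieldType) (A B : kalg k) (h : kmor A B) u v w :
  h (weval u v w) = weval (h u) (h v) w.
Proof. by rewrite /weval rmorph_prod; apply: eq_bigr => -[] _. Qed.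

Section PbwSpan.
Variables (k : fieldType) (n : nat) (g : {poly k}) (m : nat) (f : {poly k}).
Hypotheses (deg_g : size g = n.+1) (n_ge2 : (2 <= n)%N).
Hypotheses (deg_f : size f = m.+1) (m_ge2 : (2 <= m)%N).
Variables (A1 A2 C0 C : kalg k) (L : kmor A1 C) (R : kmor A2 C) (iota : kmor C0 C).
Variables (x a ai : A1) (y b bi : A2) (cx cy : C0).
Hypotheses (aai : a * ai = 1) (aia : ai * a = 1) (ap : additive_pair n g x a).
Hypotheses (bbi : b * bi = 1) (bib : bi * b = 1) (bp : additive_pair m f y b).
Hypothesis genA1 : generated (fun u => [\/ u = x, u = a | u = ai]).
Hypothesis genA2 : generated (fun u => [\/ u = y, u = b | u = bi]).
Hypothesis LR : forall p q, L p * R q = R q * L p.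
Hypothesis genLR : generated (fun u => (exists p, u = L p) \/ (exists q, u = R q)).
Hypothesis anbm : L a ^+ n = R b ^+ m.
Hypotheses (iota_x : iota cx = L x) (iota_y : iota cy = R y).

Definition pbw_word (p : pbw_index) : C :=
  let: (w, v, i, j) := p in
  weval (L a) (L x) w * weval (R b) (R y) v * zpow (L a) (L ai) i * R b ^+ j.

Lemma pbw_wordE w v i j : pbw_word (w, v, i, j)
  = L (weval a x w * zpow a ai i) * R (weval b y v * b ^+ j).
Proof.
rewrite /pbw_word -kmor_zpow -!kmor_weval -(rmorphXn R) [L (_ * _)]rmorphM [R (_ * _)]rmorphM.
by rewrite !mulrA; congr (_ * _); rewrite -!mulrA; congr (_ * _); rewrite LR.
Qed.

Let an_central u : GRing.comm (a ^+ n) u.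
Proof.
move: u; apply: genA1; first exact: (subalgebra_comm (kid A1)).
have can : GRing.comm (a ^+ n) a by apply/commr_sym/commrX.
move=> u [] ->; [|by []|].
  exact/commr_sym/(additive_pair_an deg_g n_ge2).
exact: (comm_inverse aai aia can).
Qed.

Let An_central u : GRing.comm (L a ^+ n) u.
Proof.
move: u; apply: genLR; first exact: (subalgebra_comm (kid C)).
move=> u [[p ->]|[q ->]].
  rewrite -(rmorphXn L); exact: (kmor_comm L (an_central p)).
by rewrite -(rmorphXn L); apply: LR.
Qed.

Let ann : L a ^+ n * L ai ^+ n = 1.
Proof. by rewrite -!(rmorphXn L) (kmor_inv L (expr_inv n aai aia)). Qed.
Let nan : L ai ^+ n * L a ^+ n = 1.
Proof. by rewrite -!(rmorphXn L) (kmor_inv L (expr_inv n aia aai)). Qed.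

Let Ain_central u : GRing.comm (L ai ^+ n) u.
Proof. exact/commr_sym/(comm_inverse ann nan)/commr_sym/An_central. Qed.

Let inverse_top : R bi ^+ m = L ai ^+ n.
Proof.
exact: (inverse_expr_eq (kmor_inv R bbi) (kmor_inv R bib) (kmor_inv L aai)
  (kmor_inv L aia) (esym anbm)).
Qed.

Let La : L a * L ai = 1. Proof. exact: (kmor_inv L aai). Qed.
Let La' : L ai * L a = 1. Proof. exact: (kmor_inv L aia). Qed.

Local Notation span := (in_span iota (pbw_dom n m) pbw_word).

Let An_word w v i j : L a ^+ n * pbw_word (w, v, i, j) = pbw_word (w, v, i + n%:Z, j).
Proof.
rewrite /pbw_word (zpowDn La') An_central -!mulrA; congr (_ * (_ * (_ * _))).
by rewrite An_central.
Qed.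

Let Ain_word w v i j : L ai ^+ n * pbw_word (w, v, i, j) = pbw_word (w, v, i - n%:Z, j).
Proof.
rewrite /pbw_word (zpowBn La La') Ain_central -!mulrA; congr (_ * (_ * (_ * _))).
by rewrite Ain_central.
Qed.

Let span_An u : span u -> span (L a ^+ n * u).
Proof.
apply: (in_span_additive (t := fun u => L a ^+ n * u)); first exact: mulrBr.
move=> r [[[w v] i] j] D; rewrite mulrA An_central -mulrA An_word.
exact: in_span_gen.
Qed.

Let span_Ain u : span u -> span (L ai ^+ n * u).
Proof.
apply: (in_span_additive (t := fun u => L ai ^+ n * u)); first exact: mulrBr.
move=> r [[[w v] i] j] D; rewrite mulrA Ain_central -mulrA Ain_word.
exact: in_span_gen.
Qed.

Let span_in c u v : span u -> span v -> span (kin C c * u + v).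
Proof.
by move=> su sv; apply: in_spanD => //; rewrite -(kmor_in iota); apply: in_spanM.
Qed.

Let span_words (V : seq (block m)) j p : (j < m)%N ->
  span (L p * R (weval b y (state_word V) * b ^+ j)).
Proof.
move=> lt_jm; pose w := R (weval b y (state_word V) * b ^+ j).
apply: (Aone_spanning n_ge2 deg_g (x := x) (a := a) (ai := ai)
  (P := fun p => span (L p * w))).
- exact: aai.
- exact: aia.
- exact: ap.
- exact: genA1.
- by rewrite rmorph0 mul0r; apply: in_span0.
- move=> c u v su sv; rewrite rmorphD rmorphM kmor_in mulrDl -mulrA.
  exact: span_in.
- by move=> u su; rewrite rmorphM -mulrA -iota_x; apply: in_spanM.
- by move=> u su; rewrite rmorphM rmorphXn -mulrA; apply: span_An.
- by move=> u su; rewrite rmorphM rmorphXn -mulrA; apply: span_Ain.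
move=> W s lt_sn.
have -> : L (weval a x (state_word W) * a ^+ s) * w
  = iota 1 * pbw_word (state_word W, state_word V, s%:Z, j).
  by rewrite rmorph1 mul1r pbw_wordE.
by apply: in_span_gen; split=> //; apply/Lsemigroup_state; [exists W|exists V].
Qed.

(** Normal words span each factor, and x, y and a^n = b^m can be moved to the
    left: x and y into the scalars, a^n into the exponent of a. *)
Lemma pbw_word_span u : span u.
Proof.
move: u; apply: (product_ind LR genLR); [exact: in_span0|exact: in_spanD|].
move=> p q; move: q p.
apply: (Aone_spanning m_ge2 deg_f (x := y) (a := b) (ai := bi)
  (P := fun q => forall p, span (L p * R q))).
- exact: bbi.
- exact: bib.
- exact: bp.
- exact: genA2.
- by move=> p; rewrite rmorph0 mulr0; apply: in_span0.
- move=> c u v su sv p; rewrite rmorphD rmorphM kmor_in mulrDr mulrA -kcentral -mulrA.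
  exact: span_in.
- by move=> u su p; rewrite rmorphM mulrA LR -mulrA -iota_y; apply: in_spanM.
- by move=> u su p; rewrite rmorphM mulrA LR rmorphXn -anbm -mulrA; apply: span_An.
- by move=> u su p; rewrite rmorphM mulrA LR rmorphXn inverse_top -mulrA; apply: span_Ain.
by move=> V j lt_jm p; apply: span_words.
Qed.
End PbwSpan.

(** * Coordinates over the coordinate ring *)
Lemma zpow_split (R : pzRingType) (a ai : R) n (s : nat) q : a * ai = 1 -> ai * a = 1 ->
  zpow a ai (s%:Z + n%:Z * q) = a ^+ s * zpow (a ^+ n) (ai ^+ n) q.
Proof.
move=> aai aia; case: q => p; first by rewrite -PoszM -PoszD /= exprD exprM.
rewrite (_ : n%:Z * Negz p = - (n * p.+1)%N%:Z); last by rewrite NegzE mulrN PoszM.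
by rewrite (zpowBn aai aia) /= exprM.
Qed.

Lemma kmor_kendM (k : fieldType) (A : kalg k) (M : lmodType k) (h : kmor A (kend M)) u v phi :
  h (u * v) phi = h u (h v phi).
Proof. by rewrite rmorphM. Qed.

Lemma kmor_zpow_eq (k : fieldType) (A B : kalg k) (h : kmor A B) u v u' v' q :
  h u = u' -> h v = v' -> h (zpow u v q) = zpow u' v' q.
Proof. by move=> <- <-; apply: kmor_zpow. Qed.

Section IntegerShift.
Variables (k : fieldType) (V : lmodType k).
Local Notation T := (int -> V : lmodType k).

Fact int_shift_linear (d : int) : linear (fun phi : T => (fun t => phi (t + d)) : T).
Proof. by []. Qed.
Definition int_shift d : kend T := Endo (int_shift_linear d).

Lemma int_shiftM d e : int_shift d * int_shift e = int_shift (d + e).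
Proof. apply: kendP => phi; apply/funext => t; change (phi (t + d + e) = phi (t + (d + e))).
by rewrite addrA. Qed.

Lemma int_shift0 : int_shift 0 = 1.
Proof. apply: kendP => phi; apply/funext => t; change (phi (t + 0) = phi t).
by rewrite addr0. Qed.

Lemma int_shift1N : int_shift 1 * int_shift (-1) = 1.
Proof. by rewrite int_shiftM subrr int_shift0. Qed.
Lemma int_shiftN1 : int_shift (-1) * int_shift 1 = 1.
Proof. by rewrite int_shiftM addNr int_shift0. Qed.

Lemma int_shift_exp d p : int_shift d ^+ p = int_shift (d *+ p).
Proof.
by elim: p => [|p IH]; rewrite ?expr0 ?mulr0n ?int_shift0 // exprS IH int_shiftM mulrS.
Qed.

Lemma zpow_int_shift q : zpow (int_shift 1) (int_shift (-1)) q = int_shift q.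
Proof.
case: q => p; rewrite [LHS]int_shift_exp; congr int_shift; first by rewrite natz.
by rewrite mulNrn natz NegzE.
Qed.
End IntegerShift.

Section CurveStates.
Variables (k : fieldType) (n : nat) (g : {poly k}) (m : nat) (f : {poly k}).
Hypotheses (deg_g : size g = n.+1) (n_ge2 : (2 <= n)%N).
Hypotheses (deg_f : size f = m.+1) (m_ge2 : (2 <= m)%N).
Variables (C0 : kalg k) (cx cy : C0).
Hypotheses (cxy : GRing.comm cx cy) (gf : keval g cx = keval f cy).
Local Notation T := (int -> kvect C0 : lmodType k).
Local Notation o := (ordn n_ge2).
Local Notation a := (Aone_a n g).
Local Notation ai := (Aone_ai n g).
Local Notation x := (Aone_x n g).

Definition int_lmul : kmor C0 (kend T) := kcomp (pointwise int (kvect C0)) (lmul C0).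

Lemma int_lmul_shift c d : GRing.comm (int_lmul c) (int_shift _ d).
Proof. by apply: kendP. Qed.

Let gg := int_shift1N (kvect C0).
Let gg' := int_shiftN1 (kvect C0).
Let xg := int_lmul_shift cx 1.

(** The states of A(x,a,g) with values in the functions from Z to O(C): x acts at
    the empty state by x in O(C), and a^n by translation. *)
Definition curve_state_act : kmor (Aone n g) (kend (state_fun n T)) :=
  state_act n_ge2 gg gg' xg deg_g.
Local Notation st := curve_state_act.

Definition curve_y_op : kend (state_fun n T) := pointwise2 n T (int_lmul cy).

Lemma curve_y_op_comm p : GRing.comm curve_y_op (st p).
Proof.
have cyx : GRing.comm (int_lmul cy) (int_lmul cx) by apply/(kmor_comm int_lmul)/commr_sym.
have [ex ea _] := state_actE n_ge2 gg gg' xg deg_g.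
move: p; apply: Aone_comm_image.
  exact: (eq_ind_r (GRing.comm curve_y_op)
    (pointwise2_state_x g n_ge2 cyx (int_lmul_shift cy 1)) ex).
exact: (eq_ind_r (GRing.comm curve_y_op)
  (pointwise2_state_a n_ge2 (int_lmul_shift cy 1)) ea).
Qed.

Lemma keval_curve_y_op : keval f curve_y_op = st (keval g x).
Proof.
have [ex _ _] := state_actE n_ge2 gg gg' xg deg_g.
apply: etrans (esym (etrans (keval_mor st g x) (congr1 (keval g) ex))).
apply: etrans (esym (keval_mor (pointwise2 n T) f (int_lmul cy))) _.
apply: kendP => phi; apply/funext => W; apply/funext => s.
apply: etrans (esym (keval_state_x n_ge2 xg deg_g phi W s)).
apply: (congr1 (fun p : kend T => p (phi W s))).
exact: etrans (esym (keval_mor int_lmul f cy)) (etrans (congr1 int_lmul (esym gf))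
  (keval_mor int_lmul g cx)).
Qed.

Let st_an : st (a ^+ n) = pointwise2 n T (int_shift _ 1).
Proof.
have [_ ea _] := state_actE n_ge2 gg gg' xg deg_g.
apply: etrans (rmorphXn st n a) _.
apply: etrans (congr1 (fun z => z ^+ n) ea) _.
by apply: kendP => phi; apply: (state_a_expn n_ge2 (int_shift _ 1) phi).
Qed.

Let st_ain : st (ai ^+ n) = pointwise2 n T (int_shift _ (-1)).
Proof.
apply: (@inverse_unique _ (st (a ^+ n))).
  exact: (kmor_inv st (expr_inv n (Aone_aia n g) (Aone_aai n g))).
by rewrite st_an; apply: (kmor_inv (pointwise2 n T) gg).
Qed.

Let st_zpow q : st (zpow (a ^+ n) (ai ^+ n) q) = pointwise2 n T (int_shift _ q).
Proof.
apply: etrans (kmor_zpow_eq q st_an st_ain) _.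
apply: etrans (esym (kmor_zpow (pointwise2 n T) (int_shift _ 1) (int_shift _ (-1)) q)) _.
exact: (congr1 (pointwise2 n T) (zpow_int_shift (kvect C0) q)).
Qed.

(** The integer s + n q is the exponent of a: s is read on the state and q on the
    argument in Z. *)
Lemma curve_state_actE W (s : nat) q psi : (s < n)%N ->
  st (weval a x (state_word W) * zpow a ai (s%:Z + n%:Z * q)) psi [::] (o 0) 0
  = psi W (o s) q.
Proof.
move=> lt_sn; have e : weval a x (state_word W) * zpow a ai (s%:Z + n%:Z * q)
    = (weval a x (state_word W) * a ^+ s) * zpow (a ^+ n) (ai ^+ n) q.
  apply: etrans (congr1 ( *%R _) (zpow_split n s q (Aone_aai n g) (Aone_aia n g))) _.
  exact: mulrA.
rewrite e (kmor_kendM st) st_zpow.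
apply: etrans (congr1 (fun h : T => h 0)
  (state_act_state n_ge2 gg gg' xg deg_g W (pointwise2 n T (int_shift _ q) psi) lt_sn)) _.
rewrite pointwise2E; change (psi W (o s) (0 + q) = psi W (o s) q).
by rewrite add0r.
Qed.

Lemma curve_state_act_x psi : st x psi [::] (o 0) 0 = cx * (psi [::] (o 0) 0 : C0).
Proof.
have [ex _ _] := state_actE n_ge2 gg gg' xg deg_g.
apply: etrans (congr1 (fun z : kend (state_fun n T) => z psi [::] (o 0) 0) ex) _.
exact: (congr1 (fun h : T => h 0) (state_x_at0 g n_ge2 (int_lmul cx) (int_shift _ 1) psi)).
Qed.

End CurveStates.

Lemma kmor_kendB (k : fieldType) (A : kalg k) (M : lmodType k) (h : kmor A (kend M)) u v phi :
  h (u - v) phi = h u phi - h v phi.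
Proof. by rewrite rmorphB. Qed.

Lemma kmor_kend_in (k : fieldType) (A : kalg k) (M : lmodType k) (h : kmor A (kend M)) c u phi :
  h (kin A c * u) phi = c *: h u phi.
Proof. by rewrite rmorphM kmor_in. Qed.

Lemma subalgebra_semilinear (k : fieldType) (C A : kalg k) (h : kmor C A) (F : A -> C) :
  zmod_morphism F -> (forall c u, F (kin A c * u) = kin C c * F u) ->
  subalgebra (fun c => forall u, F (h c * u) = c * F u).
Proof.
move=> FB Fk; split=> [c u|c d Fc Fd u|c d Fc Fd u]; first by rewrite kmor_in.
  by rewrite rmorphB [_ * u]mulrBl FB Fc Fd -mulrBl.
by rewrite rmorphM -mulrA Fc Fd mulrA.
Qed.

Lemma int_modn_split n (i : int) : (0 < n)%N ->
  exists s q, (s < n)%N /\ i = s%:Z + n%:Z * q.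
Proof.
move=> n0; have nz : n%:Z != 0 by lia.
exists `|(i %% n)%Z|%N, (i %/ n)%Z; split.
  by have := ltz_pmod i (d := n); have := modz_ge0 i nz; lia.
rewrite (gez0_abs (modz_ge0 i nz)) addrC mulrC; exact: divz_eq.
Qed.

Lemma kmor_word_exp (k : fieldType) (A B : kalg k) (h : kmor A B) u v w j :
  h (weval u v w * u ^+ j) = weval (h u) (h v) w * h u ^+ j.
Proof. by rewrite rmorphM rmorphXn kmor_weval. Qed.

Lemma in_span_eq (R S : pzRingType) (h : {rmorphism R -> S}) (I : eqType)
    (D : I -> Prop) (b b' : I -> S) u : b =1 b' -> in_span h D b u -> in_span h D b' u.
Proof.
by move=> eb [l [Dl ->]]; exists l; split=> //; apply: eq_bigr => p _; rewrite eb.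
Qed.

Section CurveCoordinates.
Variables (k : fieldType) (n : nat) (g : {poly k}) (m : nat) (f : {poly k}).
Hypotheses (deg_g : size g = n.+1) (n_ge2 : (2 <= n)%N).
Hypotheses (deg_f : size f = m.+1) (m_ge2 : (2 <= m)%N).
Variable iota : kmor (curve g f) (Atwo n g m f).
Hypotheses (iota_x : iota (curve_x g f) = Atwo_x n g m f)
  (iota_y : iota (curve_y g f) = Atwo_y n g m f).
Local Notation C0 := (curve g f).
Local Notation A := (Atwo n g m f).
Local Notation il := (Atwo_l n g m f).
Local Notation ir := (Atwo_r n g m f).
Local Notation T := (int -> kvect C0 : lmodType k).
Local Notation L := (state_fun m (state_fun n T)).
Local Notation o := (ordn n_ge2).
Local Notation o' := (ordn m_ge2).

Let cxy : GRing.comm (curve_x g f) (curve_y g f) := curveC _ _.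

Definition curve_act : kmor A (kend L) := Atwo_act deg_g n_ge2 deg_f m_ge2
  (curve_y_op_comm deg_g n_ge2 cxy) (keval_curve_y_op deg_g n_ge2 (curve_eq g f)).

(** The value of u phi on the empty word.  As phi ranges over the indicator
    functions of PBW words, these are the coordinates of u. *)
Definition curve_value (phi : L) (u : A) : C0 := curve_act u phi [::] (o' 0) [::] (o 0) 0.

Lemma curve_valueB phi : zmod_morphism (curve_value phi).
Proof.
move=> u v; have e := kmor_kendB curve_act u v phi.
exact: (congr1 (fun h : L => h [::] (o' 0) [::] (o 0) 0) e).
Qed.

Let value_x phi u : curve_value phi (Atwo_x n g m f * u) = curve_x g f * curve_value phi u.
Proof.
have e := kmor_kendM curve_act (Atwo_x n g m f) u phi.
apply: etrans (congr1 (fun h : L => h [::] (o' 0) [::] (o 0) 0) e) _.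
have e1 := Atwo_act_l deg_g n_ge2 deg_f m_ge2
  (curve_y_op_comm deg_g n_ge2 cxy) (keval_curve_y_op deg_g n_ge2 (curve_eq g f))
  (Aone_x n g) (curve_act u phi) [::] (o' 0).
apply: etrans (congr1 (fun h : state_fun n T => h [::] (o 0) 0) e1) _.
exact: curve_state_act_x.
Qed.

Let value_y phi u : curve_value phi (Atwo_y n g m f * u) = curve_y g f * curve_value phi u.
Proof.
have e1 := Atwo_act_y deg_g n_ge2 deg_f m_ge2
  (curve_y_op_comm deg_g n_ge2 cxy) (keval_curve_y_op deg_g n_ge2 (curve_eq g f)) u phi.
exact: (congr1 (fun h : state_fun n T => h [::] (o 0) 0) e1).
Qed.

(** By generation, from x and y, which act by scalars at the empty states. *)
Lemma curve_valueM phi c u : curve_value phi (iota c * u) = c * curve_value phi u.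
Proof.
move: c u; suff S : subalgebra (fun c => forall u, curve_value phi (iota c * u) = c * curve_value phi u).
  apply: (generated_curve S) => c [] -> u.
    by apply: etrans (congr1 (fun z => curve_value phi (z * u)) iota_x) (value_x phi u).
  by apply: etrans (congr1 (fun z => curve_value phi (z * u)) iota_y) (value_y phi u).
apply: (subalgebra_semilinear iota (curve_valueB phi)) => b u.
have e := kmor_kend_in curve_act b u phi.
exact: (congr1 (fun h : L => h [::] (o' 0) [::] (o 0) 0) e).
Qed.

Lemma curve_value_word phi W V (s : nat) q (j : nat) : (s < n)%N -> (j < m)%N ->
  curve_value phi (pbw_elt n g m f (state_word W, state_word V, s%:Z + n%:Z * q, j))
  = phi V (o' j) W (o s) q.
Proof.
move=> lt_sn lt_jm; set i := _ + _.
pose p := weval (Aone_a n g) (Aone_x n g) (state_word W) * zpow (Aone_a n g) (Aone_ai n g) i.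
pose r := weval (Atwo_b n g m f) (Atwo_y n g m f) (state_word V) * Atwo_b n g m f ^+ j.
have e : pbw_elt n g m f (state_word W, state_word V, i, j) = il p * r.
  apply: etrans (pbw_wordE (Aone_x n g) (Aone_a n g) (Aone_ai n g) (Aone_x m f) (Aone_a m f)
    (@Atwo_comm k n g m f) (state_word W) (state_word V) i j) _.
  apply: (congr1 (fun z => il p * z)).
  exact: kmor_word_exp.
apply: etrans (congr1 (curve_value phi) e) _.
have e1 := kmor_kendM curve_act (il p) r phi.
apply: etrans (congr1 (fun h : L => h [::] (o' 0) [::] (o 0) 0) e1) _.
have e2 := Atwo_act_l deg_g n_ge2 deg_f m_ge2
  (curve_y_op_comm deg_g n_ge2 cxy) (keval_curve_y_op deg_g n_ge2 (curve_eq g f))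
  p (curve_act r phi) [::] (o' 0).
apply: etrans (congr1 (fun h : state_fun n T => h [::] (o 0) 0) e2) _.
have e3 := Atwo_act_word deg_g n_ge2 deg_f m_ge2
  (curve_y_op_comm deg_g n_ge2 cxy) (keval_curve_y_op deg_g n_ge2 (curve_eq g f))
  V phi lt_jm.
apply: etrans (congr1 (fun psi => curve_state_act deg_g n_ge2 (curve_x g f) p psi [::] (o 0) 0) e3) _.
exact: curve_state_actE.
Qed.

Definition curve_indicator (p : pbw_index) : L := fun V j W s q =>
  ((state_word W, state_word V, s%:Z + n%:Z * q, val j) == p)%:R.

Lemma pbw_left_coordinates : left_coordinates iota (pbw_dom n m) (@pbw_elt k n g m f)
  (fun p => curve_value (curve_indicator p)).
Proof.
split.
- by move=> p; apply: curve_valueB.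
- by move=> p c u; apply: curve_valueM.
- move=> p [[[w v] i] j] _ [/Lsemigroup_state[W ->] /Lsemigroup_state[V ->] lt_jm].
  have [s [q [lt_sn ->]]] := int_modn_split i (ltnW n_ge2).
  apply: etrans (curve_value_word _ W V q lt_sn lt_jm) _.
  by rewrite /curve_indicator /= !modn_small // eq_sym.
move=> u; apply: in_span_combination.
have := pbw_word_span deg_g n_ge2 deg_f m_ge2
  (Aone_aai n g) (Aone_aia n g) (Aone_pair deg_g)
  (Aone_aai m f) (Aone_aia m f) (Aone_pair deg_f)
  (@generated_Aone k n g) (@generated_Aone k m f)
  (@Atwo_comm k n g m f) (@generated_Atwo_lr k n g m f)
  (@Atwo_anbm k n g m f) iota_x iota_y u.
apply: in_span_eq => -[[[w v] i] j].
by [].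
Qed.
End CurveCoordinates.

Lemma endo_zmod (k : fieldType) (V : lmodType k) (p : kend V) : zmod_morphism p.
Proof. by move=> u v; rewrite -scaleN1r endoD endoZ scaleN1r. Qed.

Lemma comm_keval (k : fieldType) (A : kalg k) (h : {poly k}) (u v : A) :
  GRing.comm u v -> GRing.comm u (keval h v).
Proof.
move=> uv; apply: commr_sum => i _; apply: commrM; last exact: commrX.
exact/commr_sym/kcentral.
Qed.

(** * Coordinates over A(x,a,g) *)
Section Companion.
Variables (k : fieldType) (m : nat) (f : {poly k}) (V : lmodType k) (z : kend V).
Hypotheses (deg_f : size f = m.+1) (m_ge2 : (2 <= m)%N).
Local Notation W := ('I_m -> V : lmodType k).
Local Notation o := (ordn m_ge2).

(** The transpose of multiplication by Y on the basis 1, Y, ..., Y^(m-1) of the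
    extension by a root Y of f(Y) = z. *)
Definition companion_fun (psi : W) : W := fun l =>
  if (l.+1 < m)%N then psi (o l.+1)
  else (f`_m)^-1 *: (z (psi (o 0)) - \sum_(i < m) f`_i *: psi i).

Fact companion_linear : linear companion_fun.
Proof.
move=> c u v; apply/funext => l.
change (companion_fun (c *: u + v) l = c *: companion_fun u l + companion_fun v l).
rewrite /companion_fun; case: ifP => // _.
have E i : (c *: u + v : W) i = c *: u i + v i by [].
rewrite E (endo_linear z) scalerA mulrC -scalerA -scalerDr; congr (_ *: _).
rewrite scalerBr scaler_sumr addrACA -opprD -big_split; congr (_ - _).
by apply: eq_bigr => i _; rewrite E scalerDr !scalerA mulrC.
Qed.
Definition companion : kend W := Endo companion_linear.

Lemma companion_comm (p : kend V) : GRing.comm p z ->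
  GRing.comm (pointwise 'I_m V p) companion.
Proof.
move=> pz; apply: kendP => psi; apply/funext => l.
change (p (companion_fun psi l) = companion_fun (fun t => p (psi t)) l).
rewrite /companion_fun; case: ifP => // _.
rewrite endoZ (endo_zmod p) (kend_comm _ pz) (zmod_sum _ _ (endo_zmod p)).
congr (_ *: (_ - _)); apply: eq_bigr => i _; exact: endoZ.
Qed.

Lemma companion_exp i psi : (i < m)%N ->
  (companion ^+ i : kend W) psi (o 0) = psi (o i).
Proof.
move=> lt_im; rewrite -[o 0]/(o (0 + 0)).
suff E l : (l + i < m)%N -> (companion ^+ i : kend W) psi (o l) = psi (o (l + i)) by apply: E.
elim: i l {lt_im} => [|i IH] l lim; first by rewrite addn0.
have E : (o l).+1 = l.+1 by rewrite /= modn_small //; lia.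
rewrite exprS; change (companion_fun ((companion ^+ i : kend W) psi) (o l) = psi (o (l + i.+1))).
rewrite /companion_fun E; have -> : (l.+1 < m)%N by lia.
by rewrite IH addSnnS.
Qed.

Let keval_at0 psi : (keval f companion : kend W) psi (o 0) = z (psi (o 0)).
Proof.
have e : (keval f companion : kend W) psi
    = \sum_(i < m.+1) f`_i *: (companion ^+ i : kend W) psi.
  by rewrite -deg_f keval_kend; apply: eq_bigr => i _; rewrite kendX.
rewrite e fct_sumE big_ord_recr /=.
have em : (companion ^+ m : kend W) psi (o 0)
    = (f`_m)^-1 *: (z (psi (o 0)) - \sum_(i < m) f`_i *: psi i).
  have -> : companion ^+ m = companion ^+ m.-1 * companion :> kend W.
    by rewrite -exprSr prednK //; lia.
  rewrite kendM companion_exp; last by lia.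
  change (companion_fun psi (o m.-1) = (f`_m)^-1 *: (z (psi (o 0)) - \sum_(i < m) f`_i *: psi i)).
  rewrite /companion_fun (_ : (o m.-1).+1 = m) ?ltnn //= modn_small; lia.
have -> : (f`_m *: (companion ^+ m : kend W) psi) (o 0)
  = f`_m *: ((companion ^+ m : kend W) psi (o 0)) by [].
rewrite em scalerA mulfV ?scale1r; last exact: lead_coef_neq0.
have -> : \sum_(i < m) (f`_i *: (companion ^+ i : kend W) psi) (o 0)
  = \sum_(i < m) f`_i *: psi i.
  apply: eq_bigr => i _; congr (_ *: _).
  by rewrite -[in RHS](ordn_id m_ge2 i); apply: companion_exp.
by rewrite addrC subrK.
Qed.

(** As psi l = (companion^l psi) 0 and f(companion) commutes with companion, the
    equation f(companion) = z need only be checked at 0, where it is the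
    definition of the last entry of companion psi. *)
Lemma keval_companion : keval f companion = pointwise 'I_m V z.
Proof.
apply: kendP => psi; apply/funext => l.
have cc : GRing.comm (companion ^+ l) (keval f companion).
  exact/comm_keval/commr_sym/commrX.
rewrite -[in LHS](ordn_id m_ge2 l) -(companion_exp _ (ltn_ord l)) -kendM cc kendM keval_at0.
by rewrite companion_exp // ordn_id.
Qed.

End Companion.

(** The index (l, v, j) stands for y^l v b^j; the powers of y with l < m replace
    the functions on the curve, since y has degree m over A(x,a,g). *)
Definition factor_index := (nat * seq bool * nat)%type.

Definition factor_dom (m : nat) (p : factor_index) : Prop :=
  let: (l, v, j) := p in [/\ (l < m)%N, Lsemigroup m v & (j < m)%N].

Definition factor_word (R : pzRingType) (y b : R) (p : factor_index) : R :=
  let: (l, v, j) := p in y ^+ l * (weval b y v * b ^+ j).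

Section FactorSpan.
Variables (k : fieldType) (n : nat) (g : {poly k}) (m : nat) (f : {poly k}).
Hypotheses (deg_f : size f = m.+1) (m_ge2 : (2 <= m)%N).
Variables (A1 A2 C : kalg k) (L : kmor A1 C) (R : kmor A2 C).
Variables (x a ai : A1) (y b bi : A2).
Hypotheses (aai : a * ai = 1) (aia : ai * a = 1).
Hypotheses (bbi : b * bi = 1) (bib : bi * b = 1) (bp : additive_pair m f y b).
Hypothesis genA2 : generated (fun u => [\/ u = y, u = b | u = bi]).
Hypothesis LR : forall p q, L p * R q = R q * L p.
Hypothesis genLR : generated (fun u => (exists p, u = L p) \/ (exists q, u = R q)).
Hypotheses (gf : keval g (L x) = keval f (R y)) (anbm : L a ^+ n = R b ^+ m).

Local Notation span := (in_span L (factor_dom m) (factor_word (R y) (R b))).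

Let inverse_top : R bi ^+ m = L ai ^+ n.
Proof.
exact: (inverse_expr_eq (kmor_inv R bbi) (kmor_inv R bib) (kmor_inv L aai)
  (kmor_inv L aia) (esym anbm)).
Qed.

(** The equation f(y) = g(x), solved for y^m. *)
Let y_top : R y ^+ m = L ((kin A1 (f`_m)^-1) * keval g x)
  - \sum_(i < m) L (kin A1 ((f`_m)^-1 * f`_i)) * R y ^+ i.
Proof.
have e : L (keval g x) = \sum_(i < m) kin C f`_i * R y ^+ i + kin C f`_m * R y ^+ m.
  by rewrite keval_mor gf /keval deg_f big_ord_recr.
have lead0 : f`_m != 0 := lead_coef_neq0 deg_f.
have -> : \sum_(i < m) L (kin A1 ((f`_m)^-1 * f`_i)) * R y ^+ i
    = kin C (f`_m)^-1 * \sum_(i < m) kin C f`_i * R y ^+ i.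
  by rewrite mulr_sumr; apply: eq_bigr => i _; rewrite kmor_in rmorphM mulrA.
rewrite (rmorphM L) kmor_in e -mulrBr addrC addKr.
by rewrite mulrA -rmorphM mulVf // rmorph1 mul1r.
Qed.

Let span_y u : span u -> span (R y * u).
Proof.
apply: (in_span_additive (t := fun u => R y * u)); first exact: mulrBr.
move=> r [[l v] j] [lt_lm Lv lt_jm]; rewrite mulrA -LR -mulrA /factor_word.
rewrite mulrA mulrA -[_ * R y * _]mulrA -exprS -mulrA.
set w := weval _ _ _ * _; have [lt_l1m|] := ltnP l.+1 m.
  exact: (in_span_gen L (factor_word (R y) (R b)) r (i := (l.+1, v, j)) (And3 lt_l1m Lv lt_jm)).
move=> le_ml; rewrite (_ : l.+1 = m); last by lia.
rewrite y_top; apply: in_spanM; rewrite mulrBl; apply: in_spanB.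
  have := in_span_gen L (factor_word (R y) (R b)) (kin A1 (f`_m)^-1 * keval g x) (i := (0%N, v, j)).
  by rewrite /factor_word expr0 mul1r; apply; split=> //; lia.
rewrite mulr_suml; apply: big_ind => [||i _]; [exact: in_span0|exact: in_spanD|].
rewrite -mulrA.
exact: (in_span_gen L (factor_word (R y) (R b)) _ (i := (i : nat, v, j)) (And3 (ltn_ord i) Lv lt_jm)).
Qed.

Lemma factor_word_span u : span u.
Proof.
move: u; apply: (product_ind LR genLR); [exact: in_span0|exact: in_spanD|].
move=> p q; apply: in_spanM; move: q.
apply: (Aone_spanning m_ge2 deg_f (x := y) (a := b) (ai := bi) (P := fun q => span (R q))).
- exact: bbi.
- exact: bib.
- exact: bp.
- exact: genA2.
- by rewrite rmorph0; apply: in_span0.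
- move=> c u v su sv; rewrite rmorphD rmorphM kmor_in; apply: in_spanD => //.
  by rewrite -(kmor_in L); apply: in_spanM.
- by move=> u su; rewrite rmorphM; apply: span_y.
- by move=> u su; rewrite rmorphM rmorphXn -anbm -rmorphXn; apply: in_spanM.
- by move=> u su; rewrite rmorphM rmorphXn inverse_top -rmorphXn; apply: in_spanM.
move=> V j lt_jm; rewrite kmor_word_exp.
have := in_span_gen L (factor_word (R y) (R b)) 1 (D := factor_dom m) (i := (0%N, state_word V, j)).
rewrite /factor_word expr0 rmorph1 !mul1r; apply; split=> //; first by lia.
by apply/Lsemigroup_state; exists V.
Qed.
End FactorSpan.

Section FactorCoordinates.
Variables (k : fieldType) (n : nat) (g : {poly k}) (m : nat) (f : {poly k}).
Hypotheses (deg_g : size g = n.+1) (n_ge2 : (2 <= n)%N).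
Hypotheses (deg_f : size f = m.+1) (m_ge2 : (2 <= m)%N).
Local Notation A := (Atwo n g m f).
Local Notation A1 := (Aone n g).
Local Notation il := (Atwo_l n g m f).
Local Notation V := (kvect (Aone n g)).
Local Notation o := (ordn m_ge2).
Local Notation B := ('I_m -> V : lmodType k).
Local Notation L := (state_fun m B).

Let act : kmor A1 (kend B) := kcomp (pointwise 'I_m V) (lmul A1).
Let z : kend V := lmul A1 (keval g (Aone_x n g)).
Let xi : kend B := companion f z m_ge2.

Let xi_act p : GRing.comm xi (act p).
Proof.
apply/commr_sym/companion_comm/(kmor_comm (lmul A1)).
apply/commr_sym; move: p; apply: (Aone_comm_image (h := kid A1)).
  exact/commr_sym/comm_keval.
exact/commr_sym/(additive_pair_g deg_g n_ge2)/Aone_pair.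
Qed.

Let f_xi : keval f xi = act (keval g (Aone_x n g)).
Proof. exact: (keval_companion z deg_f m_ge2). Qed.

Definition factor_act : kmor A (kend L) := Atwo_act deg_g n_ge2 deg_f m_ge2 xi_act f_xi.
Definition factor_value (phi : L) (u : A) : A1 := factor_act u phi [::] (o 0) (o 0).
Definition factor_indicator (p : factor_index) : L := fun V j l =>
  ((val l, state_word V, val j) == p)%:R.

Lemma factor_valueB phi : zmod_morphism (factor_value phi).
Proof.
move=> u v; have e := kmor_kendB factor_act u v phi.
exact: (congr1 (fun h : L => h [::] (o 0) (o 0)) e).
Qed.

Lemma factor_valueM phi p u : factor_value phi (il p * u) = p * factor_value phi u.
Proof.
have e := kmor_kendM factor_act (il p) u phi.
apply: etrans (congr1 (fun h : L => h [::] (o 0) (o 0)) e) _.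
have e1 := Atwo_act_l deg_g n_ge2 deg_f m_ge2 xi_act f_xi p (factor_act u phi) [::] (o 0).
exact: (congr1 (fun h : B => h (o 0)) e1).
Qed.

Let act_y_exp l u phi : factor_act (Atwo_y n g m f ^+ l * u) phi [::] (o 0)
  = (xi ^+ l) (factor_act u phi [::] (o 0)).
Proof.
elim: l => [|l IH].
  have e : Atwo_y n g m f ^+ 0 * u = u by apply: mul1r.
  exact: (congr1 (fun w => factor_act w phi [::] (o 0)) e).
have e : Atwo_y n g m f ^+ l.+1 * u = Atwo_y n g m f * (Atwo_y n g m f ^+ l * u).
  by rewrite exprS -mulrA.
apply: etrans (congr1 (fun w => factor_act w phi [::] (o 0)) e) _.
apply: etrans (Atwo_act_y deg_g n_ge2 deg_f m_ge2 xi_act f_xi _ phi) _.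
apply: etrans (congr1 xi IH) _.
by rewrite exprS.
Qed.

Lemma factor_value_word phi l W j : (l < m)%N -> (j < m)%N ->
  factor_value phi (factor_word (Atwo_y n g m f) (Atwo_b n g m f) (l, state_word W, j))
  = phi W (o j) (o l).
Proof.
move=> lt_lm lt_jm.
apply: etrans (congr1 (fun h : B => h (o 0)) (act_y_exp l _ phi)) _.
apply: etrans (companion_exp z deg_f m_ge2 _ lt_lm) _.
exact: (congr1 (fun h : B => h (o l))
  (Atwo_act_word deg_g n_ge2 deg_f m_ge2 xi_act f_xi W phi lt_jm)).
Qed.

Lemma factor_left_coordinates : left_coordinates il (factor_dom m)
  (factor_word (Atwo_y n g m f) (Atwo_b n g m f)) (fun p => factor_value (factor_indicator p)).
Proof.
split.
- by move=> p; apply: factor_valueB.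
- by move=> p c u; apply: factor_valueM.
- move=> p [[l v] j] _ [lt_lm /Lsemigroup_state[W ->] lt_jm].
  apply: etrans (factor_value_word _ W lt_lm lt_jm) _.
  by rewrite /factor_indicator /= !modn_small // eq_sym.
move=> u; apply: in_span_combination.
exact: (factor_word_span deg_f m_ge2 (Aone_aai n g) (Aone_aia n g)
  (Aone_aai m f) (Aone_aia m f) (Aone_pair deg_f)
  (@generated_Aone k m f) (@Atwo_comm k n g m f) (@generated_Atwo_lr k n g m f)
  (@Atwo_gf k n g m f) (@Atwo_anbm k n g m f) u).
Qed.
End FactorCoordinates.

(** * Left and right, first and second factor *)
Section Reversal.
Variables (k : fieldType) (A : kalg k) (r : kmor A (kop A)) (G : A -> Prop).
Hypotheses (genG : generated G) (rG : forall u, G u -> anti r u = u).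

Lemma anti_involution : cancel (anti r) (anti r).
Proof.
apply: genG => [|u Gu]; last by rewrite !rG.
split=> [c|u v ru rv|u v ru rv]; first by rewrite !anti_in.
  by rewrite !antiB ru rv.
by rewrite !antiM ru rv.
Qed.

Lemma anti_restrict (C : kalg k) (rC : kmor C (kop C)) (h : kmor A C) :
  (forall u, G u -> anti rC (h u) = h u) -> forall u, anti rC (h u) = h (anti r u).
Proof.
move=> rh; apply: genG => [|u Gu]; last by rewrite rh // rG.
split=> [c|u v ru rv|u v ru rv].
- by rewrite anti_in !kmor_in; apply: (kmor_in rC).
- by rewrite antiB !rmorphB -ru -rv; apply: (rmorphB rC).
by rewrite antiM !rmorphM -ru -rv; apply: (antiM rC).
Qed.
End Reversal.

Lemma two_sided_faithfully_flat (k : fieldType) (C A : kalg k) (h : kmor C A)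
    (rC : kmor C (kop C)) (rA : kmor A (kop A)) (I : eqType) (D : I -> Prop) b co i0 :
  cancel (anti rC) (anti rC) -> cancel (anti rA) (anti rA) ->
  (forall u, anti rA (h u) = h (anti rC u)) ->
  left_coordinates h D b co -> D i0 -> faithfully_flat_over h.
Proof.
move=> rCK rAK rh lc Di0; have ff := left_faithfully_flat lc Di0.
split; last by apply: ff.
by apply: right_faithfully_flat (right_of_left _ _ _ rCK _ _ rAK rh lc) _ Di0;
  first [exact: antiB | exact: antiM | exact: (rmorph1 rC)].
Qed.

Lemma left_coordinates_iso (R S S' : pzRingType) (h : {rmorphism R -> S})
    (h' : {rmorphism R -> S'}) (s : {rmorphism S -> S'}) (s' : {rmorphism S' -> S})
    (I : eqType) (D : I -> Prop) b co :
  cancel s s' -> cancel s' s -> (forall r, s (h r) = h' r) ->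
  left_coordinates h' D b co -> left_coordinates h D (s' \o b) (fun i => co i \o s).
Proof.
move=> sK s'K sh lc; split=> [i u v|i r u|i j Di Dj|u] /=.
- by rewrite rmorphB (coB lc).
- by rewrite rmorphM sh (coM lc).
- by rewrite s'K (co_dual lc).
have [l [c [Dl e]]] := co_span lc (s u); exists l, c; split=> //.
rewrite -[u]sK e rmorph_sum; apply: eq_bigr => i _.
by rewrite rmorphM -sh sK.
Qed.

Section CommutativeReversal.
Variables (k : fieldType) (A : kalg k).
Hypothesis mulA_comm : forall u v : A, u * v = v * u.

Definition to_op (u : A) : kop A := u.
Fact to_op_zmod : zmod_morphism to_op. Proof. by []. Qed.
Fact to_op_monoid : monoid_morphism to_op.
Proof. by split=> // u v; apply: mulA_comm. Qed.
HB.instance Definition _ := GRing.isZmodMorphism.Build A (kop A) to_op to_op_zmod.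
HB.instance Definition _ := GRing.isMonoidMorphism.Build A (kop A) to_op to_op_monoid.
Definition comm_reversal : kmor A (kop A) := @Kmor k A (kop A) to_op (fun=> erefl).
End CommutativeReversal.

(** * Hopf subalgebras, coideals, and bases over a basis *)
Section HopfSubalgebra.
Variables (k : fieldType) (B H : kalg k) (DB : hopf B) (DH : hopf H) (h : kmor B H).
Variables (SB : kmor B (kop B)) (SH : kmor H (kop H)) (x a ai : B).
Hypotheses (SBE : forall u, antipode DB u = anti SB u).
Hypotheses (SHE : forall u, antipode DH u = anti SH u).
Hypothesis genB : generated (fun u => [\/ u = x, u = a | u = ai]).
Hypotheses (cB : [/\ comul DB x = kt 1 x + kt x a, comul DB a = kt a a
  & comul DB ai = kt ai ai]).
Hypotheses (cH : [/\ comul DH (h x) = kt 1 (h x) + kt (h x) (h a),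
  comul DH (h a) = kt (h a) (h a) & comul DH (h ai) = kt (h ai) (h ai)]).
Hypotheses (eB : [/\ counit DB x = 0, counit DB a = 1 & counit DB ai = 1]).
Hypotheses (eH : [/\ counit DH (h x) = 0, counit DH (h a) = 1 & counit DH (h ai) = 1]).
Hypotheses (sB : [/\ anti SB x = - (x * ai), anti SB a = ai & anti SB ai = a]).
Hypotheses (sH : [/\ anti SH (h x) = - (h x * h ai), anti SH (h a) = h ai
  & anti SH (h ai) = h a]).

Lemma hopf_subalgebra_skew : injective h -> hopf_subalgebra DB DH h.
Proof.
have [cBx cBa cBi] := cB; have [cHx cHa cHi] := cH.
have [eBx eBa eBi] := eB; have [eHx eHa eHi] := eH.
have [sBx sBa sBi] := sB; have [sHx sHa sHi] := sH.
have hh u v : ktmap_mor h h (kt u v) = kt (h u) (h v) by apply: ktmap_mor_kt.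
move=> hI; split=> // b.
- rewrite -ktmap_morE.
  have E : kcomp (comul DH) h =1 kcomp (ktmap_mor h h) (comul DB).
    apply: (kmor_ext genB) => u [] ->; rewrite !kcompE.
    + by rewrite cHx cBx rmorphD !hh rmorph1.
    + by rewrite cHa cBa hh.
    by rewrite cHi cBi hh.
  exact: E.
- have E : kcomp (counit DH) h =1 counit DB.
    apply: (kmor_ext genB) => u [] ->; rewrite kcompE.
    + by rewrite eHx eBx.
    + by rewrite eHa eBa.
    by rewrite eHi eBi.
  exact: E.
rewrite SHE SBE; move: b; apply: genB; last first.
  move=> u [] ->.
  - by rewrite sHx sBx rmorphN rmorphM.
  - by rewrite sHa sBa.
  by rewrite sHi sBi.
split=> [c|u v Su Sv|u v Su Sv].
- by rewrite kmor_in !anti_in kmor_in.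
- by rewrite antiB !rmorphB antiB Su Sv.
by rewrite antiM !rmorphM antiM Su Sv.
Qed.
End HopfSubalgebra.

(** The elements whose comultiplication lies in the image of C @ H form a
    subalgebra, as that image is itself a subalgebra. *)
Lemma coideal_of_generators (k : fieldType) (C H : kalg k) (D : hopf H)
    (h : kmor C H) (G : C -> Prop) :
  generated G ->
  (forall c, G c -> exists a, comul D (h c) = kt 1 (h c) + kt (h c) a) ->
  forall c, exists t : ktens C H, comul D (h c) = ktmap h idfun t.
Proof.
move=> genG hG; pose F := ktmap_mor h (kid H).
suff S c : exists t, comul D (h c) = F t.
  by move=> c; have [t e] := S c; exists t; rewrite e; apply: ktmap_morE.
move: c; apply: genG => [|c Gc]; last first.
  have [a e] := hG c Gc; exists (kt 1 (h c) + kt c a).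
  rewrite rmorphD e.
  by congr (_ + _); apply: esym; [|apply: ktmap_mor_kt];
    apply: etrans (ktmap_mor_kt _ _ _ _) _; rewrite rmorph1.
split=> [u|u v [s es] [t et]|u v [s es] [t et]].
- by exists (kin _ u); rewrite !kmor_in.
- by exists (s - t); rewrite !rmorphB es et.
by exists (s * t); rewrite !rmorphM es et.
Qed.

Section BasisOverBasis.
Variables (k : fieldType) (C A : kalg k) (h : kmor C A) (I J : eqType).
Variables (D : J -> Prop) (c : I -> C) (b : J -> A) (co : J -> A -> C).
Hypothesis lc : left_coordinates h D b co.
Hypothesis cb : is_basis (V := kvect C) (fun=> True) c.

Lemma basis_over_basis : is_basis (V := kvect A) (fun p : I * J => D p.2)
  (fun p => h (c p.1) * b p.2).
Proof.
split=> [s d us Ds e [i j] sij|u].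
  (* The coordinate at j of the relation keeps the terms of second index j. *)
  pose t := [seq p.1 | p <- [seq p <- s | p.2 == j]].
  have Dj : D j := Ds _ sij.
  have ut : uniq t.
    rewrite map_inj_in_uniq ?filter_uniq // => -[i1 j1] [i2 j2].
    by rewrite !mem_filter /= => /andP[/eqP -> _] /andP[/eqP -> _] ->.
  have ti : i \in t.
    by apply/mapP; exists (i, j); rewrite // mem_filter eqxx.
  apply: (proj1 cb t (fun i => d (i, j)) ut _ _ i ti) => //.
  have := congr1 (co j) e; rewrite (zmod_sum _ _ (coB lc j)) (zmod0 (coB lc j)) => e0.
  rewrite -[RHS]e0 /t big_map big_filter big_mkcond /=.
  rewrite big_seq [RHS]big_seq; apply: eq_bigr => -[i1 j1] sp /=.
  have e1 : d (i1, j1) *: (h (c i1) * b j1 : kvect A)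
      = h (kin C (d (i1, j1)) * c i1) * b j1 :> A.
    by rewrite rmorphM kmor_in -mulrA.
  apply/esym; apply: etrans (congr1 (co j) e1) _.
  apply: etrans (coM lc j _ _) _; rewrite (co_dual lc Dj (Ds _ sp)) eq_sym.
  by case: eqP => /= [->|_]; [apply: mulr1|apply: mulr0].
suff S : in_span (kin A) (fun p : I * J => D p.2) (fun p => h (c p.1) * b p.2) u.
  by have [s [d [Ds e]]] := in_span_combination S; exists s, d.
have [s [r [Ds ->]]] := co_span lc u.
rewrite big_seq; apply: big_ind => [||j sj]; [exact: in_span0|exact: in_spanD|].
have [s' [d [_ ->]]] := proj2 cb (r j).
rewrite rmorph_sum mulr_suml; apply: big_ind => [||i _]; [exact: in_span0|exact: in_spanD|].
have -> : h (d i *: (c i : kvect C)) = kin A (d i) * h (c i) by rewrite rmorphM kmor_in.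
rewrite -mulrA; exact: (in_span_gen (kin A) _ _ (i := (i, j)) (Ds j sj)).
Qed.
End BasisOverBasis.

(** * Exchange of the factors and reversal of words *)
Lemma relations_swap (k : fieldType) n (g : {poly k}) m (f : {poly k}) (B : kalg k)
    (X U V Y W Z : B) :
  Atwo_relations n g m f X U V Y W Z -> Atwo_relations m f n g Y W Z X U V.
Proof.
case=> UV VU XU WZ ZW YW cXY cXW cUY cUW gf ab.
by apply: AtwoRelations => //; apply: commr_sym.
Qed.

Section Assembly.
Variables (k : fieldType) (n : nat) (g : {poly k}) (m : nat) (f : {poly k}).
Hypotheses (deg_g : size g = n.+1) (n_ge2 : (2 <= n)%N) (g0 : g`_0 = 0).
Hypotheses (deg_f : size f = m.+1) (m_ge2 : (2 <= m)%N) (f0 : f`_0 = 0).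
Local Notation A := (Atwo n g m f).
Local Notation A' := (Atwo m f n g).
Local Notation A1 := (Aone n g).
Local Notation il := (Atwo_l n g m f).
Local Notation ir := (Atwo_r n g m f).

Definition Atwo_swap : kmor A A' :=
  sval (Atwo_mor deg_g deg_f (relations_swap (Atwo_satisfies deg_f deg_g))).

Lemma Atwo_swapE :
  [/\ Atwo_swap (Atwo_x n g m f) = Atwo_y m f n g,
      Atwo_swap (Atwo_a n g m f) = Atwo_b m f n g
    & Atwo_swap (Atwo_ai n g m f) = Atwo_bi m f n g] /\
  [/\ Atwo_swap (Atwo_y n g m f) = Atwo_x m f n g,
      Atwo_swap (Atwo_b n g m f) = Atwo_a m f n g
    & Atwo_swap (Atwo_bi n g m f) = Atwo_ai m f n g].
Proof. exact: (svalP (Atwo_mor deg_g deg_f (relations_swap (Atwo_satisfies deg_f deg_g)))). Qed.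

Lemma Atwo_swap_r q : Atwo_swap (ir q) = Atwo_l m f n g q.
Proof.
have [_ [sy sb sbi]] := Atwo_swapE.
have E : kcomp Atwo_swap ir =1 Atwo_l m f n g.
  by apply: (kmor_ext (@generated_Aone k m f)) => u [] ->; [exact: sy|exact: sb|exact: sbi].
exact: E.
Qed.

Definition Atwo_reversal : kmor A (kop A) :=
  sval (Atwo_mor deg_g deg_f (relations_op (Atwo_satisfies deg_g deg_f))).

Lemma Atwo_reversalE u : Atwo_letter u -> anti Atwo_reversal u = u.
Proof.
have [[rx ra rai] [ry rb rbi]] :=
  svalP (Atwo_mor deg_g deg_f (relations_op (Atwo_satisfies deg_g deg_f))).
by case=> -[] ->; [exact: rx|exact: ra|exact: rai|exact: ry|exact: rb|exact: rbi].
Qed.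

Let op_pair : additive_pair n g (B := kop A1) (Aone_x n g) (Aone_a n g) :=
  additive_pair_op (Aone_pair deg_g).

Definition Aone_reversal : kmor A1 (kop A1) :=
  Aone_lift deg_g (B := kop A1) (U := Aone_a n g) (V := Aone_ai n g)
    (Aone_aia n g) (Aone_aai n g) op_pair.

Lemma Aone_reversalE u : Aone_gen u -> anti Aone_reversal u = u.
Proof.
case=> ->.
- exact: (Aone_lift_x deg_g (B := kop A1) (U := Aone_a n g) (V := Aone_ai n g)
    (Aone_aia n g) (Aone_aai n g) op_pair).
- exact: (Aone_lift_a deg_g (B := kop A1) (U := Aone_a n g) (V := Aone_ai n g)
    (Aone_aia n g) (Aone_aai n g) op_pair).
exact: (Aone_lift_ai deg_g (B := kop A1) (U := Aone_a n g) (V := Aone_ai n g)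
    (Aone_aia n g) (Aone_aai n g) op_pair).
Qed.
End Assembly.

(** * The theorem *)
Lemma kmor_cancel (k : fieldType) (A B : kalg k) (G : A -> Prop) (s : kmor A B) (t : kmor B A) :
  generated G -> (forall u, G u -> t (s u) = u) -> cancel s t.
Proof. by move=> genG ts; apply: (kmor_ext (f := kcomp t s) (g := kid A) genG). Qed.

Lemma anti_fixed_image (k : fieldType) (C A : kalg k) (r : kmor A (kop A)) (h : kmor C A) c u :
  h c = u -> anti r u = u -> anti r (h c) = h c.
Proof. by move=> ->. Qed.

Section Conclusion.
Variables (k : fieldType) (n : nat) (g : {poly k}) (m : nat) (f : {poly k}).
Hypotheses (deg_g : size g = n.+1) (n_ge2 : (2 <= n)%N) (g0 : g`_0 = 0).
Hypotheses (deg_f : size f = m.+1) (m_ge2 : (2 <= m)%N) (f0 : f`_0 = 0).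
Local Notation A := (Atwo n g m f).
Local Notation il := (Atwo_l n g m f).
Local Notation ir := (Atwo_r n g m f).

Let rev : kmor A (kop A) := Atwo_reversal deg_g deg_f.
Let revK : cancel (anti rev) (anti rev).
Proof. exact: (anti_involution (@generated_Atwo k n g m f) (Atwo_reversalE deg_g deg_f)). Qed.

Let rev_l u : anti rev (il u) = il (anti (Aone_reversal deg_g) u).
Proof.
apply: (anti_restrict (@generated_Aone k n g) (Aone_reversalE deg_g)) => v Gv.
apply: (Atwo_reversalE deg_g deg_f); left.
by case: Gv => ->; [constructor 1|constructor 2|constructor 3].
Qed.

Let rev_r u : anti rev (ir u) = ir (anti (Aone_reversal deg_f) u).
Proof.
apply: (anti_restrict (@generated_Aone k m f) (Aone_reversalE deg_f)) => v Gv.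
apply: (Atwo_reversalE deg_g deg_f); right.
by case: Gv => ->; [constructor 1|constructor 2|constructor 3].
Qed.

Let factor0 p : (2 <= p)%N -> factor_dom p (0%N, [::], 0%N).
Proof. by move=> p2; split; [lia| |lia]; apply/Lsemigroup_state; exists [::]. Qed.

Let swapK (n1 : nat) (g1 : {poly k}) m1 (f1 : {poly k}) (dg : size g1 = n1.+1) (df : size f1 = m1.+1) :
  cancel (Atwo_swap dg df) (Atwo_swap df dg).
Proof.
have [[sx sa sai] [sy sb sbi]] := Atwo_swapE dg df.
have [[tx ta tai] [ty tb tbi]] := Atwo_swapE df dg.
apply: (kmor_cancel (@generated_Atwo k n1 g1 m1 f1)) => u [] [] ->.
- exact: etrans (congr1 _ sx) ty.
- exact: etrans (congr1 _ sa) tb.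
- exact: etrans (congr1 _ sai) tbi.
- exact: etrans (congr1 _ sy) tx.
- exact: etrans (congr1 _ sb) ta.
- exact: etrans (congr1 _ sbi) tai.
Qed.

Let lc := factor_left_coordinates deg_g n_ge2 deg_f m_ge2.
Let rc := left_coordinates_iso (swapK deg_g deg_f) (swapK deg_f deg_g)
  (Atwo_swap_r deg_g deg_f) (factor_left_coordinates deg_f m_ge2 deg_g n_ge2).

Lemma Atwo_l_injective : injective il.
Proof. exact: (coordinates_injective lc (factor0 m_ge2)). Qed.

Lemma Atwo_r_injective : injective ir.
Proof. exact: (coordinates_injective rc (factor0 n_ge2)). Qed.

Lemma Atwo_l_faithfully_flat : faithfully_flat_over il.
Proof.
exact: (two_sided_faithfully_flat
  (anti_involution (@generated_Aone k n g) (Aone_reversalE deg_g)) revK rev_l lc (factor0 m_ge2)).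
Qed.

Lemma Atwo_r_faithfully_flat : faithfully_flat_over ir.
Proof.
exact: (two_sided_faithfully_flat
  (anti_involution (@generated_Aone k m f) (Aone_reversalE deg_f)) revK rev_r rc (factor0 n_ge2)).
Qed.

Local Notation D := (Atwo_hopf deg_g g0 deg_f f0).

Lemma Atwo_l_hopf_subalgebra : hopf_subalgebra (Aone_hopf deg_g g0) D il.
Proof.
have [cH _] := Atwo_comulE deg_g g0 deg_f f0.
have [eH _] := Atwo_counitE deg_g g0 deg_f f0.
have [sH _] := Atwo_antipodeE deg_g g0 deg_f f0.
exact: (@hopf_subalgebra_skew k (Aone n g) A (Aone_hopf deg_g g0) D il
  (Aone_antipode deg_g g0) (Atwo_antipode deg_g g0 deg_f f0)
  (Aone_x n g) (Aone_a n g) (Aone_ai n g) (fun=> erefl) (fun=> erefl)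
  (@generated_Aone k n g) (Aone_comulE deg_g g0) cH (Aone_counitE deg_g) eH
  (Aone_antipodeE deg_g g0) sH Atwo_l_injective).
Qed.

Lemma Atwo_r_hopf_subalgebra : hopf_subalgebra (Aone_hopf deg_f f0) D ir.
Proof.
have [_ cH] := Atwo_comulE deg_g g0 deg_f f0.
have [_ eH] := Atwo_counitE deg_g g0 deg_f f0.
have [_ sH] := Atwo_antipodeE deg_g g0 deg_f f0.
exact: (@hopf_subalgebra_skew k (Aone m f) A (Aone_hopf deg_f f0) D ir
  (Aone_antipode deg_f f0) (Atwo_antipode deg_g g0 deg_f f0)
  (Aone_x m f) (Aone_a m f) (Aone_ai m f) (fun=> erefl) (fun=> erefl)
  (@generated_Aone k m f) (Aone_comulE deg_f f0) cH (Aone_counitE deg_f) eH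
  (Aone_antipodeE deg_f f0) sH Atwo_r_injective).
Qed.

Section CurveInclusion.
Variable iota : kmor (curve g f) A.
Hypotheses (iota_x : iota (curve_x g f) = Atwo_x n g m f)
  (iota_y : iota (curve_y g f) = Atwo_y n g m f).

Let cc := pbw_left_coordinates deg_g n_ge2 deg_f m_ge2 iota_x iota_y.

Let pbw0 : pbw_dom n m ([::], [::], 0, 0%N).
Proof. by split; [| |lia]; apply/Lsemigroup_state; exists [::]. Qed.

Let rev_iota c : anti rev (iota c) = iota (anti (comm_reversal (@curveC k g f)) c).
Proof.
apply: (anti_restrict (r := comm_reversal (@curveC k g f)) (@generated_curve k g f)) => [//|u [] ->].
  exact: (anti_fixed_image iota_x (Atwo_reversalE deg_g deg_f (or_introl (Or31 _ _ erefl)))).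
exact: (anti_fixed_image iota_y (Atwo_reversalE deg_g deg_f (or_intror (Or31 _ _ erefl)))).
Qed.

Lemma curve_quantum_homogeneous_space : quantum_homogeneous_space D iota.
Proof.
have [[Dx _ _] [Dy _ _]] := Atwo_comulE deg_g g0 deg_f f0.
split; first exact: (coordinates_injective cc pbw0).
  apply: (coideal_of_generators (@generated_curve k g f)) => c [] ->.
    by exists (Atwo_a n g m f); rewrite iota_x; exact: Dx.
  by exists (Atwo_b n g m f); rewrite iota_y; exact: Dy.
exact: (two_sided_faithfully_flat (rC := comm_reversal (@curveC k g f))
  (fun=> erefl) revK rev_iota cc pbw0).
Qed.

Lemma pbw_basis_over_curve : is_basis (V := restrL iota) (pbw_dom n m) (@pbw_elt k n g m f).
Proof. exact: (left_is_basis cc). Qed.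

Lemma pbw_basis (c : nat -> curve g f) : is_basis (V := kvect (curve g f)) (fun=> True) c ->
  is_basis (V := kvect A) (fun p : nat * pbw_index => pbw_dom n m p.2)
    (fun p => iota (c p.1) * pbw_elt n g m f p.2).
Proof. exact: (basis_over_basis cc). Qed.

End CurveInclusion.
End Conclusion.

Theorem theorem5p2 (k : closedFieldType) (n m : nat) (g f : {poly k})
    (char0 : [pchar k] =i pred0)
    (n_ge2 : (2 <= n)%N) (m_ge2 : (2 <= m)%N)
    (deg_g : size g = n.+1) (g0 : g`_0 = 0)
    (deg_f : size f = m.+1) (f0 : f`_0 = 0)
    (g_case : (n <= 5)%N \/ exists d, g = 'X^d)
    (f_case : (m <= 5)%N \/ exists d, f = 'X^d) :
  exists (Dx : hopf (Aone n g)) (Dy : hopf (Aone m f))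
         (D : hopf (Atwo n g m f)) (iota : kmor (curve g f) (Atwo n g m f)),
  [/\ (* the Hopf structures and the map from O(C) are the standard ones *)
      [/\ hopf_on Dx (Aone_x n g) (Aone_a n g) (Aone_ai n g),
          hopf_on Dy (Aone_x m f) (Aone_a m f) (Aone_ai m f),
          hopf_on D (Atwo_x n g m f) (Atwo_a n g m f) (Atwo_ai n g m f),
          hopf_on D (Atwo_y n g m f) (Atwo_b n g m f) (Atwo_bi n g m f) &
          iota (curve_x g f) = Atwo_x n g m f /\
          iota (curve_y g f) = Atwo_y n g m f],
      (* (i) *)
      quantum_homogeneous_space D iota,
      (* (ii) *)
      [/\ hopf_subalgebra Dx D (Atwo_l n g m f),
          hopf_subalgebra Dy D (Atwo_r n g m f),
          faithfully_flat_over (Atwo_l n g m f) &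
          faithfully_flat_over (Atwo_r n g m f)] &
      (* (iii) *)
      (n <= 5)%N -> (m <= 5)%N ->
      (forall c : nat -> curve g f,
         is_basis (V := kvect (curve g f)) (fun=> True) c ->
         is_basis (V := kvect (Atwo n g m f))
           (fun p : nat * pbw_index => pbw_dom n m p.2)
           (fun p => iota (c p.1) * pbw_elt n g m f p.2)) /\
      is_basis (V := restrL iota) (pbw_dom n m) (@pbw_elt k n g m f)].
Proof.
have [iota [iota_x iota_y]] := curve_mor
  (@Atwo_comm k n g m f (Aone_x n g) (Aone_x m f)) (@Atwo_gf k n g m f).
exists (Aone_hopf deg_g g0), (Aone_hopf deg_f f0), (Atwo_hopf deg_g g0 deg_f f0), iota.
split.
- split; [exact: Aone_hopf_on|exact: Aone_hopf_on|exact: Atwo_hopf_onl|exact: Atwo_hopf_onr|].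
  by split; [exact: iota_x|exact: iota_y].
- exact: (curve_quantum_homogeneous_space deg_g n_ge2 g0 deg_f m_ge2 f0 iota_x iota_y).
- split; [exact: (Atwo_l_hopf_subalgebra deg_g n_ge2 g0 deg_f m_ge2 f0)|
    exact: (Atwo_r_hopf_subalgebra deg_g n_ge2 g0 deg_f m_ge2 f0)| |].
    exact: (Atwo_l_faithfully_flat deg_g n_ge2 deg_f m_ge2).
  exact: (Atwo_r_faithfully_flat deg_g n_ge2 deg_f m_ge2).
move=> _ _; split; first by move=> c; exact: (pbw_basis deg_g n_ge2 deg_f m_ge2 iota_x iota_y).
exact: (pbw_basis_over_curve deg_g n_ge2 deg_f m_ge2 iota_x iota_y).
Qed.
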